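(* There is a polynomial-time algorithm that, given a connected graph $G$ with at least two vertices, outputs a spanning transition walk with two agents of length at most $\left(3-\tfrac{1}{21}\right)h_2(G)$. If $G$ contains no cycle of length four, the output walk has length at most $2\,h_2(G)$.
   Context: All graphs are finite, simple, undirected and connected. A configuration of $2$ agents is an ordered pair $(v_1,v_2)$ with $(v_1,v_2)\in E$. Two configurations $(v_1,v_2)$, $(v'_1,v'_2)$ are adjacent if for each $i\in\{1,2\}$ either $v_i=v'_i$ or $(v_i,v'_i)\in E$. A transition walk of length $l$ is a sequence $\mathcal C_0,\dots,\mathcal C_l$ of configurations with consecutive ones adjacent; it is spanning if every vertex of $G$ lies in some $\mathcal C_t$. $h_2(G)$ is the minimum length of a spanning transition walk with two agents. *)

(* Defs.v *)
From Stdlib Require Import ClassicalEpsilon.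
From mathcomp Require Import all_boot.
Set Implicit Arguments. Unset Strict Implicit. Unset Printing Implicit Defensive.

(* A simple graph on a finite type T is a symmetric irreflexive relation e. *)
Section Walks.
Variables (T : finType) (e : rel T).

Definition config (p : T * T) : bool := e p.1 p.2.

Definition config_adj (p q : T * T) : bool :=
  ((p.1 == q.1) || e p.1 q.1) && ((p.2 == q.2) || e p.2 q.2).

Definition transition_walk (s : seq (T * T)) : bool :=
  all config s && (if s is x :: s' then path config_adj x s' else false).

Definition walk_len (s : seq (T * T)) : nat := (size s).-1.

Definition spanning (s : seq (T * T)) : bool :=
  [forall v : T, has (fun p => (p.1 == v) || (p.2 == v)) s].

Definition spanning_walk (s : seq (T * T)) : bool :=
  transition_walk s && spanning s.

Definition has_spanning_walk_of_len (l : nat) : bool :=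
  [exists w : (l.+1).-tuple (T * T), spanning_walk w].

(* h_2(G): minimum length of a spanning transition walk (0 if none exists) *)
Definition h2 : nat :=
  match excluded_middle_informative (exists l, has_spanning_walk_of_len l) with
  | left H => ex_minn (P := has_spanning_walk_of_len) H
  | right _ => 0
  end.

(* G contains a cycle of length four (not necessarily induced) *)
Definition has_C4 : Prop :=
  exists a b c d : T, [/\ uniq [:: a; b; c; d], e a b, e b c & e c d /\ e d a].

End Walks.

(* Registers hold naturals; instructions increment / decrement by one, test for
   zero, and load / store with indirect addressing.  Since every step changes a
   register value by at most one, register values stay polynomially bounded in
   polynomial time, and polynomial time in this model coincides with the usual
   notion (Turing machines). *)
Inductive instr :=
| Inc of nat
| Dec of nat
| Jz of nat & nat
| Rd of nat & nat
| Wr of nat & nat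
| Halt.

Definition regs := nat -> nat.
Definition upd (R : regs) (r v : nat) : regs := fun x => if x == r then v else R x.

Definition step (P : seq instr) (s : nat * regs) : option (nat * regs) :=
  let: (pc, R) := s in
  match nth Halt P pc with
  | Inc r => Some (pc.+1, upd R r (R r).+1)
  | Dec r => Some (pc.+1, upd R r (R r).-1)
  | Jz r l => Some (if R r == 0 then l else pc.+1, R)
  | Rd a b => Some (pc.+1, upd R a (R (R b)))
  | Wr a b => Some (pc.+1, upd R (R a) (R b))
  | Halt => None
  end.

Fixpoint run (P : seq instr) (fuel : nat) (s : nat * regs) : option regs :=
  match step P s with
  | None => Some s.2
  | Some s' => if fuel is f.+1 then run P f s' else None
  end.

(* Input encoding of a graph on vertex set {0..n-1}: R[0] = n,
   R[1 + i*n + j] = 1 iff ij is an edge, all other registers 0. *)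
Definition edge_nat (n : nat) (e : rel 'I_n) (i j : nat) : bool :=
  [exists u : 'I_n, exists v : 'I_n, [&& val u == i, val v == j & e u v]].

Definition input_regs (n : nat) (e : rel 'I_n) : regs :=
  fun r => if r == 0 then n
           else if r <= n * n then nat_of_bool (edge_nat e ((r.-1) %/ n) ((r.-1) %% n))
           else 0.

Definition output_walk (R : regs) : seq (nat * nat) :=
  mkseq (fun t => (R (1 + 2 * t), R (2 + 2 * t))) (R 0).+1.

(* Main.v *)
(** Start with a one-vertex set A and enlarge it greedily: attach, in this order
    of preference, ears (paths, possibly closed) with 3 or 4 inner vertices
    outside A, ears with 2 inner vertices, and a pendant path of two vertices if
    some vertex is at distance 2 from A.  In the end every vertex outside A is
    adjacent to A.  Going through the ears backwards, each is laid down as a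
    multigraph whose parities complete those of the later ears; reversing all
    parities of an ear is possible, so at most two edges are even, of which one
    is left out and the other doubled.  An ear with m inner vertices thus costs
    at most m + 1 edges, and the result is a connected multigraph on A with all
    degrees even and c edges in total.  The two agents follow a closed Eulerian
    trail of it, and visit the vertices outside A at cost one each, so that the
    walk has length at most c - 2 + n - #|A|.

    For the lower bound, take any spanning walk of length l = d + q, where the d
    "double" steps bring both agents to new vertices.  Then n <= 2 + 2d + q,
    which settles the case without 4-cycles, since a double step closes one.
    Three consecutive double steps span a 2x3 grid of new vertices; if the first
    vertices of such a grid to enter A do so through an ear with 2 inner vertices
    or a pendant path, then, up to one grid per pendant path, a long ear fits
    inside the grid afterwards or would have been available before.  Vertices of
    A and vertices at distance 2 from A belong to different runs of consecutive
    double steps when no ear is left, hence there are at most q pendant paths.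
    Charging the grids to long ears and pendant paths gives
    18 * walk <= 53 d + 50 q. *)

Require Import Defs.
From Stdlib Require Import FunctionalExtensionality ClassicalEpsilon.
From mathcomp Require Import all_boot zify.
Set Implicit Arguments. Unset Strict Implicit. Unset Printing Implicit Defensive.

(** * Structured code for the register machine *)

(** The factor 3 is what ears with two inner vertices give: they cost 3/2 edges per vertex of [A],
    hence about [3n/2] steps in total, and [n] is about [2d]. A pendant path costs 2 per vertex, but
    there are at most [q] of them, and each of the [q] other steps reaches at most one new vertex,
    which leaves room to pay for it. A long ear with three inner vertices costs 4 instead of 9/2;
    the saved half edge is spread over the at most three grids that it spoils, 1/6 each, and a grid
    stands for three double steps. This yields [3 - 1/18 = 53/18] per double step, slightly less
    than [62/21]. On the machine side two obstacles shape the code. Increments and decrements change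
    a register by one only, so the algorithm is written in a loop language whose expressions add
    nothing but constants; values and running times then stay polynomial by a syntactic argument.
    And the input fills the registers from 1 on, so that no fixed work register is free: the low
    input bits have to be saved before anything can be computed. *)

Fixpoint steps (P : seq instr) (t : nat) (s : nat * regs) : option (nat * regs) :=
  if t is t'.+1 then (if step P s is Some s' then steps P t' s' else None) else Some s.

Lemma steps_add P t1 t2 s s1 :
  steps P t1 s = Some s1 -> steps P (t1 + t2) s = steps P t2 s1.
Proof.
by elim: t1 s => [|t IH] s /=; [case=> -> | case: (step P s) => // s' /IH].
Qed.

Lemma run_steps P t s s1 f :
  steps P t s = Some s1 -> run P (t + f) s = run P f s1.
Proof.
by elim: t s => [|t IH] s /=; [case=> -> | case: (step P s) => // s' /IH].
Qed.

Lemma run_halted P f s : step P s = None -> run P f s = Some s.2.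
Proof. by case: f => [|f] /= ->. Qed.

Definition code_at (P : seq instr) (pc : nat) (cs : seq instr) :=
  forall i, i < size cs -> nth Halt P (pc + i) = nth Halt cs i.

Lemma code_at_cat P pc c1 c2 :
  code_at P pc (c1 ++ c2) -> code_at P pc c1 /\ code_at P (pc + size c1) c2.
Proof.
move=> H; split=> i Hi.
  by rewrite H ?size_cat ?ltn_addr // nth_cat Hi.
by rewrite -addnA H ?size_cat ?ltn_add2l // nth_cat ltnNge leq_addr /= addKn.
Qed.

Lemma code_at_cons P pc i cs :
  code_at P pc (i :: cs) -> nth Halt P pc = i /\ code_at P pc.+1 cs.
Proof.
move=> H; split; first by have := H 0 isT; rewrite addn0.
by move=> j Hj; have := H j.+1 Hj; rewrite addnS.
Qed.

Definition zreg := 1.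

Inductive raw :=
| RI of instr
| RNop
| RSeq of raw & raw
| RIf of nat & raw & raw
| RWh of nat & raw.

Fixpoint rsz (c : raw) : nat :=
  match c with
  | RI _ => 1
  | RNop => 0
  | RSeq a b => rsz a + rsz b
  | RIf _ a b => rsz b + (rsz a).+2
  | RWh _ a => (rsz a).+2
  end.

(* Register [zreg] holds 0, so that [Jz zreg l] is an unconditional jump.
   [RIf r a b] runs [a] when register [r] is zero. *)
Fixpoint rcode (c : raw) (pc : nat) : seq instr :=
  match c with
  | RI i => [:: i]
  | RNop => [::]
  | RSeq a b => rcode a pc ++ rcode b (pc + rsz a)
  | RIf r a b => Jz r (pc + (rsz b).+2) :: rcode b pc.+1 ++
                 Jz zreg (pc + (rsz b + (rsz a).+2)) :: rcode a (pc + (rsz b).+2)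
  | RWh r a => Jz r (pc + (rsz a).+2) :: rcode a pc.+1 ++ [:: Jz zreg pc]
  end.

Lemma size_rcode c pc : size (rcode c pc) = rsz c.
Proof.
elim: c pc => //= [a IHa b IHb|r a IHa b IHb|r a IHa] pc;
  rewrite ?size_cat /= ?size_cat ?IHa ?IHb /=; lia.
Qed.

(** Total correctness with a time bound. Quantifying over [P] and [pc] makes triples composable
    although the jump targets in [rcode] are absolute; execution always leaves a block by falling
    through its end. *)
Definition tr (c : raw) (R : regs) (T : nat) (Q : regs -> Prop) :=
  forall P pc, code_at P pc (rcode c pc) ->
  exists t R', [/\ t <= T, steps P t (pc, R) = Some (pc + rsz c, R') & Q R'].

Lemma tr_conseq c R T T' (Q Q' : regs -> Prop) :
  tr c R T Q -> T <= T' -> (forall R', Q R' -> Q' R') -> tr c R T' Q'.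
Proof.
move=> H HT HQ P pc /H [t [R' [Ht Hs HR]]]; exists t, R'; split=> //; last exact: HQ.
exact: leq_trans HT.
Qed.

Lemma tr_inc r R T (Q : regs -> Prop) :
  0 < T -> Q (upd R r (R r).+1) -> tr (RI (Inc r)) R T Q.
Proof.
move=> HT HQ P pc /code_at_cons [H _].
by exists 1, (upd R r (R r).+1); split=> //; rewrite /= /step H addn1.
Qed.

Lemma tr_dec r R T (Q : regs -> Prop) :
  0 < T -> Q (upd R r (R r).-1) -> tr (RI (Dec r)) R T Q.
Proof.
move=> HT HQ P pc /code_at_cons [H _].
by exists 1, (upd R r (R r).-1); split=> //; rewrite /= /step H addn1.
Qed.

Lemma tr_rd a b R T (Q : regs -> Prop) :
  0 < T -> Q (upd R a (R (R b))) -> tr (RI (Rd a b)) R T Q.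
Proof.
move=> HT HQ P pc /code_at_cons [H _].
by exists 1, (upd R a (R (R b))); split=> //; rewrite /= /step H addn1.
Qed.

Lemma tr_wr a b R T (Q : regs -> Prop) :
  0 < T -> Q (upd R (R a) (R b)) -> tr (RI (Wr a b)) R T Q.
Proof.
move=> HT HQ P pc /code_at_cons [H _].
by exists 1, (upd R (R a) (R b)); split=> //; rewrite /= /step H addn1.
Qed.

Lemma tr_nop R T (Q : regs -> Prop) : Q R -> tr RNop R T Q.
Proof. by move=> HQ P pc _; exists 0, R; split=> //=; rewrite addn0. Qed.

Lemma tr_seq a b R T1 T2 (Q : regs -> Prop) :
  tr a R T1 (fun R' => tr b R' T2 Q) -> tr (RSeq a b) R (T1 + T2) Q.
Proof.
move=> H P pc /code_at_cat [Ha Hb].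
have [t1 [R1 [Ht1 Hs1 H1]]] := H _ _ Ha.
rewrite size_rcode in Hb.
have [t2 [R2 [Ht2 Hs2 H2]]] := H1 _ _ Hb.
exists (t1 + t2), R2; split=> //; first exact: leq_add.
by rewrite (steps_add _ Hs1) Hs2 /= addnA.
Qed.

(** The branches are asymmetric: the code of [b] comes first and has to jump over [a], so only [b]
    must leave [zreg] at 0. The 2 pays for the test and this jump. *)
Lemma tr_if r a b R T (Q : regs -> Prop) :
  (R r = 0 -> tr a R T Q) ->
  (R r != 0 -> tr b R T (fun R' => R' zreg = 0 /\ Q R')) ->
  tr (RIf r a b) R (T + 2) Q.
Proof.
move=> Ha Hb P pc /code_at_cons [H0 /code_at_cat [Cb /code_at_cons [H1 Ca]]].
rewrite size_rcode in H1 Ca.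
have [R0|R0] := eqVneq (R r) 0.
  have E : (pc.+1 + rsz b).+1 = pc + (rsz b).+2 by lia.
  rewrite E in Ca.
  have [t [R' [Ht Hs HQ]]] := Ha R0 _ _ Ca.
  exists t.+1, R'; split=> //; first by lia.
  by rewrite /= H0 R0 /= Hs; congr (Some (_, _)); lia.
have [t [R' [Ht Hs [Z HQ]]]] := Hb R0 _ _ Cb.
exists (t + 1).+1, R'; split=> //; first by lia.
rewrite /= H0 (negbTE R0) (steps_add _ Hs) /= H1 Z /=.
by congr (Some (_, _)); lia.
Qed.

(** The index of the invariant is the number of rounds still to come. A round pays 2 for its test
    and the jump back, and the final 1 is the test that leaves the loop. *)
Lemma tr_while (I : nat -> regs -> Prop) r c R T k (Q : regs -> Prop) :
  (forall j R1, I j.+1 R1 ->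
     R1 r != 0 /\ tr c R1 T (fun R' => R' zreg = 0 /\ I j R')) ->
  (forall R1, I 0 R1 -> R1 r = 0 /\ Q R1) ->
  I k R -> tr (RWh r c) R (k * (T + 2) + 1) Q.
Proof.
move=> Hs H0 + P pc C; have /code_at_cons [C0 /code_at_cat [Cb /code_at_cons [C1 _]]] := C.
rewrite size_rcode in C1.
elim: k R => [|k IH] R HI.
  have [R0 HQ] := H0 _ HI.
  by exists 1, R; split=> //=; rewrite C0 R0.
have [R0 /(_ _ _ Cb) [t [R' [Ht Hst [Z HI']]]]] := Hs _ _ HI.
have [t2 [R2 [Ht2 Hs2 HQ]]] := IH _ HI'.
exists (t + t2.+1).+1, R2; split=> //; first by lia.
by rewrite /= C0 (negbTE R0) (steps_add _ Hst) /= C1 Z /= Hs2.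
Qed.

Fixpoint rseq (l : seq raw) : raw := if l is c :: l' then RSeq c (rseq l') else RNop.
Definition incs (bs : seq nat) := rseq [seq RI (Inc b) | b <- bs].

Lemma tr_incs bs R T (Q : regs -> Prop) :
  size bs <= T -> Q (fun x => R x + count_mem x bs) -> tr (incs bs) R T Q.
Proof.
elim: bs R T => [|b bs IH] R T /= HT HQ.
  apply: tr_nop; have -> // : R = (fun x => R x + 0).
  by apply: functional_extensionality => x; rewrite addn0.
case: T HT => // T HT; rewrite -add1n; apply: tr_seq; apply: tr_inc => //.
apply: IH => //.
match goal with |- Q ?F => have -> // : F = (fun x => R x + ((b == x) + count_mem x bs)) end.
apply: functional_extensionality => x; rewrite /upd; case: eqVneq => [->|N].
  by lia.
by lia.
Qed.

(** The source is emptied, so this is a move and not a copy. With [bs] empty it is the way to clear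
    a register. *)
Definition addto (a : nat) (bs : seq nat) := RWh a (RSeq (RI (Dec a)) (incs bs)).

Definition added (R : regs) a bs : regs :=
  fun x => if x == a then 0 else R x + R a * count_mem x bs.

Lemma tr_addto a bs R T (Q : regs -> Prop) :
  a != zreg -> zreg \notin bs -> a \notin bs -> R zreg = 0 ->
  R a * (size bs).+3 + 1 <= T -> Q (added R a bs) -> tr (addto a bs) R T Q.
Proof.
move=> az zb ab Z HT HQ.
pose I k (R1 : regs) := k <= R a /\
  R1 = (fun x => if x == a then k else R x + (R a - k) * count_mem x bs).
apply: (@tr_conseq _ _ (R a * ((size bs).+1 + 2) + 1) _ Q) => //; last by lia.
apply: (@tr_while I) => [j R1 [Hj ->]|R1 [_ ->]|].
- rewrite eqxx; split=> //; apply: (@tr_seq _ _ _ 1 (size bs)); apply: tr_dec => //.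
  apply: tr_incs => //; split.
    rewrite /upd eq_sym (negbTE az) Z.
    by rewrite (count_memPn zb) muln0.
  split; first exact: ltnW.
  apply: functional_extensionality => x; rewrite /upd eqxx.
  case: (eqVneq x a) => [->|_]; first by rewrite (count_memPn ab) addn0.
  rewrite -addnA -mulSnr; congr (_ + _ * _); lia.
- rewrite subn0; split; first by rewrite eqxx.
  exact: HQ.
- split=> //; apply: functional_extensionality => x.
  by case: eqP => [->|_] //; rewrite subnn addn0.
Qed.

Definition subto (a b : nat) := RWh b (RSeq (RI (Dec b)) (RI (Dec a))).

Lemma tr_subto a b R T (Q : regs -> Prop) :
  a != zreg -> b != zreg -> a != b -> R zreg = 0 ->
  R b * 4 + 1 <= T -> Q (upd (upd R a (R a - R b)) b 0) -> tr (subto a b) R T Q.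
Proof.
move=> az bz ab Z HT HQ.
pose I k (R1 : regs) := k <= R b /\ R1 = upd (upd R a (R a - (R b - k))) b k.
apply: (@tr_conseq _ _ (R b * (2 + 2) + 1) _ Q) => //.
apply: (@tr_while I) => [j R1 [Hj ->]|R1 [_ ->]|].
- split; first by rewrite /upd eqxx.
  apply: (@tr_seq _ _ _ 1 1); apply: tr_dec => //; apply: tr_dec => //; split.
    by rewrite /upd !(eq_sym zreg) (negbTE az) (negbTE bz).
  split; first exact: ltnW.
  apply: functional_extensionality => x; rewrite /upd !eqxx (negbTE ab).
  case: (eqVneq x a) => [->|_]; first by rewrite (negbTE ab); lia.
  by case: (x == b).
- rewrite subn0; split; first by rewrite /upd eqxx.
  exact: HQ.
- split=> //; rewrite subnn subn0; apply: functional_extensionality => x; rewrite /upd.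
  by case: eqP => [->|_] //; case: eqP => [->|].
Qed.

(** * Polynomial bounds *)

(** Monotonicity is part of the notion because bounds get composed and evaluated at upper estimates
    of the actual values. *)
Definition pol (f : nat -> nat) :=
  (exists c k, forall n, f n <= c * n.+1 ^ k) /\ {homo f : m n / m <= n}.

Lemma pol_const c : pol (fun=> c).
Proof. by split=> //; exists c, 0 => n; rewrite muln1. Qed.

Lemma pol_id : pol id.
Proof. by split=> //; exists 1, 1 => n; rewrite mul1n expn1. Qed.

Lemma pol_add f g : pol f -> pol g -> pol (fun n => f n + g n).
Proof.
move=> [[c [k Hf]] mf] [[c' [k' Hg]] mg]; split; last by move=> m n H; rewrite leq_add ?mf ?mg.
exists (c + c'), (k + k') => n; rewrite mulnDl; apply: leq_add.
  by apply: leq_trans (Hf n) _; rewrite leq_mul2l leq_pexp2l ?leq_addr ?orbT.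
by apply: leq_trans (Hg n) _; rewrite leq_mul2l leq_pexp2l ?leq_addl ?orbT.
Qed.

Lemma pol_mul f g : pol f -> pol g -> pol (fun n => f n * g n).
Proof.
move=> [[c [k Hf]] mf] [[c' [k' Hg]] mg]; split; last by move=> m n H; rewrite leq_mul ?mf ?mg.
by exists (c * c'), (k + k') => n; rewrite expnD mulnACA leq_mul.
Qed.

Lemma pol_comp f g : pol f -> pol g -> pol (fun n => f (g n)).
Proof.
move=> [[c [k Hf]] mf] [[c' [k' Hg]] mg]; split; last by move=> m n H; rewrite mf ?mg.
exists (c * c'.+1 ^ k), (k' * k) => n; apply: leq_trans (Hf _) _.
rewrite -mulnA leq_mul2l expnM -expnMn; apply/orP; right.
case: k {Hf} => [|k]; first by rewrite !expn0.
by rewrite leq_exp2r // mulSn -add1n leq_add ?expn_gt0.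
Qed.

(** * A loop language over variables and arrays *)

Record st := St { sv : nat -> nat; sa : nat -> nat -> nat }.

Definition setv s x v := St (upd (sv s) x v) (sa s).
Definition seta s q k v :=
  St (sv s) (fun q' k' => if (q' == q) && (k' == k) then v else sa s q' k').

(* [A2 q i j] reads array cell [idx2 n i j]; the cells below [n * n] are kept
   apart, since they overlap with the input registers. *)
Inductive expr :=
| V of nat
| N
| Z0
| Suc of expr
| Sb of expr & expr
| Ite of expr & expr & expr
| A1 of nat & expr
| A2 of nat & expr & expr.

Definition idx2 n i j := (i + n) * n + j.

Fixpoint eval n s e :=
  match e with
  | V x => sv s x
  | N => n
  | Z0 => 0
  | Suc e => (eval n s e).+1
  | Sb a b => eval n s a - eval n s b
  | Ite a b c => if eval n s a != 0 then eval n s b else eval n s c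
  | A1 q a => sa s q (eval n s a)
  | A2 q a b => sa s q (idx2 n (eval n s a) (eval n s b))
  end.

Inductive com :=
| Asg of nat & expr
| S1 of nat & expr & expr
| S2 of nat & expr & expr & expr
| Nop
| Seq of com & com
| If of expr & com & com
| Rep of com.

Fixpoint exec n c s :=
  match c with
  | Asg x e => setv s x (eval n s e)
  | S1 q i e => seta s q (eval n s i) (eval n s e)
  | S2 q i j e => seta s q (idx2 n (eval n s i) (eval n s j)) (eval n s e)
  | Nop => s
  | Seq a b => exec n b (exec n a s)
  | If e a b => if eval n s e != 0 then exec n a s else exec n b s
  | Rep a => iter n (exec n a) s
  end.

Definition bnd B s := (forall x, sv s x <= B) /\ (forall q k, sa s q k <= B).

Fixpoint esz e :=
  match e with
  | Suc e => (esz e).+1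
  | Sb a b => esz a + esz b
  | Ite a b c => esz a + esz b + esz c
  | A1 _ a => esz a
  | A2 _ a b => esz a + esz b
  | _ => 0
  end.

Lemma eval_bnd n B s e : n <= B -> bnd B s -> eval n s e <= B + esz e.
Proof.
move=> nB [bv ba]; elim: e => [x|||e IH|a IHa b IHb|a IHa b IHb c IHc|q a _|q a _ b _] /=.
- by rewrite addn0.
- by rewrite addn0.
- by [].
- lia.
- lia.
- case: ifP => _; lia.
- by have := ba q (eval n s a); lia.
- by have := ba q (idx2 n (eval n s a) (eval n s b)); lia.
Qed.

(** Products occur in addresses only, so an expression exceeds the present bound by at most its
    number of [Suc]. The bound on all values therefore grows additively, and a loop multiplies the
    growth of its body by [n]. *)
Fixpoint grow c n :=
  match c with
  | Asg _ e | S1 _ _ e | S2 _ _ _ e => esz e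
  | Nop => 0
  | Seq a b | If _ a b => grow a n + grow b n
  | Rep a => n * grow a n
  end.

Lemma bnd_le B B' s : B <= B' -> bnd B s -> bnd B' s.
Proof.
by move=> H [bv ba]; split=> [x|q k]; apply: leq_trans H; [apply: bv|apply: ba].
Qed.

Lemma exec_bnd c n B s : n <= B -> bnd B s -> bnd (B + grow c n) (exec n c s).
Proof.
elim: c B s => [x e|q i e|q i j e||a IHa b IHb|e a IHa b IHb|a IHa] B s nB bs /=.
- have He := eval_bnd e nB bs; case: bs => bv ba; split=> [y|q k] /=.
    by rewrite /upd; case: ifP => // _; have := bv y; lia.
  by have := ba q k; lia.
- have He := eval_bnd e nB bs; case: bs => bv ba; split=> [y|q' k] /=.
    by have := bv y; lia.
  by case: ifP => // _; have := ba q' k; lia.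
- have He := eval_bnd e nB bs; case: bs => bv ba; split=> [y|q' k] /=.
    by have := bv y; lia.
  by case: ifP => // _; have := ba q' k; lia.
- by rewrite addn0.
- rewrite addnA; apply: IHb; last exact: IHa.
  by apply: leq_trans nB _; rewrite leq_addr.
- by case: ifP => _; [apply: bnd_le (IHa _ _ nB bs)|apply: bnd_le (IHb _ _ nB bs)]; lia.
- elim: {1 3}n => [|k IH] /=; first by apply: bnd_le bs; lia.
  rewrite mulSnr addnA; apply: IHa => //; lia.
Qed.

Lemma pol_grow c : pol (grow c).
Proof.
elim: c => [x e|q i e|q i j e||a IHa b IHb|e a IHa b IHb|a IHa] /=; try exact: pol_const.
- exact: pol_add.
- exact: pol_add.
- by apply: pol_mul => //; exact: pol_id.
Qed.

(** * Compilation *)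

Section Compile.
Variables (NV ND S : nat).
Hypothesis S0 : 0 < S.

(* Memory layout: register 0 holds n, register 1 holds 0, then come NV
   variables and ND temporaries; the S arrays are interleaved above them. *)
Definition rv x := x.+2.
Definition treg d := (NV + d).+2.
Definition lowmem := (NV + ND).+2.
Definition addr_of q k := lowmem + q + S * k.

Definition mem_of n (s : st) (tf : nat -> nat) : regs := fun r =>
  if r == 0 then n else if r == 1 then 0 else if r < NV.+2 then sv s (r - 2)
  else if r < lowmem then tf (r - NV.+2) else sa s ((r - lowmem) %% S) ((r - lowmem) %/ S).

Lemma mem_n n s tf : mem_of n s tf 0 = n. Proof. by []. Qed.
Lemma mem_z n s tf : mem_of n s tf 1 = 0. Proof. by []. Qed.
Lemma mem_v n s tf x : x < NV -> mem_of n s tf (rv x) = sv s x.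
Proof. by move=> H; rewrite /mem_of /rv /= !ltnS H !subSS subn0. Qed.
Lemma mem_t n s tf d : d < ND -> mem_of n s tf (treg d) = tf d.
Proof.
move=> H; rewrite /mem_of /treg /lowmem /= !ltnS ltnNge leq_addr /= ltn_add2l H !subSS.
by rewrite addKn.
Qed.

Lemma ad_decode q k : q < S -> [/\ lowmem <= addr_of q k, (addr_of q k - lowmem) %% S = q & (addr_of q k - lowmem) %/ S = k].
Proof.
move=> H; rewrite /addr_of -addnA leq_addr addKn; split=> //.
  by rewrite (mulnC S) (addnC q) modnMDl modn_small.
by rewrite (mulnC S) (addnC q) divnMDl // divn_small // addn0.
Qed.

Lemma mem_high n s tf r : lowmem <= r -> mem_of n s tf r = sa s ((r - lowmem) %% S) ((r - lowmem) %/ S).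
Proof.
move=> H; rewrite /mem_of.
have -> : (r == 0) = false by move: H; rewrite /lowmem; lia.
have -> : (r == 1) = false by move: H; rewrite /lowmem; lia.
have -> : (r < NV.+2) = false by move: H; rewrite /lowmem; lia.
by rewrite ltnNge H.
Qed.

Lemma mem_a n s tf q k : q < S -> mem_of n s tf (addr_of q k) = sa s q k.
Proof.
by move=> H; have [H1 H2 H3] := ad_decode k H; rewrite mem_high // H2 H3.
Qed.

Lemma upd_v n s tf x v : x < NV -> upd (mem_of n s tf) (rv x) v = mem_of n (setv s x v) tf.
Proof.
move=> H; apply: functional_extensionality => r; rewrite /upd /mem_of /rv /=.
case: (eqVneq r x.+2) => [->|Hr] /=; first by rewrite !ltnS H /upd !subSS subn0 eqxx.
case: eqP => // r0; case: eqP => // r1; case: ifP => // rN; rewrite /upd.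
by have -> : (r - 2 == x) = false by lia.
Qed.

Lemma upd_t n s tf d v : d < ND -> upd (mem_of n s tf) (treg d) v = mem_of n s (upd tf d v).
Proof.
move=> H; apply: functional_extensionality => r; rewrite /upd /mem_of /treg /lowmem /=.
case: (eqVneq r (NV + d).+2) => [->|Hr] /=.
  by rewrite !ltnS ltnNge leq_addr /= ltn_add2l H !subSS addKn eqxx.
case: eqP => // r0; case: eqP => // r1; case: ifP => // rN; case: ifP => // rK.
by have -> : (r - NV.+2 == d) = false by lia.
Qed.

Lemma upd_a n s tf q k v : q < S -> upd (mem_of n s tf) (addr_of q k) v = mem_of n (seta s q k v) tf.
Proof.
move=> H; have [H1 H2 H3] := ad_decode k H.
apply: functional_extensionality => r; rewrite {1}/upd.
case: (eqVneq r (addr_of q k)) => [->|Hr]; first by rewrite mem_high // H2 H3 /= !eqxx.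
have [rK|rK] := leqP lowmem r; last first.
  rewrite /mem_of; case: eqP => // _; case: eqP => // _; case: ifP => // _.
  by rewrite rK.
rewrite !mem_high //=; case: ifP => // /andP [/eqP E1 /eqP E2]; case/eqP: Hr.
by have := divn_eq (r - lowmem) S; rewrite E1 E2 /addr_of; lia.
Qed.

(** Since moving destroys the source, a copy sends the value to the target and to the empty
    temporary [t], and then moves it back from [t]. *)
Definition cp r x t := RSeq (addto r [:: x; t]) (addto t [:: r]).

Lemma tr_cp r x t R T (Q : regs -> Prop) :
  r != 1 -> x != 1 -> t != 1 -> r != x -> r != t -> x != t -> R 1 = 0 -> R t = 0 ->
  R r * 9 + 2 <= T -> Q (upd R x (R x + R r)) -> tr (cp r x t) R T Q.
Proof.
move=> r1 x1 t1 rx rt xt Z Rt HT HQ.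
apply: (@tr_conseq _ _ ((R r * 5 + 1) + (R r * 4 + 1)) _ Q) => //; last by lia.
have E y : y != 1 -> (zreg == y) = false by move=> /negbTE; rewrite eq_sym.
apply: tr_seq; apply: tr_addto => //.
- by rewrite !inE !E.
- by rewrite !inE negb_or rx rt.
- have A1 : added R r [:: x; t] t = R r.
    by rewrite /added eq_sym (negbTE rt) Rt /= eqxx (negbTE xt) /= muln1.
  apply: tr_addto => //.
  + by rewrite inE E.
  + by rewrite inE eq_sym.
  + by rewrite /added E // Z /= !(eq_sym _ 1) !E // muln0.
  + by rewrite A1.
  + match goal with |- Q ?F => have -> // : F = upd R x (R x + R r) end.
    apply: functional_extensionality => y; rewrite {1}/added A1.
    rewrite /added /upd /=; case: (eqVneq y t) => [->|yt].
      by rewrite eq_sym (negbTE xt).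
    rewrite /= !addn0 !(eq_sym _ y).
    case: (eqVneq y r) => [->|yr]; first by rewrite (negbTE rx) muln1.
    by case: (eqVneq y x) => [->|_] /=; rewrite ?muln1 ?muln0 ?addn0.
Qed.

Lemma added0 R r : added R r [::] = upd R r 0.
Proof.
by apply: functional_extensionality => x; rewrite /added /upd muln0 addn0.
Qed.

Lemma added1 R r x : r != x -> added R r [:: x] = upd (upd R x (R x + R r)) r 0.
Proof.
move=> rx; apply: functional_extensionality => y; rewrite /added /upd /=.
case: (eqVneq y r) => // _; rewrite (eq_sym x).
by case: eqP => [->|_]; rewrite ?muln1 ?muln0 ?addn0.
Qed.

Lemma added_nseq R r x m :
  r != x -> added R r (nseq m x) = upd (upd R x (R x + R r * m)) r 0.
Proof.
move=> rx; apply: functional_extensionality => y; rewrite /added /upd count_nseq /=.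
case: (eqVneq y r) => // _; rewrite (eq_sym x).
by case: eqP => [->|_]; rewrite ?mul1n ?muln0 ?addn0.
Qed.

Lemma incs_nseq R x m : (fun y => R y + count_mem y (nseq m x)) = upd R x (R x + m).
Proof.
apply: functional_extensionality => y; rewrite /upd count_nseq /= eq_sym.
by case: eqP => [->|_]; rewrite ?mul1n ?mul0n ?addn0.
Qed.

(** Turns an index into the address [addr_of q]: multiplication by the constant [S] consists in
    incrementing the same register [S] times per unit moved. *)
Definition scale q d :=
  RSeq (addto (treg d) (nseq S (treg d.+1)))
       (RSeq (addto (treg d.+1) [:: treg d]) (incs (nseq (lowmem + q) (treg d)))).

Lemma tmE d d' : (treg d == treg d') = (d == d').
Proof. by rewrite /treg !eqSS eqn_add2l. Qed.
Lemma tm1 d : (treg d == 1) = false. Proof. by []. Qed.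

Lemma upd_eq (f : nat -> nat) d v : upd f d v d = v.
Proof. by rewrite /upd eqxx. Qed.

Lemma upd_ne (f : nat -> nat) d d' v : d' != d -> upd f d v d' = f d'.
Proof. by rewrite /upd => /negbTE ->. Qed.

Lemma updupd (f : nat -> nat) d u v : upd (upd f d u) d v = upd f d v.
Proof. by apply: functional_extensionality => x; rewrite /upd; case: eqP. Qed.

Lemma updC (f : nat -> nat) d d' u v : d != d' ->
  upd (upd f d u) d' v = upd (upd f d' v) d u.
Proof.
move=> H; apply: functional_extensionality => x; rewrite /upd.
by case: (eqVneq x d') => [->|//]; rewrite eq_sym (negbTE H).
Qed.

Lemma upd_same (f : nat -> nat) d v : f d = v -> upd f d v = f.
Proof. by move=> H; apply: functional_extensionality => x; rewrite /upd; case: eqP => // ->. Qed.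

Lemma tr_scale q d n s tf T (Q : regs -> Prop) :
  d.+1 < ND -> tf d.+1 = 0 -> tf d * (S * 5 + 3) + (lowmem + q + 2) <= T ->
  Q (mem_of n s (upd tf d (addr_of q (tf d)))) -> tr (scale q d) (mem_of n s tf) T Q.
Proof.
move=> dN t0 HT HQ.
have dN' : d < ND by lia.
apply: (@tr_conseq _ _ ((tf d * S.+3 + 1) + ((tf d * S * 4 + 1) + (lowmem + q))) _ Q) => //; last by lia.
apply: tr_seq; apply: tr_addto; rewrite ?mem_n ?mem_z ?tm1 //.
- by rewrite mem_nseq; apply/negP => /andP [_ /eqP].
- by rewrite mem_nseq tmE -(addn1 d) -{1}(addn0 d) eqn_add2l andbF.
- by rewrite size_nseq mem_t.
rewrite added_nseq ?tmE; last by lia.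
rewrite !mem_t // t0 add0n !upd_t // updC; last by lia.
apply: tr_seq; apply: tr_addto; rewrite ?mem_n ?mem_z ?tm1 ?inE ?tmE //; try by lia.
  by rewrite mem_t // /upd eqxx.
rewrite added1 ?tmE; last by lia.
rewrite !mem_t // upd_eq upd_ne; last by lia.
rewrite upd_eq add0n !upd_t //; apply: tr_incs; first by rewrite size_nseq.
rewrite incs_nseq mem_t // upd_t // upd_ne; last by lia.
rewrite upd_eq.
match goal with |- Q (mem_of _ _ ?F) => have -> // : F = upd tf d (addr_of q (tf d)) end.
apply: functional_extensionality => x; rewrite /upd /addr_of (mulnC S).
case: (eqVneq x d) => [_|xd]; first by lia.
by case: (eqVneq x d.+1) => // ->.
Qed.

Lemma tr_cp0 n s tf x t T (Q : regs -> Prop) :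
  x < ND -> t < ND -> x != t -> tf t = 0 -> n * 9 + 2 <= T ->
  Q (mem_of n s (upd tf x (tf x + n))) -> tr (cp 0 (treg x) (treg t)) (mem_of n s tf) T Q.
Proof.
move=> xN tN xt t0 HT HQ.
by apply: tr_cp => //; rewrite ?tmE ?mem_t ?mem_n ?upd_t.
Qed.

(** The factor [i + n] in register [d] serves as the loop counter, and the multiples of [n] are
    accumulated on top of the column index in [d.+1]. *)
Definition idxc d :=
  RSeq (cp 0 (treg d) (treg d.+2))
  (RSeq (RWh (treg d) (RSeq (RI (Dec (treg d))) (cp 0 (treg d.+1) (treg d.+2))))
        (addto (treg d.+1) [:: treg d])).

Lemma tr_idxc d n s tf T (Q : regs -> Prop) :
  d.+2 < ND -> tf d.+2 = 0 ->
  (n * 9 + 2) + ((tf d + n) * (n * 9 + 5) + 1 + (idx2 n (tf d) (tf d.+1) * 4 + 1)) <= T ->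
  Q (mem_of n s (upd (upd tf d (idx2 n (tf d) (tf d.+1))) d.+1 0)) ->
  tr (idxc d) (mem_of n s tf) T Q.
Proof.
move=> dN t0 HT HQ; apply: tr_conseq HT (fun _ => id).
have [dN0 dN1] : d < ND /\ d.+1 < ND by lia.
apply: tr_seq; apply: tr_cp0 => //; try by lia.
apply: tr_seq.
pose I k R := k <= tf d + n /\
  R = mem_of n s (upd (upd tf d k) d.+1 (tf d.+1 + (tf d + n - k) * n)).
have -> : (tf d + n) * (n * 9 + 5) = (tf d + n) * ((1 + (n * 9 + 2)) + 2) by congr (_ * _); lia.
apply: (@tr_while I) => [j R1 [Hj ->]|R1 [_ ->]|].
- split; first by rewrite mem_t // upd_ne ?upd_eq //; lia.
  apply: tr_seq; apply: tr_dec => //; rewrite mem_t // upd_ne ?upd_eq ?upd_t //; last by lia.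
  apply: tr_cp0 => //; try lia.
    by rewrite !upd_ne //; lia.
  split=> //; split; first by lia.
  congr mem_of; apply: functional_extensionality => x; rewrite /upd eqxx.
  case: (x == d.+1); last by case: (x == d).
  rewrite ?(gtn_eqF (ltnSn d)).
  by rewrite -addnA -mulSnr; congr (_ + _ * _); lia.
- rewrite mem_t // upd_ne ?upd_eq; last by lia.
  split=> //; apply: tr_addto; rewrite ?mem_z ?inE ?tmE ?tm1 //; try lia.
    by rewrite mem_t // upd_eq subn0 /idx2 (addnC (tf d.+1)).
  rewrite added1 ?tmE; last by lia.
  rewrite !mem_t // upd_eq upd_ne; last by lia.
  rewrite upd_eq !upd_t //.
  match goal with |- Q (mem_of _ _ ?F) =>
    have -> // : F = upd (upd tf d (idx2 n (tf d) (tf d.+1))) d.+1 0 end.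
  apply: functional_extensionality => x; rewrite /upd /idx2 subn0 add0n addnC.
  by case: (x == d.+1); case: (x == d).
- split=> //; rewrite subnn addn0 (upd_same (d := d.+1)) // upd_ne //; lia.
Qed.

(** The temporaries form a stack: those from [d] on are 0 before, the value is left in [d], and all
    above [d] are 0 again afterwards. [dep] is the stack height needed. *)
Fixpoint cexpr e d : raw :=
  match e with
  | V x => cp (rv x) (treg d) (treg d.+1)
  | N => cp 0 (treg d) (treg d.+1)
  | Z0 => RNop
  | Suc a => RSeq (cexpr a d) (RI (Inc (treg d)))
  | Sb a b => RSeq (cexpr a d) (RSeq (cexpr b d.+1) (subto (treg d) (treg d.+1)))
  | Ite a b c =>
      RSeq (cexpr a d) (RIf (treg d) (cexpr c d) (RSeq (addto (treg d) [::]) (cexpr b d)))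
  | A1 q a => RSeq (cexpr a d) (RSeq (scale q d) (RI (Rd (treg d) (treg d))))
  | A2 q a b =>
      RSeq (cexpr a d) (RSeq (cexpr b d.+1)
        (RSeq (idxc d) (RSeq (scale q d) (RI (Rd (treg d) (treg d))))))
  end.

Fixpoint dep e :=
  match e with
  | V _ | N => 2
  | Z0 => 1
  | Suc a => dep a
  | Sb a b => maxn (dep a) (dep b).+1
  | Ite a b c => maxn (dep a) (maxn (dep b) (dep c))
  | A1 _ a => maxn (dep a) 2
  | A2 _ a b => maxn 3 (maxn (dep a) (dep b).+1)
  end.

Fixpoint wfe e :=
  match e with
  | V x => x < NV
  | N | Z0 => true
  | Suc a => wfe a
  | Sb a b => wfe a && wfe b
  | Ite a b c => [&& wfe a, wfe b & wfe c]
  | A1 q a => (q < S) && wfe a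
  | A2 q a b => [&& q < S, wfe a & wfe b]
  end.

Lemma dep_gt0 e : 0 < dep e.
Proof. by elim: e => //= *; lia. Qed.

(* The time bound [T] is a function of a bound [B] on n and on all values. *)
Definition cexpr_spec e d := exists2 T, pol T &
  forall n s tf B (Q : regs -> Prop), n <= B -> bnd B s ->
  (forall d', d <= d' -> tf d' = 0) ->
  Q (mem_of n s (upd tf d (eval n s e))) -> tr (cexpr e d) (mem_of n s tf) (T B) Q.

Hint Resolve pol_const pol_id pol_add pol_mul pol_comp : core.

Lemma cexpr_ok e d : wfe e -> d + dep e <= ND -> cexpr_spec e d.
Proof.
elim: e d => [x|||a IHa|a IHa b IHb|a IHa b IHb c IHc|q a IHa|q a IHa b IHb] d /=.
- move=> xN dN; exists (fun B => B * 9 + 2); first by auto 10.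
  move=> n s tf B Q nB [bv _] t0 HQ.
  have [dN0 dN1] : d < ND /\ d.+1 < ND by lia.
  have rt d' : (rv x == treg d') = false by rewrite /rv /treg; lia.
  apply: tr_cp; rewrite ?rt ?tmE ?(mem_v _ _ _ xN) ?mem_t ?upd_t ?t0 ?add0n //; try lia.
  by have := bv x; lia.
- move=> _ dN; exists (fun B => B * 9 + 2); first by auto 10.
  move=> n s tf B Q nB bs t0 HQ.
  have [dN0 dN1] : d < ND /\ d.+1 < ND by lia.
  by apply: tr_cp0; rewrite ?t0 ?add0n //; lia.
- move=> _ dN; exists (fun B => 0); first by [].
  move=> n s tf B Q nB bs t0 HQ; apply: tr_nop.
  by rewrite upd_same in HQ; last exact: t0.
- move=> wa dN; have [T pT HT] := IHa _ wa dN.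
  have dN0 : d < ND by have := dep_gt0 a; lia.
  exists (fun B => T B + 1); first by auto 10.
  move=> n s tf B Q nB bs t0 HQ; apply: tr_seq; apply: HT => //.
  by apply: tr_inc => //; rewrite mem_t // upd_eq upd_t // updupd.
- move=> /andP [wa wb] dN.
  have [|T pT HT] := IHa d wa; first by lia.
  have [|T' pT' HT'] := IHb d.+1 wb; first by lia.
  have [dN0 dN1] : d < ND /\ d.+1 < ND by have := dep_gt0 b; lia.
  exists (fun B => T B + (T' B + ((B + esz b) * 4 + 1))); first by auto 10.
  move=> n s tf B Q nB bs t0 HQ; have Hb := eval_bnd b nB bs.
  apply: tr_seq; apply: HT => //; apply: tr_seq; apply: HT' => //.
    by move=> d' Hd; rewrite upd_ne ?t0 //; lia.
  apply: tr_subto; rewrite ?tmE ?mem_t ?upd_eq //; try lia.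
  rewrite upd_ne ?upd_eq; last by lia.
  rewrite !upd_t //; move: HQ => /=.
  match goal with |- Q (mem_of _ _ ?G) -> Q (mem_of _ _ ?F) => have -> // : F = G end.
  apply: functional_extensionality => y; rewrite /upd.
  by case: (eqVneq y d.+1) => [->|_]; [rewrite (gtn_eqF (ltnSn d)) t0 | case: (y == d)].
- move=> /and3P [wa wb wc] dN.
  have [|T pT HT] := IHa d wa; first by lia.
  have [|T' pT' HT'] := IHb d wb; first by lia.
  have [|T'' pT'' HT''] := IHc d wc; first by lia.
  have dN0 : d < ND by have := dep_gt0 b; lia.
  exists (fun B => T B + (((B + esz a) * 3 + 1 + T' B + T'' B) + 2)); first by auto 15.
  move=> n s tf B Q nB bs t0 HQ; have Ha := eval_bnd a nB bs.
  apply: tr_seq; apply: HT => //; apply: tr_if; rewrite mem_t // upd_eq => E.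
    apply: tr_conseq (fun _ => id); last first.
      apply: leq_addl. 
    apply: HT'' => //.
      by move=> d' Hd; rewrite E upd_same ?t0.
    by rewrite updupd; move: HQ; rewrite /= E.
  apply: tr_conseq (fun _ => id); last exact: leq_addr.
  apply: tr_seq; apply: tr_addto; rewrite ?mem_t ?upd_eq //=; first by lia.
  rewrite added0 upd_t // updupd upd_same ?t0 //; apply: HT' => //; split=> //.
  by move: HQ; rewrite /= E.
- move=> /andP [qS wa] dN.
  have [|T pT HT] := IHa d wa; first by lia.
  have [dN0 dN1] : d < ND /\ d.+1 < ND by lia.
  exists (fun B => T B + (((B + esz a) * (S * 5 + 3) + (lowmem + q + 2)) + 1)); first by auto 15.
  move=> n s tf B Q nB bs t0 HQ; have Ha := eval_bnd a nB bs.
  apply: tr_seq; apply: HT => //; apply: tr_seq; apply: tr_scale => //.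
  + by rewrite upd_ne ?t0 //; lia.
  + by rewrite upd_eq leq_add2r leq_mul2r Ha orbT.
  by rewrite upd_eq updupd; apply: tr_rd => //; rewrite mem_t // upd_eq mem_a // upd_t // updupd.
- move=> /and3P [qS wa wb] dN.
  have [|T pT HT] := IHa d wa; first by lia.
  have [|T' pT' HT'] := IHb d.+1 wb; first by lia.
  have [dN0 [dN1 dN2]] : d < ND /\ d.+1 < ND /\ d.+2 < ND by lia.
  (* A bound for the index. Being a product it affects the running time, but it never becomes the
     value of a variable or of an array cell. *)
  pose X B := (B + esz a + B) * B + (B + esz b).
  have pX : pol X by apply: pol_add; [apply: pol_mul|]; auto.
  exists (fun B => T B + (T' B + (((B * 9 + 2) +
     ((B + esz a + B) * (B * 9 + 5) + 1 + (X B * 4 + 1)))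
     + ((X B * (S * 5 + 3) + (lowmem + q + 2)) + 1)))); first by auto 30.
  move=> n s tf B Q nB bs t0 HQ.
  have Ha := eval_bnd a nB bs; have Hb := eval_bnd b nB bs.
  have HX : idx2 n (eval n s a) (eval n s b) <= X B.
    by rewrite /idx2 /X leq_add // leq_mul // leq_add.
  apply: tr_seq; apply: HT => //; apply: tr_seq; apply: HT' => //.
    by move=> d' Hd; rewrite upd_ne ?t0 //; lia.
  have Ed : upd (upd tf d (eval n s a)) d.+1 (eval n s b) d = eval n s a.
    by rewrite upd_ne ?upd_eq //; lia.
  apply: tr_seq; apply: tr_idxc; rewrite ?upd_eq ?Ed //.
  + by rewrite !upd_ne ?t0 //; lia.
  + apply: leq_add; first by rewrite leq_add2r leq_mul2r nB orbT.
    apply: leq_add; last by rewrite leq_add2r leq_mul2r HX orbT.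
    by rewrite leq_add2r leq_mul // leq_add // leq_mul2r nB orbT.
  set I := idx2 _ _ _ in HX *.
  apply: tr_seq; apply: tr_scale => //; rewrite ?upd_eq //.
    by rewrite upd_ne ?upd_eq ?leq_add2r ?leq_mul2r ?HX ?orbT //; lia.
  apply: tr_rd => //; rewrite upd_t // mem_t // upd_eq mem_a // updupd.
  rewrite upd_ne ?upd_eq; last by lia.
  match goal with |- Q (mem_of _ _ ?F) => have -> // : F = upd tf d (sa s q I) end.
  apply: functional_extensionality => x; rewrite /upd.
  case: (eqVneq x d) => // _; case: (eqVneq x d.+1) => // ->.
  by rewrite t0.
Qed.

Definition store q d :=
  RSeq (scale q d.+1) (RSeq (RI (Wr (treg d.+1) (treg d)))
    (RSeq (addto (treg d.+1) [::]) (addto (treg d) [::]))).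

Lemma tr_store q d n s tf T (Q : regs -> Prop) :
  q < S -> d.+2 < ND -> (forall d', d <= d' -> d' != d -> d' != d.+1 -> tf d' = 0) ->
  (tf d.+1 * (S * 5 + 3) + (lowmem + q + 2)) +
    (1 + (((lowmem + q + S * tf d.+1) * 3 + 1) + (tf d * 3 + 1))) <= T ->
  Q (mem_of n (seta s q (tf d.+1) (tf d)) (upd (upd tf d.+1 0) d 0)) ->
  tr (store q d) (mem_of n s tf) T Q.
Proof.
move=> qS dN t0 HT HQ; apply: tr_conseq HT (fun _ => id).
have [dN0 dN1] : d < ND /\ d.+1 < ND by lia.
have dd : d != d.+1 by lia.
apply: tr_seq; apply: tr_scale => //; first by rewrite t0 //; lia.
apply: tr_seq; apply: tr_wr => //; rewrite !mem_t // upd_eq upd_ne // upd_a //.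
apply: tr_seq; apply: tr_addto; rewrite ?mem_t ?upd_eq //=.
rewrite added0 upd_t // updupd; apply: tr_addto; rewrite ?mem_t ?upd_ne //=.
by rewrite added0 upd_t.
Qed.

Fixpoint ccom c d : raw :=
  match c with
  | Asg x e => RSeq (cexpr e d) (RSeq (addto (rv x) [::]) (addto (treg d) [:: rv x]))
  | S1 q i e => RSeq (cexpr e d) (RSeq (cexpr i d.+1) (store q d))
  | S2 q i j e => RSeq (cexpr e d) (RSeq (cexpr i d.+1) (RSeq (cexpr j d.+2)
       (RSeq (idxc d.+1) (store q d))))
  | Nop => RNop
  | Seq a b => RSeq (ccom a d) (ccom b d)
  | If e a b =>
      RSeq (cexpr e d) (RIf (treg d) (ccom b d) (RSeq (addto (treg d) [::]) (ccom a d)))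
  | Rep a => RSeq (cp 0 (treg d) (treg d.+1))
                  (RWh (treg d) (RSeq (RI (Dec (treg d))) (ccom a d.+1)))
  end.

Fixpoint cdep c :=
  match c with
  | Asg _ e => dep e
  | S1 _ i e => maxn 3 (maxn (dep e) (dep i).+1)
  | S2 _ i j e => maxn 4 (maxn (dep e) (maxn (dep i).+1 (dep j).+2))
  | Nop => 0
  | Seq a b => maxn (cdep a) (cdep b)
  | If e a b => maxn (dep e) (maxn (cdep a) (cdep b))
  | Rep a => maxn 2 (cdep a).+1
  end.

Fixpoint wfc c :=
  match c with
  | Asg x e => (x < NV) && wfe e
  | S1 q i e => [&& q < S, wfe i & wfe e]
  | S2 q i j e => [&& q < S, wfe i, wfe j & wfe e]
  | Nop => true
  | Seq a b => wfc a && wfc b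
  | If e a b => [&& wfe e, wfc a & wfc b]
  | Rep a => wfc a
  end.

(** The time polynomial takes the bound on the values at the start. A second command starts from
    values bounded by [B + grow a B], and every round of a loop from values bounded by [G B], which
    does not depend on the round. *)
Lemma ccom_ok c d : wfc c -> d + cdep c <= ND ->
  exists2 T, pol T & forall n s tf B, n <= B -> bnd B s ->
  (forall d', d <= d' -> tf d' = 0) ->
  tr (ccom c d) (mem_of n s tf) (T B) (eq (mem_of n (exec n c s) tf)).
Proof.
elim: c d => [x e|q i e|q i j e||a IHa b IHb|e a IHa b IHb|a IHa] d /=.
- move=> /andP [xN we] dN; have [T pT HT] := cexpr_ok we dN.
  have dN0 : d < ND by have := dep_gt0 e; lia.
  exists (fun B => T B + ((B * 3 + 1) + ((B + esz e) * 4 + 1))); first by auto 15.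
  move=> n s tf B nB bs t0; have He := eval_bnd e nB bs; case: (bs) => bv _.
  have rt : (rv x == treg d) = false by rewrite /rv /treg; lia.
  apply: tr_seq; apply: HT => //; apply: tr_seq; apply: tr_addto => //.
    by rewrite (mem_v _ _ _ xN) leq_add2r leq_mul2r bv orbT.
  rewrite added0 upd_v //; apply: tr_addto => //.
  + by rewrite inE eq_sym rt.
  + by rewrite mem_t // upd_eq leq_add2r leq_mul2r He orbT.
  rewrite added1; last by rewrite eq_sym rt.
  rewrite mem_t // upd_eq (mem_v _ _ _ xN) upd_v // upd_t // updupd upd_same ?t0 //.
  by rewrite /setv /= updupd upd_eq.
- move=> /and3P [qS wi we] dN.
  have [|T pT HT] := @cexpr_ok e d we; first by lia.
  have [|T' pT' HT'] := @cexpr_ok i d.+1 wi; first by lia.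
  exists (fun B => T B + (T' B + (((B + esz i) * (S * 5 + 3) + (lowmem + q + 2)) +
    (1 + (((lowmem + q + S * (B + esz i)) * 3 + 1) + ((B + esz e) * 3 + 1))))));
    first by auto 30.
  move=> n s tf B nB bs t0.
  have He := eval_bnd e nB bs; have Hi := eval_bnd i nB bs.
  apply: tr_seq; apply: HT => //; apply: tr_seq; apply: HT' => //.
    by move=> d' Hd; rewrite upd_ne ?t0 //; lia.
  have Ed v w : upd (upd tf d v) d.+1 w d = v by rewrite upd_ne ?upd_eq //; lia.
  apply: tr_store => //; rewrite ?Ed ?upd_eq //.
  + by lia.
  + by move=> d' H1 H2 H3; rewrite !upd_ne ?t0.
  + do ![apply: leq_add => // | rewrite leq_mul2r]; rewrite ?Hi ?He ?orbT //.
    by rewrite leq_mul2l Hi orbT.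
  congr mem_of; apply: functional_extensionality => y; rewrite /upd.
  case: (eqVneq y d) => [->|_]; first by rewrite t0.
  by case: (eqVneq y d.+1) => [->|//]; rewrite t0.
- move=> /and4P [qS wi wj we] dN.
  have [|T pT HT] := @cexpr_ok e d we; first by lia.
  have [|T' pT' HT'] := @cexpr_ok i d.+1 wi; first by lia.
  have [|T'' pT'' HT''] := @cexpr_ok j d.+2 wj; first by lia.
  pose X B := (B + esz i + B) * B + (B + esz j).
  have pX : pol X by apply: pol_add; [apply: pol_mul|]; auto.
  exists (fun B => T B + (T' B + (T'' B + (((B * 9 + 2) +
     ((B + esz i + B) * (B * 9 + 5) + 1 + (X B * 4 + 1)))
     + ((X B * (S * 5 + 3) + (lowmem + q + 2)) +
    (1 + (((lowmem + q + S * X B) * 3 + 1) + ((B + esz e) * 3 + 1))))))));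
    first by auto 40.
  move=> n s tf B nB bs t0.
  have He := eval_bnd e nB bs; have Hi := eval_bnd i nB bs; have Hj := eval_bnd j nB bs.
  have HX : idx2 n (eval n s i) (eval n s j) <= X B.
    by rewrite /idx2 /X leq_add // leq_mul // leq_add.
  apply: tr_seq; apply: HT => //; apply: tr_seq; apply: HT' => //.
    by move=> d' Hd; rewrite upd_ne ?t0 //; lia.
  apply: tr_seq; apply: HT'' => //.
    by move=> d' Hd; rewrite !upd_ne ?t0 //; lia.
  set tf' := upd _ d.+2 _.
  have E0 : tf' d = eval n s e by rewrite /tf' /upd eqxx !ifN //; lia.
  have E1 : tf' d.+1 = eval n s i by rewrite /tf' /upd eqxx !ifN //; lia.
  have E2 : tf' d.+2 = eval n s j by rewrite /tf' upd_eq.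
  have E3 d' : d.+2 < d' -> tf' d' = 0 by move=> H; rewrite /tf' !upd_ne ?t0 //; lia.
  apply: tr_seq; apply: tr_idxc; rewrite ?E1 ?E2 //.
  + by lia.
  + by apply: E3.
  + apply: leq_add; first by rewrite leq_add2r leq_mul2r nB orbT.
    apply: leq_add; last by rewrite leq_add2r leq_mul2r HX orbT.
    by rewrite leq_add2r leq_mul // leq_add // leq_mul2r nB orbT.
  set I := idx2 _ _ _ in HX *.
  have E4 : upd (upd tf' d.+1 I) d.+2 0 d.+1 = I by rewrite upd_ne ?upd_eq //; lia.
  have E5 : upd (upd tf' d.+1 I) d.+2 0 d = eval n s e by rewrite !upd_ne //; lia.
  apply: tr_store => //; rewrite ?E4 ?E5 //.
  + by lia.
  + move=> d' H1 H2 H3; have [->|H4] := eqVneq d' d.+2; first by rewrite upd_eq.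
    by rewrite !upd_ne // E3 //; lia.
  + do ![apply: leq_add => // | rewrite leq_mul2r]; rewrite ?HX ?He ?orbT //.
    by rewrite leq_mul2l HX orbT.
  congr mem_of; apply: functional_extensionality => y; rewrite /tf' /upd.
  case: (eqVneq y d) => [->|_]; first by rewrite t0.
  case: (eqVneq y d.+1) => [->|_]; first by rewrite t0 //; lia.
  by case: (eqVneq y d.+2) => [->|//]; rewrite t0 //; lia.
- move=> _ _; exists (fun=> 0); first by auto.
  by move=> n s tf B _ _ _; apply: tr_nop.
- move=> /andP [wa wb] dN.
  have [|T pT HT] := IHa d wa; first by lia.
  have [|T' pT' HT'] := IHb d wb; first by lia.
  exists (fun B => T B + T' (B + grow a B)).
    by have pg := pol_grow a; apply: pol_add => //; apply: (pol_comp pT'); auto.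
  move=> n s tf B nB bs t0; apply: tr_seq.
  apply: (tr_conseq (HT n s tf B nB bs t0) (leqnn _)) => _ <-.
  apply: HT' => //; first by lia.
  by apply: bnd_le (exec_bnd _ nB bs); rewrite leq_add2l; case: (pol_grow a) => _; apply.
- move=> /and3P [we wa wb] dN.
  have [|T pT HT] := @cexpr_ok e d we; first by lia.
  have [|T' pT' HT'] := IHa d wa; first by lia.
  have [|T'' pT'' HT''] := IHb d wb; first by lia.
  have dN0 : d < ND by have := dep_gt0 e; lia.
  exists (fun B => T B + (((B + esz e) * 3 + 1 + T' B + T'' B) + 2)); first by auto 15.
  move=> n s tf B nB bs t0; have He := eval_bnd e nB bs.
  apply: tr_seq; apply: HT => //; apply: tr_if; rewrite mem_t // upd_eq => E.
    rewrite E eqxx /= upd_same ?t0 //.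
    by apply: tr_conseq (HT'' n s tf B nB bs t0) (leq_addl _ _) (fun _ => id).
  rewrite E; apply: tr_conseq (fun _ => id); last exact: leq_addr.
  apply: tr_seq; apply: tr_addto; rewrite ?mem_t ?upd_eq //=; first by lia.
  rewrite added0 upd_t // updupd upd_same ?t0 //.
  by apply: (tr_conseq (HT' n s tf B nB bs t0) (leqnn _)) => _ <-.
- move=> wa dN.
  have [|T pT HT] := IHa d.+1 wa; first by lia.
  have [dN0 dN1] : d < ND /\ d.+1 < ND by lia.
  pose G B := B + B * grow a B.
  have pG : pol G by have pg := pol_grow a; apply: pol_add => //; apply: pol_mul.
  exists (fun B => (B * 9 + 2) + (B * ((1 + T (G B)) + 2) + 1)).
    by have := pol_comp pT pG; auto 15.
  move=> n s tf B nB bs t0; apply: tr_seq; apply: tr_cp0 => //; rewrite ?t0 //; try lia.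
  rewrite add0n.
  have [_ mT] := pT; have [_ mg] := pol_grow a.
  apply: (@tr_conseq _ _ (n * ((1 + T (G B)) + 2) + 1) _ _ _ _ _ (fun _ => id)); last first.
    by rewrite leq_add2r leq_mul2r nB orbT.
  pose I k R := k <= n /\ R = mem_of n (iter (n - k) (exec n a) s) (upd tf d k).
  apply: (@tr_while I) => [j R1 [Hj ->]|R1 [_ ->]|].
  + split; first by rewrite mem_t // upd_eq.
    apply: tr_seq; apply: tr_dec => //; rewrite mem_t // upd_eq upd_t // updupd /=.
    have Hb : bnd (G B) (iter (n - j.+1) (exec n a) s).
      apply: (@bnd_le (B + (n - j.+1) * grow a n)).
        by rewrite /G leq_add2l leq_mul ?mg //; lia.
      elim: (n - j.+1) => [|m IH] /=; first by rewrite addn0.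
      by rewrite mulSnr addnA; apply: exec_bnd => //; lia.
    have t0' d' : d.+1 <= d' -> upd tf d j d' = 0 by move=> H; rewrite upd_ne ?t0 //; lia.
    apply: (tr_conseq (HT n _ _ _ _ Hb t0') (leqnn _)).
      by rewrite /G; lia.
    move=> _ <-; split=> //; split; first by lia.
    by have -> : n - j = (n - j.+1).+1 by lia.
  + by rewrite mem_t // upd_eq subn0 upd_same ?t0.
  + by split=> //; rewrite subnn.
Qed.
End Compile.

Fixpoint cseq (l : seq com) : com := if l is c :: l' then Seq c (cseq l') else Nop.
Definition cst m : expr := iter m Suc Z0.
Definition addc m e : expr := iter m Suc e.

Lemma eval_cst n s m : eval n s (cst m) = m.
Proof. by elim: m => //= m ->. Qed.
Lemma eval_addc n s m e : eval n s (addc m e) = eval n s e + m.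
Proof. by elim: m => [|m IH] /=; rewrite ?addn0 // IH addnS. Qed.

Lemma iter_inv (T : Type) (I : nat -> T -> Prop) f m s :
  I 0 s -> (forall t s', t < m -> I t s' -> I t.+1 (f s')) -> I m (iter m f s).
Proof.
move=> H0 Hs; suff H k : k <= m -> I k (iter k f s) by exact: H.
by elim: k => //= k IH Hk; apply: Hs => //; apply: IH; exact: ltnW.
Qed.

Lemma exec_rep2 n c s : exec n (Rep (Rep c)) s = iter (n * n) (exec n c) s.
Proof. by rewrite /= iterM. Qed.

(** * Moving the input into the arrays and the output back to the registers *)

Section Machine.
Variables (NV ND S qr : nat) (main : com).
Hypotheses (S0 : 0 < S) (NV2 : 1 < NV) (ND7 : 7 < ND) (qrS : qr < S).
Hypotheses (main_wf : wfc NV S main) (main_dep : cdep main <= ND).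
Local Notation K := (lowmem NV ND).
Local Notation ad := (addr_of NV ND S).
Local Notation memo := (mem_of NV ND S).
Local Notation tm := (treg NV).

(* Variable 0 runs through the addresses [ad q t] and variable 1 through [t]. *)
Definition sweep q c :=
  Seq (Asg 0 (cst (K + q))) (Seq (Asg 1 Z0)
    (Rep (Rep (Seq c (Seq (Asg 1 (Suc (V 1))) (Asg 0 (addc S (V 0)))))))).

Lemma sweepP q c (I : nat -> (nat -> nat -> nat) -> Prop) n s :
  (forall s', sv (exec n c s') = sv s') ->
  (forall t s', t < n * n -> sv s' 0 = ad q t -> sv s' 1 = t -> I t (sa s') ->
     I t.+1 (sa (exec n c s'))) ->
  I 0 (sa s) -> I (n * n) (sa (exec n (sweep q c) s)).
Proof.
move=> Hv Hc H0; rewrite /sweep.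
change (I (n * n) (sa (exec n (Rep (Rep (Seq c (Seq (Asg 1 (Suc (V 1))) (Asg 0 (addc S (V 0)))))))
  (exec n (Asg 1 Z0) (exec n (Asg 0 (cst (K + q))) s))))).
rewrite exec_rep2; set s1 := exec n (Asg 1 Z0) _.
pose J t s' := [/\ sv s' 0 = ad q t, sv s' 1 = t & I t (sa s')].
suff [] : J (n * n) (iter (n * n)
  (exec n (Seq c (Seq (Asg 1 (Suc (V 1))) (Asg 0 (addc S (V 0)))))) s1) by [].
apply: iter_inv => [|t s' Ht [E0 E1 HI]].
  by split=> //; rewrite /s1 /= /upd /= eval_cst /addr_of muln0 addn0.
split; rewrite /= ?eval_addc /= /upd /= ?Hv ?E0 ?E1 //.
  by rewrite /addr_of mulnS; lia.
exact: Hc.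
Qed.

(** The loads bring the input bit of each register [r >= K] into cell [n * n + r] of array 0, so
    that the main program finds it at a place independent of the layout. Sources lie below [n * n]
    and targets from [n * n + K] on, hence nothing is overwritten before it is read. *)
Definition load q := sweep q (S2 0 Z0 (V 0) (A1 q (V 1))).
Definition dump q := sweep q (S1 q (V 1) (A2 qr Z0 (V 0))).

Lemma idx2_0 n r : idx2 n 0 r = n * n + r. Proof. by []. Qed.

Lemma ad_inj q t q' t' : q < S -> q' < S -> ad q t = ad q' t' -> q = q' /\ t = t'.
Proof.
move=> H H' E; have [_ E1 E2] := ad_decode NV ND S0 t H.
by have [_ E3 E4] := ad_decode NV ND S0 t' H'; split; [rewrite -E1 E|rewrite -E2 E].
Qed.

Lemma ad_ge q t : K <= ad q t.
Proof. by rewrite /addr_of -addnA leq_addr. Qed.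

Definition loaded n (a0 : nat -> nat -> nat) m t (a : nat -> nat -> nat) :=
  (forall q k, 0 < q \/ k < n * n + K -> a q k = a0 q k) /\
  (forall q k, k < n * n -> q < m \/ q = m /\ k < t -> a 0 (n * n + ad q k) = a0 q k).

Lemma loadP n a0 m s : m < S -> loaded n a0 m 0 (sa s) ->
  loaded n a0 m.+1 0 (sa (exec n (load m) s)).
Proof.
move=> mS H0.
have [H1 H2] : loaded n a0 m (n * n) (sa (exec n (load m) s)).
  apply: sweepP => // t s' Ht E0 E1 [H1 H2]; split=> [q k Hqk|q k Hk Hqk] /=.
    rewrite E0 idx2_0; case: ifP => [/andP [/eqP Eq /eqP Ek]|_]; last exact: H1.
    by have := ad_ge m t; case: Hqk; [rewrite Eq|rewrite Ek; lia].
  rewrite E0 E1 idx2_0 eqn_add2l /=; case: eqP => [E|NE].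
    have [|-> ->] := ad_inj _ mS E; first by lia.
    by apply: H1; right; lia.
  apply: H2 => //; case: Hqk => [|[Eq Ek]]; [by left|right; split=> //].
  by rewrite ltn_neqAle -ltnS Ek andbT; apply/eqP => Et; apply: NE; rewrite Eq Et.
split=> // q k Hk [Hq|[_]]; last by rewrite ltn0.
apply: H2 => //.
by move: Hq; rewrite ltnS leq_eqVlt => /orP [/eqP ->|]; [right|left].
Qed.

Lemma loadsP n s : let s' := exec n (cseq [seq load q | q <- iota 0 S]) s in
  loaded n (sa s) S 0 (sa s').
Proof.
have H m k s' : m + k = S -> loaded n (sa s) m 0 (sa s') ->
    loaded n (sa s) S 0 (sa (exec n (cseq [seq load q | q <- iota m k]) s')).
  elim: k m s' => [|k IH] m s' E; first by rewrite -E addn0.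
  by move=> H; apply: IH; [lia|apply: loadP => //; lia].
by apply: H => //; split=> // q k _ [|[_]]; rewrite ltn0.
Qed.

(** The reverse transport: sources have index at least [n * n], targets index below [n * n], so the
    arrays can be treated one after the other. *)
Definition dumped n (a0 : nat -> nat -> nat) m t (a : nat -> nat -> nat) :=
  (forall q k, n * n <= k -> a q k = a0 q k) /\
  (forall q k, k < n * n -> q < m \/ q = m /\ k < t -> a q k = a0 qr (n * n + ad q k)).

Lemma dumpP n a0 m s : m < S -> dumped n a0 m 0 (sa s) ->
  dumped n a0 m.+1 0 (sa (exec n (dump m) s)).
Proof.
move=> mS H0.
have [H1 H2] : dumped n a0 m (n * n) (sa (exec n (dump m) s)).
  apply: sweepP => // t s' Ht E0 E1 [H1 H2]; split=> [q k Hqk|q k Hk Hqk] /=.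
    by rewrite E1; case: ifP => [/andP [_ /eqP Ek]|_]; [lia|exact: H1].
  rewrite E0 E1 idx2_0; case: ifP => [/andP [/eqP -> /eqP ->]|NE].
    by apply: H1; lia.
  apply: H2 => //; case: Hqk => [|[Eq Ek]]; [by left|right; split=> //].
  by rewrite ltn_neqAle -ltnS Ek andbT; apply/eqP => Et; move: NE; rewrite Eq Et !eqxx.
split=> // q k Hk [Hq|[_]]; last by rewrite ltn0.
apply: H2 => //.
by move: Hq; rewrite ltnS leq_eqVlt => /orP [/eqP ->|]; [right|left].
Qed.

Lemma dumpsP n s : let s' := exec n (cseq [seq dump q | q <- iota 0 S]) s in
  dumped n (sa s) S 0 (sa s').
Proof.
have H m k s' : m + k = S -> dumped n (sa s) m 0 (sa s') ->
    dumped n (sa s) S 0 (sa (exec n (cseq [seq dump q | q <- iota m k]) s')).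
  elim: k m s' => [|k IH] m s' E; first by rewrite -E addn0.
  by move=> H; apply: IH; [lia|apply: dumpP => //; lia].
by apply: H => //; split=> // q k _ [|[_]]; rewrite ltn0.
Qed.

(** Writes the input bits of the registers below [K], which are known constants in the leaf of the
    decision tree that is being executed. *)
Definition puts (bs : seq nat) :=
  cseq [seq S2 0 Z0 (cst i.+2) (cst (nth 0 bs i)) | i <- iota 0 (size bs)].

Lemma putsP n bs s (a := sa (exec n (puts bs) s)) :
  (forall q k, 0 < q \/ k < n * n + 2 \/ n * n + (size bs).+2 <= k -> a q k = sa s q k) /\
  (forall i, i < size bs -> a 0 (n * n + i.+2) = nth 0 bs i).
Proof.
rewrite /a /puts; set f := fun i => S2 0 Z0 _ _.
have H k m s' : m + k = size bs ->
  (forall q k, 0 < q \/ k < n * n + 2 \/ n * n + (size bs).+2 <= k -> sa s' q k = sa s q k) ->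
  (forall i, i < m -> sa s' 0 (n * n + i.+2) = nth 0 bs i) ->
  let a := sa (exec n (cseq [seq f i | i <- iota m k]) s') in
  (forall q k, 0 < q \/ k < n * n + 2 \/ n * n + (size bs).+2 <= k -> a q k = sa s q k) /\
  (forall i, i < size bs -> a 0 (n * n + i.+2) = nth 0 bs i).
  elim: k m s' => [|k IH] m s' E H1 H2; first by split=> // i Hi; apply: H2; lia.
  apply: IH; first by lia.
    move=> q j Hj; rewrite /= !eval_cst idx2_0 -H1 //=.
    case: ifP => // /andP [/eqP Eq /eqP Ej]; case: Hj; first by rewrite Eq.
    by rewrite Ej; lia.
  move=> i Hi; rewrite /= !eval_cst idx2_0 eqn_add2l !eqSS /=.
  by case: eqP => [->//|Ne]; apply: H2; lia.
exact: H.
Qed.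

Definition prog bs :=
  Seq (cseq [seq load q | q <- iota 0 S]) (Seq (puts bs)
    (Seq main (cseq [seq dump q | q <- iota 0 S]))).

Lemma dep_cst m : dep (cst m) = 1. Proof. by elim: m. Qed.
Lemma wfe_cst m : wfe NV S (cst m). Proof. by elim: m. Qed.
Lemma dep_addc m e : dep (addc m e) = dep e. Proof. by elim: m. Qed.
Lemma wfe_addc m e : wfe NV S (addc m e) = wfe NV S e. Proof. by elim: m. Qed.

Lemma wfc_cseq l : wfc NV S (cseq l) = all (wfc NV S) l.
Proof. by elim: l => //= c l ->. Qed.

Lemma cdep_cseq m l : (cdep (cseq l) <= m) = all (fun c => cdep c <= m) l.
Proof. by elim: l => //= c l <-; rewrite geq_max. Qed.

Lemma prog_wf bs : wfc NV S (prog bs).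
Proof.
have HA : {in iota 0 S, forall q, wfc NV S (load q) && wfc NV S (dump q)}.
  move=> q; rewrite mem_iota /= add0n => Hq.
  by rewrite wfe_cst wfe_addc /= Hq S0 qrS NV2 (ltnW NV2).
rewrite /= !wfc_cseq !all_map main_wf; apply/and3P; split=> //=.
- by apply/allP => q /HA /andP [].
- by apply/allP => i _; rewrite /= !wfe_cst S0.
- by apply/allP => q /HA /andP [].
Qed.

Lemma prog_dep bs : cdep (prog bs) <= ND.
Proof.
rewrite /= !geq_max main_dep !cdep_cseq !all_map /=; apply/and3P; split=> //.
- by apply/allP => q _; rewrite /= dep_cst dep_addc /=; lia.
- by apply/allP => q _; rewrite /= !dep_cst /=; lia.
- by apply/allP => q _; rewrite /= dep_cst dep_addc /=; lia.
Qed.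

Definition decs (l : seq nat) := rseq [seq RI (Dec r) | r <- l].

Lemma tr_decs l R (Q : regs -> Prop) :
  Q (fun x => R x - count_mem x l) -> tr (decs l) R (size l) Q.
Proof.
elim: l R => [|b l IH] R /= HQ.
  apply: tr_nop; have -> // : R = (fun x => R x - 0).
  by apply: functional_extensionality => x; rewrite subn0.
rewrite -add1n; apply: tr_seq; apply: tr_dec => //; apply: IH.
match goal with |- Q ?F => have -> // : F = (fun x => R x - ((b == x) + count_mem x l)) end.
by apply: functional_extensionality => x; rewrite /upd; case: (eqVneq x b) => [->|_]; lia.
Qed.

(* Register [K.-1] walks through the output array and finally overwrites itself. *)
Definition walker := K.-1.
Definition epi i m := rseq
  [seq RSeq (RI (Rd j walker)) (incs (nseq S walker)) | j <- iota i m].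
Definition epilogue :=
  RSeq (idxc NV 0) (RSeq (scale NV ND S qr 0) (RSeq (addto (tm 0) [:: walker])
    (RSeq (epi 0 walker) (RI (Rd walker walker))))).

(** Consecutive cells of one array are [S] registers apart, hence [S] increments of the pointer. The
    targets lie below [K] and every source address is at least [K], so no source is lost. *)
Lemma tr_epi i m n R (Q : regs -> Prop) :
  i + m = walker -> R walker = ad qr (n * n + i) ->
  (forall R', (forall r, walker < r -> R' r = R r) ->
     (forall r, r < i -> R' r = R r) ->
     (forall r, i <= r < walker -> R' r = R (ad qr (n * n + r))) ->
     R' walker = ad qr (n * n + walker) -> Q R') ->
  tr (epi i m) R (m * S.+1) Q.
Proof.
have Kw : K = walker.+1 by [].
elim: m i R => [|m IH] i R E Ew HQ.
  rewrite addn0 in E; apply: tr_nop; apply: HQ => //; last by rewrite Ew E.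
  by move=> r; rewrite E; lia.
rewrite mulSn; apply: tr_seq; rewrite -add1n; apply: tr_seq; apply: tr_rd => //.
apply: tr_incs; first by rewrite size_nseq.
rewrite incs_nseq upd_ne; last by rewrite -E; lia.
rewrite Ew; have Ha r := ad_ge qr (n * n + r).
apply: IH => [||R' H1 H2 H3 H4]; first by lia.
  by rewrite upd_eq /addr_of; lia.
apply: HQ => // r Hr.
- by rewrite H1 // !upd_ne //; lia.
- by rewrite H2; [rewrite !upd_ne //; lia|lia].
- have [->|Hri] := eqVneq r i.
    by rewrite H2 // upd_ne ?upd_eq //; lia.
  by rewrite H3; [rewrite !upd_ne //; have := Ha r; lia|lia].
Qed.

Lemma tr_epilogue : exists2 T, pol T & forall n s,
  tr epilogue (memo n s (fun=> 0)) (T n)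
    (fun R => (forall r, r < K -> R r = sa s qr (n * n + r)) /\
              (forall r, K <= r -> R r = memo n s (fun=> 0) r)).
Proof.
pose f n := n * n.
have pf : pol f by apply: pol_mul; exact: pol_id.
have pa : pol (fun n => ad qr (f n)).
  apply: pol_add; first exact: pol_const.
  by apply: pol_mul; first exact: pol_const.
exists (fun n => ((n * 9 + 2) + ((n * (n * 9 + 5) + 1) + (f n * 4 + 1))) +
  ((f n * (S * 5 + 3) + (K + qr + 2)) + (ad qr (f n) * 4 + 1 + (walker * S.+1 + 1)))).
  by repeat first [exact: pol_id | exact: pol_const | assumption | apply: pol_add | apply: pol_mul].
move=> n s; have idx0 : idx2 n 0 0 = n * n by rewrite /idx2 add0n addn0.
apply: tr_seq; apply: tr_idxc; rewrite ?idx0 //; first by lia.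
have E0 : upd (upd (fun=> 0) 0 (n * n)) 1 0 0 = n * n by rewrite upd_ne // upd_eq.
apply: tr_seq; apply: tr_scale; rewrite ?E0 //; first by lia.
have Kw : walker = tm ND.-1 by rewrite /walker /lowmem /treg; lia.
set tf := upd _ 0 _.
have tf0 : tf 0 = ad qr (n * n) by rewrite /tf upd_eq.
have tfw : tf ND.-1 = 0 by rewrite /tf !upd_ne //; lia.
apply: tr_seq; apply: tr_addto => //.
- by rewrite inE /walker /zreg /lowmem; lia.
- by rewrite inE /walker /treg /lowmem; lia.
- by rewrite mem_t ?tf0 //; lia.
rewrite added1; last by rewrite /walker /treg /lowmem; lia.
rewrite mem_t ?tf0; last by lia.
have Ew : memo n s tf walker = 0 by rewrite Kw mem_t ?tfw //; lia.
rewrite Ew add0n.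
set R := upd _ _ 0.
have HR r : K <= r -> R r = memo n s (fun=> 0) r.
  move=> Hr; rewrite /R !upd_ne ?mem_high //; move: Hr; rewrite /walker /treg /lowmem; lia.
apply: tr_seq; apply: (@tr_epi 0 walker n) => //.
  rewrite /R upd_ne; last by rewrite /walker /treg /lowmem; lia.
  by rewrite upd_eq addn0.
move=> R' H1 _ H3 H4; apply: tr_rd => //.
have wK : walker.+1 = K by [].
split=> r Hr.
  have [->|Hn] := eqVneq r walker.
    rewrite upd_eq H4 H1; last by rewrite wK ad_ge.
    by rewrite HR ?ad_ge // mem_a.
  rewrite upd_ne // H3; last by lia.
  by rewrite HR ?ad_ge // mem_a.
by rewrite upd_ne; [rewrite H1 ?HR //; lia|lia].
Qed.

Definition s_init n (e : rel 'I_n) : st :=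
  St (fun=> 0) (fun q k => if q < S then input_regs e (ad q k) else 0).

Lemma input_le1 n (e : rel 'I_n) r : 0 < r -> input_regs e r <= 1.
Proof. by case: r => // r _; rewrite /input_regs /=; case: ifP => // _; case: edge_nat. Qed.

Lemma input_big n (e : rel 'I_n) r : n * n < r -> input_regs e r = 0.
Proof. by case: r => // r H; rewrite /input_regs /= leqNgt H. Qed.

Lemma input1 n (e : rel 'I_n) : irreflexive e -> input_regs e 1 = 0.
Proof.
move=> irr; rewrite /input_regs /=; case: ifP => // _; apply/eqP; rewrite eqb0 div0n mod0n.
apply/negP => /existsP [u /existsP [v /and3P [/eqP Eu /eqP Ev]]].
by have -> : u = v; [apply: val_inj; rewrite /= Eu Ev|rewrite irr].
Qed.

(** Every input register other than 0 holds 0 or 1, so a single truncated decrement clears it.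
    Register 1 belongs to the pair of vertex 0 with itself and is 0 already by irreflexivity, as the
    role of [zreg] demands. *)
Lemma tr_clear n (e : rel 'I_n) (Q : regs -> Prop) : irreflexive e ->
  Q (memo n (s_init e) (fun=> 0)) -> tr (decs (iota 2 K.-2)) (input_regs e) K Q.
Proof.
move=> irr HQ; apply: (@tr_conseq _ _ K.-2 _ Q) => //; last by lia.
rewrite -{2}(size_iota 2 K.-2); apply: tr_decs.
match goal with |- Q ?F => have -> // : F = memo n (s_init e) (fun=> 0) end.
apply: functional_extensionality => r.
rewrite count_uniq_mem ?iota_uniq // mem_iota.
have [rK|rK] := ltnP r K; last first.
  rewrite andbF subn0 mem_high //.
  rewrite /= ltn_mod S0; congr (input_regs e _).
  by have := divn_eq (r - K) S; rewrite /addr_of; lia.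
case: r rK => [|[|r]] rK; first by rewrite /= subn0.
  by rewrite /= input1.
rewrite (eqP (_ : input_regs e r.+2 - 1 == 0)); last by rewrite subn_eq0 input_le1.
by rewrite /mem_of /=; case: ifP => // _; rewrite rK.
Qed.

(** The contract offered to the main program: the edge bits stand in array 0 and the answer is
    expected in array [qr], both from cell [n * n] on. About lower cells nothing is promised. *)
Definition post n (e : rel 'I_n) (R : regs) := exists s0,
  [/\ forall r, 0 < r <= n * n -> sa s0 0 (n * n + r) = input_regs e r,
      forall q k, 0 < q -> n * n <= k -> sa s0 q k = 0 &
      forall r, r < n * n -> R r = sa (exec n main s0) qr (n * n + r)].

Lemma prog_post n (e : rel 'I_n) bs R : irreflexive e ->
  size bs = K.-2 -> (forall i, i < size bs -> nth 0 bs i = input_regs e i.+2) ->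
  (forall r, r < K -> R r = sa (exec n (prog bs) (s_init e)) qr (n * n + r)) ->
  (forall r, K <= r -> R r = memo n (exec n (prog bs) (s_init e)) (fun=> 0) r) ->
  post e R.
Proof.
move=> irr sbs Hbs; rewrite /prog /=.
have := loadsP n (s_init e); set s1 := exec n (cseq _) _ => -[L1 L2].
have := putsP n bs s1; set s2 := exec n (puts bs) _ => -[P1 P2].
have := dumpsP n (exec n main s2); set s3 := exec n (cseq _) _ => -[D1 D2] R1 R2.
exists s2; split=> [r Hr|q k q0 nk|r Hr].
- have [rK|rK] := ltnP r K.
    (* Cell [n * n + 1] is written neither by the loads nor by [puts]; it still holds what lay past
       the end of the input, namely 0, which is the right bit for register 1. *)
    case: r Hr rK => // -[|r] Hr rK.
      rewrite P1; last by right; left; lia.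
      rewrite L1 /=; last by right; rewrite /lowmem; lia.
      rewrite S0 input_big ?input1 // /addr_of.
      by have := leq_pmull (n * n + 1) S0; lia.
    rewrite P2 ?Hbs // sbs; move: rK; rewrite /lowmem; lia.
  rewrite P1; last by right; right; rewrite sbs; move: rK; rewrite /lowmem; lia.
  have Er : r = ad ((r - K) %% S) ((r - K) %/ S).
    by have := divn_eq (r - K) S; rewrite /addr_of; lia.
  rewrite {1}Er L2 /=.
  + by rewrite ltn_mod S0 -Er.
  + by have := leq_div (r - K) S; have : 0 < K by []; lia.
  + by left; rewrite ltn_mod.
- rewrite P1; last by left.
  rewrite L1 /=; last by left.
  case: ifP => // _; apply: input_big; rewrite /addr_of.
  by have := leq_pmull k S0; have : 0 < K by []; lia.
- have [rK|rK] := ltnP r K; first by rewrite R1 // D1 // leq_addr.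
  have Er : r = ad ((r - K) %% S) ((r - K) %/ S).
    by have := divn_eq (r - K) S; rewrite /addr_of; lia.
  rewrite R2 // mem_high // D2 -?Er //; last by left; rewrite ltn_mod.
  by have := leq_div (r - K) S; have : 0 < K by []; lia.
Qed.

Definition leaf bs := RSeq (decs (iota 2 K.-2)) (RSeq (ccom NV ND S (prog bs) 0) epilogue).

(* The low input bits, whose registers are needed as work space, are first
   memorised in the program counter. *)
Fixpoint tree m bs pc : seq instr :=
  if m is m'.+1 then
    let t := tree m' (rcons bs 1) pc.+1 in
    Jz (size bs).+2 (pc.+1 + size t) :: t ++ tree m' (rcons bs 0) (pc.+1 + size t)
  else rcode (leaf bs) pc ++ [:: Halt].

Lemma tree_ok m bs : size bs + m = K.-2 -> exists2 T, pol T &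
  forall n (e : rel 'I_n) P pc, 2 <= n -> irreflexive e -> code_at P pc (tree m bs pc) ->
  (forall i, i < size bs -> nth 0 bs i = input_regs e i.+2) ->
  exists t pc' R', [/\ t <= T n, steps P t (pc, input_regs e) = Some (pc', R'),
    nth Halt P pc' = Halt & post e R'].
Proof.
elim: m bs => [|m IH] bs Em.
  have [T pT HT] := @ccom_ok _ ND _ S0 (prog bs) 0 (prog_wf bs) (prog_dep bs).
  have [T' pT' HT'] := tr_epilogue.
  exists (fun n => K + (T n + T' n)).
    by repeat first [assumption | exact: pol_const | apply: pol_add].
  move=> n e P pc n2 irr; rewrite -[tree 0 bs pc]/(rcode (leaf bs) pc ++ [:: Halt]).
  move=> /code_at_cat [C1 /code_at_cons [C2 _]] Hbs.
  rewrite size_rcode in C2.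
  have : tr (leaf bs) (input_regs e) (K + (T n + T' n)) (post e).
    apply: tr_seq; apply: tr_clear => //; apply: tr_seq.
    have bs0 : bnd n (s_init e).
      split=> [x|q k] //=; case: ifP => // _.
      by apply: leq_trans (input_le1 _ _) _; [exact: leq_trans (ad_ge q k)|lia].
    apply: (tr_conseq (HT n _ (fun=> 0) n (leqnn n) bs0 (fun _ _ => erefl)) (leqnn _)) => _ <-.
    apply: (tr_conseq (HT' n _) (leqnn _)) => R [H1 H2].
    by apply: (@prog_post n e bs) => //; rewrite -Em addn0.
  by move=> /(_ _ _ C1) [t [R' [Ht Hs HR]]]; exists t, (pc + rsz (leaf bs)), R'.
have [|T1 pT1 H1] := IH (rcons bs 1); first by rewrite size_rcons; lia.
have [|T0 pT0 H0] := IH (rcons bs 0); first by rewrite size_rcons; lia.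
exists (fun n => (T1 n + T0 n) + 1).
  by repeat first [assumption | exact: pol_const | apply: pol_add].
move=> n e P pc n2 irr /= /code_at_cons [C0 /code_at_cat [C1 C2]] Hbs.
have Hb b : input_regs e (size bs).+2 = b ->
    forall i, i < size (rcons bs b) -> nth 0 (rcons bs b) i = input_regs e i.+2.
  move=> Eb i; rewrite size_rcons ltnS leq_eqVlt nth_rcons => /orP [/eqP ->|Hi].
    by rewrite ltnn eqxx.
  by rewrite Hi Hbs.
have [E0|E0] := eqVneq (input_regs e (size bs).+2) 0.
  have [t [pc' [R' [Ht Hs Hh HR]]]] := H0 n e P _ n2 irr C2 (Hb _ E0).
  exists t.+1, pc', R'; split=> //; first by lia.
  by rewrite /= C0 E0.
have E1 : input_regs e (size bs).+2 = 1.
  by have := input_le1 e (ltn0Sn (size bs).+1); lia.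
have [t [pc' [R' [Ht Hs Hh HR]]]] := H1 n e P _ n2 irr C1 (Hb _ E1).
exists t.+1, pc', R'; split=> //; first by lia.
by rewrite /= C0 E1.
Qed.

Theorem machine : exists (P : seq instr) (c k : nat), forall n (e : rel 'I_n),
  2 <= n -> irreflexive e ->
  exists R, run P (c * n ^ k) (0, input_regs e) = Some R /\ post e R.
Proof.
have [|T [[c [k HT]] _] H] := @tree_ok K.-2 [::]; first by [].
exists (tree K.-2 [::] 0), c, (2 * k) => n e n2 irr.
have [|t [pc' [R' [Ht Hs Hh HR]]]] := H n e (tree K.-2 [::] 0) 0 n2 irr (fun i _ => erefl); first by [].
exists R'; split=> //.
have tT : t <= c * n ^ (2 * k).
  (* The exponent is doubled because [n.+1 <= n ^ 2] for [n >= 2]. *)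
  apply: leq_trans Ht _; apply: leq_trans (HT n) _; rewrite leq_mul2l expnM.
  case: k {HT} => [|k]; first by rewrite orbT.
  by rewrite leq_exp2r // -mulnn; apply/orP; right; nia.
rewrite -(subnKC tT) (run_steps _ Hs) run_halted //.
by rewrite /step Hh.
Qed.
End Machine.

(* A tuple [a x1 x2 x3 x4 b] encodes the path obtained by merging repeated
   consecutive entries: an ear with 3 or 4 inner vertices in [eff], with 2 in
   [two]; in [rrs] the vertex [x1] and then its neighbour [x2] are attached. *)
Definition eff (adj : rel nat) (A : pred nat) a x1 x2 x3 x4 b :=
  [&& A a, A b, ~~ A x1, ~~ A x2 & ~~ A x3] &&
  [&& ~~ A x4, adj a x1, adj x1 x2, adj x2 x3 & (x4 == x3) || adj x3 x4] &&
  [&& adj x4 b, x1 != x3, x4 != x1 & x4 != x2].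

(** * The 2x3 grid *)

(** Vertex [2 * i + k] is the place of agent [k] in the configuration number [i] of three, in
    agreement with the order of [wv]. *)
Definition gadj : rel nat := fun i k => (i, k) \in
  [:: (0,1); (1,0); (2,3); (3,2); (4,5); (5,4); (0,2); (2,0); (1,3); (3,1);
      (2,4); (4,2); (3,5); (5,3)].

Definition heff (e : rel nat) A s := has (fun a => has (fun x1 => has (fun x2 =>
  has (fun x3 => has (fun x4 => has (fun b => eff e A a x1 x2 x3 x4 b) s) s) s) s) s) s.

Definition grid_mask i k := mkseq (fun m => (m == i) || (m == k)) 6.

Lemma grid_maskE i k m : m < 6 -> nth false (grid_mask i k) m = (m == i) || (m == k).
Proof. by move=> H; rewrite nth_mkseq. Qed.

Lemma heffP e A s : reflect (exists a x1 x2 x3 x4 b, all (mem s) [:: a; x1; x2; x3; x4; b] /\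
   eff e A a x1 x2 x3 x4 b) (heff e A s).
Proof.
apply: (iffP hasP) => [[a as_ /hasP [x1 H1 /hasP [x2 H2 /hasP [x3 H3 /hasP [x4 H4 /hasP [b Hb E]]]]]]|].
  by exists a, x1, x2, x3, x4, b; split=> //=; rewrite as_ H1 H2 H3 H4 Hb.
move=> [a [x1 [x2 [x3 [x4 [b [/= /and5P [Ha H1 H2 H3 /and3P [H4 Hb _]] E]]]]]]].
exists a => //; apply/hasP; exists x1 => //; apply/hasP; exists x2 => //; apply/hasP.
by exists x3 => //; apply/hasP; exists x4 => //; apply/hasP; exists b.
Qed.

(** Six closed ears around one of the two faces, and two paths that join opposite corners of the
    first face by way of the second. All have three inner vertices, whence the repeated fourth
    entry. *)
Definition grid_ears := [:: [:: 0;1;3;2;2;0]; [:: 1;0;2;3;3;1]; [:: 2;0;1;3;3;2];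
  [:: 3;1;0;2;2;3]; [:: 0;2;4;5;5;3]; [:: 1;3;5;4;4;2]; [:: 4;2;3;5;5;4]; [:: 5;3;2;4;4;5]].

Lemma grid_search : all (fun i => all (fun k => gadj i k || has (fun g =>
  if g is [:: a; x1; x2; x3; x4; b]
  then all (fun x => x \in iota 0 6) g &&
       eff gadj (nth false (grid_mask i k)) a x1 x2 x3 x4 b
  else false) grid_ears) (iota 0 6)) (iota 0 6).
Proof. by vm_compute. Qed.

Lemma grid_pair i k : i < 6 -> k < 6 -> ~~ gadj i k ->
  heff gadj (nth false (grid_mask i k)) (iota 0 6).
Proof.
move=> i6 k6 /negbTE g; have /allP /(_ i) := grid_search; rewrite mem_iota => /(_ i6).
move=> /allP /(_ k); rewrite mem_iota g => /(_ k6) /hasP [].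
case=> [|a [|x1 [|x2 [|x3 [|x4 [|b []]]]]]] // _ /andP [H E].
by apply/heffP; exists a, x1, x2, x3, x4, b.
Qed.

Lemma grid_single i : i < 6 -> heff gadj (nth false (grid_mask i i)) (iota 0 6).
Proof. by move=> i6; apply: grid_pair => //; case: i i6 => [|[|[|[|[|[|]]]]]]. Qed.

(** Every edge of the grid lies on a face, and the detour is the rest of that face. It serves to
    replace an edge of a short ear, which gains two inner vertices. *)
Lemma grid_detour i k : i < 6 -> k < 6 -> gadj i k ->
  exists u v, [/\ u < 6, v < 6 &
    [/\ gadj i u, gadj u v, gadj v k & (u != k) && (v != i)]].
Proof.
have H : all (fun i => all (fun k => gadj i k ==> has (fun u => has (fun v =>
    [&& gadj i u, gadj u v, gadj v k & (u != k) && (v != i)]) (iota 0 6)) (iota 0 6))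
    (iota 0 6)) (iota 0 6) by vm_compute.
move=> i6 k6 g; move/allP: H => /(_ i); rewrite mem_iota => /(_ i6) /allP /(_ k).
rewrite mem_iota g => /(_ k6) /hasP [u Hu /hasP [v Hv /and4P [g1 g2 g3 g4]]].
by exists u, v; rewrite !mem_iota in Hu Hv.
Qed.

(** * Greedy ear additions *)

Section Greedy.
Variables (n : nat) (adj : rel nat).
Hypotheses (adjC : symmetric adj) (adjI : irreflexive adj).
Hypothesis adj_lt : forall u v, adj u v -> u < n.

Local Notation eff := (eff adj).

Definition two (A : pred nat) a x1 x2 x3 x4 b :=
  [&& A a, A b, ~~ A x1 & ~~ A x2] &&
  [&& x3 == x2, x4 == x2, adj a x1, adj x1 x2 & adj x2 b].

Definition dom (A : pred nat) v := has (fun w => A w && adj w v) (iota 0 n).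

Definition rrs (A : pred nat) a x1 x2 x3 x4 b :=
  [&& A a, ~~ A x1, ~~ A x2 & ~~ dom A x2] &&
  [&& x3 == x2, x4 == x2, b == a, adj a x1 & adj x1 x2].

Definition addA (A : pred nat) x1 x2 x3 x4 : pred nat :=
  fun v => A v || (v \in [:: x1; x2; x3; x4]).

Fixpoint ecost (g : seq nat) :=
  if g is u :: (v :: _) as g' then (u != v) + ecost g' else 0.

(** The indices are the attached set, the ears with the latest one first, the total cost and the
    number of pendant paths. A pendant path is logged as two closed ears with one inner vertex each,
    so that only ears occur in the reverse pass; its cost 4 is that of two doubled edges. *)
Inductive greedy : pred nat -> seq (seq nat) -> nat -> nat -> Prop :=
| G0 : greedy (fun v => v == 0) [::] 0 0
| GE A l c r a x1 x2 x3 x4 b : greedy A l c r -> eff A a x1 x2 x3 x4 b ->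
    greedy (addA A x1 x2 x3 x4) ([:: a; x1; x2; x3; x4; b] :: l)
           (c + ecost [:: a; x1; x2; x3; x4; b]) r
| GT A l c r a x1 x2 x3 x4 b : greedy A l c r ->
    (forall a x1 x2 x3 x4 b, ~~ eff A a x1 x2 x3 x4 b) -> two A a x1 x2 x3 x4 b ->
    greedy (addA A x1 x2 x3 x4) ([:: a; x1; x2; x3; x4; b] :: l)
           (c + ecost [:: a; x1; x2; x3; x4; b]) r
| GR A l c r a x1 x2 x3 x4 b : greedy A l c r ->
    (forall a x1 x2 x3 x4 b, ~~ eff A a x1 x2 x3 x4 b) ->
    (forall a x1 x2 x3 x4 b, ~~ two A a x1 x2 x3 x4 b) -> rrs A a x1 x2 x3 x4 b ->
    greedy (addA A x1 x2 x3 x4)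
      ([:: x1; x2; x2; x2; x2; x1] :: [:: a; x1; x1; x1; x1; a] :: l)
      (c + ecost [:: x1; x2; x2; x2; x2; x1] + ecost [:: a; x1; x1; x1; x1; a]) r.+1.

Definition cardA (A : pred nat) := count A (iota 0 n).

Lemma adj_neq u v : adj u v -> u != v.
Proof. by move=> H; apply/eqP => E; rewrite E adjI in H. Qed.

Lemma adj_lt2 u v : adj u v -> v < n.
Proof. by rewrite adjC; apply: adj_lt. Qed.

Lemma domP (A : pred nat) v : reflect (exists2 w, A w & adj w v) (dom A v).
Proof.
apply: (iffP hasP) => [[w _ /andP [H1 H2]]|[w H1 H2]]; first by exists w.
by exists w; rewrite ?H1 ?mem_iota //= add0n; exact: adj_lt H2.
Qed.

Lemma cardA_add (A : pred nat) x1 x2 x3 x4 :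
  all (fun x => ~~ A x && (x < n)) [:: x1; x2; x3; x4] ->
  cardA (addA A x1 x2 x3 x4) = cardA A + size (undup [:: x1; x2; x3; x4]).
Proof.
move=> H; set xs := [:: x1; x2; x3; x4] in H *.
have -> : cardA (addA A x1 x2 x3 x4) = count (predU A (mem xs)) (iota 0 n) by [].
have E : count (predI A (mem xs)) (iota 0 n) = 0.
  rewrite (@eq_count _ _ pred0) ?count_pred0 // => x /=.
  by apply/negP => /andP [Ax /(allP H)]; rewrite Ax.
have := count_predUI A (mem xs) (iota 0 n); rewrite E addn0 => ->.
congr (_ + _); rewrite -size_filter; apply: perm_size.
apply: uniq_perm; rewrite ?undup_uniq ?filter_uniq ?iota_uniq // => x.
rewrite mem_undup mem_filter mem_iota /= add0n.
by apply: andb_idr => /(allP H) /andP [].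
Qed.

Lemma eff_facts A a x1 x2 x3 x4 b : eff A a x1 x2 x3 x4 b ->
  [/\ all (fun x => ~~ A x && (x < n)) [:: x1; x2; x3; x4],
      size (undup [:: x1; x2; x3; x4]) = 3 + (x4 != x3) &
      ecost [:: a; x1; x2; x3; x4; b] = 4 + (x4 != x3)].
Proof.
move=> /andP [/andP [/and5P [Aa Ab A1 A2 A3] /and5P [A4 e1 e2 e3 e4]] /and4P [e5 n13 n41 n42]].
have n12 := adj_neq e2; have n23 := adj_neq e3.
have na1 := adj_neq e1; have n4b := adj_neq e5.
split.
- by rewrite /= A1 A2 A3 A4 (adj_lt e2) (adj_lt e3) (adj_lt2 e3) (adj_lt e5).
- rewrite /= !inE (negbTE n12) (negbTE n13) (eq_sym x1 x4) (negbTE n41) /=.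
  rewrite (negbTE n23) (eq_sym x2 x4) (negbTE n42) /= (eq_sym x3).
  by case: (x4 == x3).
- by rewrite /= na1 n12 n23 n4b (eq_sym x3); case: (x4 == x3).
Qed.

Lemma two_facts A a x1 x2 x3 x4 b : two A a x1 x2 x3 x4 b ->
  [/\ all (fun x => ~~ A x && (x < n)) [:: x1; x2; x3; x4],
      size (undup [:: x1; x2; x3; x4]) = 2, x1 != x2,
      addA A x1 x2 x3 x4 =1 addA A x1 x2 x2 x2 &
      ecost [:: a; x1; x2; x3; x4; b] = 3].
Proof.
move=> /andP [/and4P [Aa Ab A1 A2] /and5P [/eqP -> /eqP -> e1 e2 e3]].
have n12 := adj_neq e2; split=> //.
- by rewrite /= A1 A2 (adj_lt e2) (adj_lt e3).
- by rewrite /= !inE eqxx (negbTE n12).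
- by rewrite /= !eqxx (adj_neq e1) n12 (adj_neq e3).
Qed.

Lemma rrs_facts A a x1 x2 x3 x4 b : rrs A a x1 x2 x3 x4 b ->
  [/\ all (fun x => ~~ A x && (x < n)) [:: x1; x2; x3; x4],
      size (undup [:: x1; x2; x3; x4]) = 2, x1 != x2,
      addA A x1 x2 x3 x4 =1 addA A x1 x2 x2 x2 &
      ecost [:: x1; x2; x2; x2; x2; x1] + ecost [:: a; x1; x1; x1; x1; a] = 4].
Proof.
move=> /andP [/and4P [Aa A1 A2 dx] /and5P [/eqP -> /eqP -> /eqP _ e1 e2]].
have n12 := adj_neq e2; have na1 := adj_neq e1; split=> //.
- by rewrite /= A1 A2 (adj_lt e2) (adj_lt2 e2).
- by rewrite /= !inE eqxx (negbTE n12).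
- by rewrite /= !eqxx n12 na1 eq_sym n12 eq_sym na1.
Qed.

Hypothesis n0 : 0 < n.

Lemma cardA0 : cardA (fun v => v == 0) = 1.
Proof. by rewrite /cardA count_uniq_mem ?iota_uniq // mem_iota n0. Qed.

(** The worst ratio of cost to new vertices is that of pendant paths, 4 to 2. This crude bound on
    [c] is what the case without 4-cycles and the fuel estimates rest on. *)
Lemma greedy_basic A l c r : greedy A l c r ->
  [/\ A 0, forall v, A v -> v < n, c <= 2 * (cardA A).-1 & 0 < cardA A].
Proof.
elim=> {A l c r}
  [|A l c r a x1 x2 x3 x4 b _ [A0 AN Hc Hp] /eff_facts [H1 H2 H3]
   |A l c r a x1 x2 x3 x4 b _ [A0 AN Hc Hp] _ /two_facts [H1 H2 _ _ H3]
   |A l c r a x1 x2 x3 x4 b _ [A0 AN Hc Hp] _ _ /rrs_facts [H1 H2 _ _ H3]].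
- by split=> [||//|]; rewrite ?cardA0 // => v /eqP ->.
- rewrite cardA_add // H2 H3; split; [by rewrite /addA A0| | lia | lia].
  by move=> v /orP [/AN //|/(allP H1) /andP []].
- rewrite cardA_add // H2 H3; split; [by rewrite /addA A0| | lia | lia].
  by move=> v /orP [/AN //|/(allP H1) /andP []].
- rewrite cardA_add // H2 -addnA H3; split; [by rewrite /addA A0| | lia | lia].
  by move=> v /orP [/AN //|/(allP H1) /andP []].
Qed.

(** * Comparison with an arbitrary spanning walk *)

Variables (C : nat -> nat * nat) (l : nat).
Hypothesis Cadj : forall t, t <= l -> adj (C t).1 (C t).2.
Hypothesis Cstep1 : forall t, t < l -> ((C t).1 == (C t.+1).1) || adj (C t).1 (C t.+1).1.
Hypothesis Cstep2 : forall t, t < l -> ((C t).2 == (C t.+1).2) || adj (C t).2 (C t.+1).2.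
Hypothesis Cspan : forall v, v < n -> exists2 t, t <= l & (C t).1 = v \/ (C t).2 = v.

Definition vis v t := ((C t).1 == v) || ((C t).2 == v).
Definition fst_vis v := find (vis v) (iota 0 l.+1).
Local Notation f := fst_vis.

Lemma f_le v t : t <= l -> vis v t -> f v <= t.
Proof.
move=> tl Hv; rewrite leqNgt; apply/negP => H.
by have := before_find 0 H; rewrite nth_iota // add0n Hv.
Qed.

Lemma f_P v : v < n -> f v <= l /\ vis v (f v).
Proof.
move=> vn; have [t tl Ht] := Cspan vn.
have Hv : vis v t by rewrite /vis; case: Ht => ->; rewrite eqxx ?orbT.
have fl := leq_trans (f_le tl Hv) tl; split=> //.
have H : has (vis v) (iota 0 l.+1) by rewrite has_find size_iota ltnS.
by have := nth_find 0 H; rewrite nth_iota ?add0n.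
Qed.

Definition dbl t := (f (C t.+1).1 == t.+1) && (f (C t.+1).2 == t.+1).
(** Besides counting the steps that are not double, this is constant along consecutive double steps
    and thus numbers the runs: [rn (f v)] is the run in which [v] is first visited. *)
Definition rn t := count (fun i => ~~ dbl i) (iota 0 t).
Definition dn t := count dbl (iota 0 t).

Lemma iotaS m : iota 0 m.+1 = rcons (iota 0 m) m.
Proof. by rewrite -addn1 iotaD add0n cats1. Qed.

Lemma rnS t : rn t.+1 = rn t + ~~ dbl t.
Proof. by rewrite /rn iotaS -cats1 count_cat /= addn0. Qed.
Lemma dnS t : dn t.+1 = dn t + dbl t.
Proof. by rewrite /dn iotaS -cats1 count_cat /= addn0. Qed.

Lemma rn_dn t : rn t + dn t = t.
Proof. by elim: t => // t IH; rewrite rnS dnS addnACA IH; case: (dbl t); rewrite addn1. Qed.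

Lemma rn_mono t t' : t <= t' -> rn t <= rn t'.
Proof. by move=> H; rewrite -(subnKC H) /rn iotaD count_cat leq_addr. Qed.

Lemma Cf1 t : t <= l -> f (C t).1 <= t.
Proof. by move=> tl; apply: f_le => //; rewrite /vis eqxx. Qed.
Lemma Cf2 t : t <= l -> f (C t).2 <= t.
Proof. by move=> tl; apply: f_le => //; rewrite /vis eqxx orbT. Qed.

(** The initial configuration contributes at most two vertices, a double step at most two and any
    other step at most one. *)
Lemma count_first_visits t : t <= l ->
  count (fun v => f v <= t) (iota 0 n) <= 2 + 2 * dn t + rn t.
Proof.
have sub_le (p : pred nat) (s : seq nat) :
    (forall v, v < n -> p v -> v \in s) -> count p (iota 0 n) <= size s.
  move=> H; rewrite -size_filter; apply: uniq_leq_size; first by rewrite filter_uniq ?iota_uniq.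
  by move=> v; rewrite mem_filter mem_iota /= add0n => /andP [pv vn]; apply: H.
elim: t => [_|t IH tl].
  apply: leq_trans (sub_le _ [:: (C 0).1; (C 0).2] _) _ => // v vn.
  rewrite leqn0 => /eqP f0; have [_] := f_P vn.
  by rewrite f0 /vis !inE !(eq_sym v).
have -> : count (fun v => f v <= t.+1) (iota 0 n) =
    count (fun v => f v <= t) (iota 0 n) + count (fun v => f v == t.+1) (iota 0 n).
  rewrite -count_predUI [X in _ + X](@eq_count _ _ pred0) ?count_pred0 ?addn0.
    by apply: eq_count => v /=; rewrite leq_eqVlt orbC.
  by move=> v /=; lia.
have {}IH := IH (ltnW tl).
have H v : v < n -> f v == t.+1 -> v \in [:: (C t.+1).1; (C t.+1).2].
  by move=> vn /eqP fv; have [_] := f_P vn; rewrite fv /vis !inE !(eq_sym v).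
suff : count (fun v => f v == t.+1) (iota 0 n) <= 1 + dbl t.
  by move=> Hs; apply: leq_trans (leq_add IH Hs) _; rewrite dnS rnS; case: (dbl t) => /=; lia.
rewrite /dbl; have [E1|E1] := eqVneq (f (C t.+1).1) t.+1; last first.
  apply: (@sub_le _ [:: (C t.+1).2]) => v vn fv.
  by have := H v vn fv; rewrite !inE => /orP [/eqP E|] //; rewrite E in fv; rewrite fv in E1.
have [E2|E2] := eqVneq (f (C t.+1).2) t.+1; first exact: (@sub_le _ [:: (C t.+1).1; (C t.+1).2]).
apply: (@sub_le _ [:: (C t.+1).1]) => v vn fv.
by have := H v vn fv; rewrite !inE => /orP [//|/eqP E]; rewrite E in fv; rewrite fv in E2.
Qed.

Lemma n_le : n <= 2 + 2 * dn l + rn l.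
Proof.
apply: leq_trans (count_first_visits (leqnn l)).
rewrite -{1}(size_iota 0 n) -count_predT leq_eqVlt; apply/orP; left; apply/eqP.
apply: eq_in_count => v; rewrite mem_iota /= add0n => vn.
by have [-> _] := f_P vn.
Qed.

Lemma dbl_square t : t < l -> dbl t ->
  [/\ adj (C t).1 (C t.+1).1, adj (C t).2 (C t.+1).2,
      (C t).1 != (C t.+1).2 & (C t).2 != (C t.+1).1].
Proof.
move=> tl /andP [/eqP E1 /eqP E2].
have := Cf1 (ltnW tl); have := Cf2 (ltnW tl) => F2 F1.
have := Cstep1 tl; have := Cstep2 tl.
have [E|_] := eqVneq (C t).1 (C t.+1).1; first by move: F1; rewrite E E1; lia.
have [E|_] := eqVneq (C t).2 (C t.+1).2; first by move: F2; rewrite E E2; lia.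
move=> /= -> ->; split=> //; apply/eqP => E.
  by move: F1; rewrite E E2; lia.
by move: F2; rewrite E E1; lia.
Qed.

Definition no_eff A := forall a x1 x2 x3 x4 b, ~~ eff A a x1 x2 x3 x4 b.
Definition no_two A := forall a x1 x2 x3 x4 b, ~~ two A a x1 x2 x3 x4 b.
Definition no_rrs A := forall a x1 x2 x3 x4 b, ~~ rrs A a x1 x2 x3 x4 b.

(** Suppose [a'] and [b'] avoid [A]. If [a] and [b] both lie in [A], then [a a' b' b] is an ear with
    two inner vertices; if only one does, the square is a closed ear at it with three inner
    vertices. *)
Lemma square_meets (A : pred nat) a b a' b' : no_eff A -> no_two A ->
  adj a b -> adj a' b' -> adj a a' -> adj b b' -> a != b' -> b != a' ->
  A a || A b -> A a' || A b'.
Proof.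
move=> nE nT ab ab' aa bb d1 d2 H; apply: contraT; rewrite negb_or => /andP [Na' Nb'].
have [Aa|Na] := boolP (A a); have [Ab|Nb] := boolP (A b).
- have /negP [] := nT a a' b' b' b' b.
  by rewrite /two Aa Ab Na' Nb' !eqxx aa ab' adjC bb.
- have /negP [] := nE a a' b' b b a.
  by rewrite /eff Aa Na' Nb' Nb aa ab' (adjC b') bb eqxx adjC ab (eq_sym a') d2 adj_neq.
- have /negP [] := nE b b' a' a a b.
  by rewrite /eff Ab Na' Nb' Na bb (adjC b') ab' (adjC a') aa eqxx ab (eq_sym b') d1 adj_neq.
- by move: H; rewrite (negbTE Na) (negbTE Nb).
Qed.

Lemma rn_dbl i t : rn i = rn (i + t) -> forall j, i <= j < i + t -> dbl j.
Proof.
move=> E j Hj; apply: contraT => Nd.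
have := rnS j; rewrite Nd addn1 => Ej.
by have := rn_mono (_ : i <= j); have := rn_mono (_ : j.+1 <= i + t); lia.
Qed.

Lemma run_meets (A : pred nat) i j : no_eff A -> no_two A -> i <= l -> j <= l ->
  rn i = rn j -> A (C i).1 || A (C i).2 -> A (C j).1 || A (C j).2.
Proof.
move=> nE nT.
have H t k : k + t <= l -> rn k = rn (k + t) ->
    A (C k).1 || A (C k).2 = A (C (k + t)).1 || A (C (k + t)).2.
  elim: t => [|t IH] kt E; first by rewrite addn0.
  have D := rn_dbl E.
  have Dt : dbl (k + t) by apply: D; lia.
  rewrite IH; last by have := rnS (k + t); rewrite addnS in E; rewrite Dt; lia.
    have tl : k + t < l by lia.
    have [e1 e2 n1 n2] := dbl_square tl Dt.
    have ab := Cadj (ltnW tl); have ab' := Cadj tl; rewrite addnS.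
    apply/idP/idP; apply: square_meets => //.
    + by rewrite adjC.
    + by rewrite adjC.
    + by rewrite eq_sym.
    + by rewrite eq_sym.
  by lia.
move=> il jl E; have [ij|ij] := leqP i j.
  by rewrite (H (j - i)) subnKC.
by have := H (i - j) j; rewrite subnKC ?(ltnW ij) // => ->.
Qed.

(** Within a run, meeting [A] passes from each configuration to the next and back. The configuration
    that first visits [y] would then have its other agent in [A], next to [y], against
    [~~ dom A y]. *)
Lemma dom_run (A : pred nat) w y : no_eff A -> no_two A ->
  A w -> w < n -> y < n -> ~~ A y -> ~~ dom A y -> rn (f w) != rn (f y).
Proof.
move=> nE nT Aw wn yn Ny Dy; apply/eqP => E.
have [fw vw] := f_P wn; have [fy vy] := f_P yn.
have : A (C (f w)).1 || A (C (f w)).2.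
  by case/orP: vw => /eqP ->; rewrite Aw ?orbT.
move=> /(run_meets nE nT fw fy E).
have cy := Cadj fy; case/orP: vy => /eqP Ey; rewrite Ey (negbTE Ny) ?orbF /= => Az;
  case/negP: Dy; apply/domP; rewrite -Ey; [exists (C (f y)).2|exists (C (f y)).1] => //.
by rewrite adjC.
Qed.

Definition runs (A : pred nat) := size (undup [seq rn (f v) | v <- iota 0 n & A v]).

Lemma runs_le A : runs A <= (rn l).+1.
Proof.
rewrite -(size_iota 0 (rn l).+1); apply: uniq_leq_size; first exact: undup_uniq.
move=> r; rewrite mem_undup => /mapP [v]; rewrite mem_filter mem_iota /= add0n => /andP [_ vn] ->.
by rewrite (mem_iota 0 (rn l).+1) /= add0n ltnS rn_mono //; have [] := f_P vn.
Qed.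

Lemma runs_sub (A A' : pred nat) : (forall v, A v -> A' v) -> runs A <= runs A'.
Proof.
move=> H; apply: uniq_leq_size; first exact: undup_uniq.
move=> r; rewrite !mem_undup => /mapP [v]; rewrite mem_filter => /andP [Av vn] ->.
by apply/mapP; exists v => //; rewrite mem_filter (H _ Av).
Qed.

(** The end [x2] of the pendant path is at distance 2 from [A], so by [dom_run] its run has not been
    met by [A] yet. *)
Lemma runs_rrs (A : pred nat) a x1 x2 x3 x4 b : no_eff A -> no_two A ->
  (forall v, A v -> v < n) ->
  rrs A a x1 x2 x3 x4 b -> runs A < runs (addA A x1 x2 x3 x4).
Proof.
move=> nE nT AN H; have [Hx _ _ _ _] := rrs_facts H.
have /and5P [_ /andP [_ x2n] _ _ _] := Hx.
case/andP: H => /and4P [_ _ A2 D2] _.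
rewrite /runs.
set s := [seq _ | v <- _]; set s' := [seq _ | v <- _].
change (size (rn (f x2) :: undup s) <= size (undup s')).
apply: uniq_leq_size => [|r].
  rewrite /= undup_uniq andbT mem_undup; apply/negP => /mapP [v].
  rewrite mem_filter mem_iota /= add0n => /andP [Av vn] E.
  by have := dom_run nE nT Av vn x2n A2 D2; rewrite E eqxx.
rewrite inE => /orP [/eqP ->|]; rewrite !mem_undup.
  by apply/mapP; exists x2 => //; rewrite mem_filter mem_iota /= x2n /addA !inE eqxx !orbT.
move=> /mapP [v]; rewrite mem_filter => /andP [Av vn] ->.
by apply/mapP; exists v => //; rewrite mem_filter /addA Av.
Qed.

(** Strict because the run of vertex 0 is there before any pendant path is added. *)
Lemma greedy_runs A lg c r : greedy A lg c r -> r < runs A.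
Proof.
elim=> {A lg c r}
  [|A lg c r a x1 x2 x3 x4 b _ H _|A lg c r a x1 x2 x3 x4 b _ H _ _
   |A lg c r a x1 x2 x3 x4 b G H nE nT R].
- suff : rn (f 0) \in undup [seq rn (f v) | v <- iota 0 n & v == 0] by rewrite /runs; case: undup.
  by rewrite mem_undup; apply: map_f; rewrite mem_filter mem_iota /= n0.
- by apply: leq_trans H (runs_sub _) => v Av; rewrite /addA Av.
- by apply: leq_trans H (runs_sub _) => v Av; rewrite /addA Av.
- have [_ AN _ _] := greedy_basic G.
  exact: leq_ltn_trans H (runs_rrs nE nT AN R).
Qed.

(** * Windows *)

(* The new vertices of three consecutive double steps form a 2x3 grid. *)
Definition full j := [&& dbl (3 * j), dbl (3 * j + 1) & dbl (3 * j + 2)].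
Definition wv j := [:: (C (3 * j + 1)).1; (C (3 * j + 1)).2; (C (3 * j + 2)).1;
                       (C (3 * j + 2)).2; (C (3 * j + 3)).1; (C (3 * j + 3)).2].
Definition wins := [seq j <- iota 0 (l %/ 3) | full j].

(** An aligned block of three steps that is not full has at most two double steps and at least one
    other step to charge them to. At most two steps remain after the last block, hence the
    successor. *)
Lemma wins_count : dn l <= 3 * size wins + 2 * (rn l).+1.
Proof.
have H k : dn (3 * k) <= 3 * size [seq j <- iota 0 k | full j] + 2 * rn (3 * k).
  elim: k => [|k IH]; first by rewrite muln0.
  rewrite iotaS -cats1 filter_cat size_cat; move: IH; set F := size _; rewrite /=.
  have -> : 3 * k.+1 = (3 * k).+3 by lia.
  rewrite !dnS !rnS /full addn1 addn2.
  by case: (dbl _) => /=; case: (dbl _) => /=; case: (dbl _) => /=; lia.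
have E : l = 3 * (l %/ 3) + l %% 3 by rewrite mulnC -divn_eq.
have {}H := H (l %/ 3); have lt3 := ltn_pmod l (isT : 0 < 3).
have : dn l <= dn (3 * (l %/ 3)) + 2.
  rewrite {1}E /dn iotaD count_cat leq_add2l.
  by apply: leq_trans (count_size _ _) _; rewrite size_iota -ltnS.
have : rn (3 * (l %/ 3)) <= rn l by apply: rn_mono; rewrite {2}E leq_addr.
by rewrite /wins; lia.
Qed.

Lemma win_bound j : j \in wins -> 3 * j + 3 <= l.
Proof. by rewrite mem_filter mem_iota => /andP [_ H]; have := leq_trunc_div l 3; lia. Qed.

(** The first visits of the six vertices fall at times [3 * j + 1] to [3 * j + 3], so the time of a
    first visit determines the window. In particular different windows are disjoint. *)
Lemma wv_time j v : j \in wins -> v \in wv j -> (f v).-1 %/ 3 = j /\ v < n.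
Proof.
move=> jw; have jl := win_bound jw; move: jw; rewrite mem_filter => /andP [/and3P [D0 D1 D2] _].
have Hf : f v = 3 * j + 1 \/ f v = 3 * j + 2 \/ f v = 3 * j + 3 ->  (f v).-1 %/ 3 = j.
  by move=> H; have := divn_eq (f v).-1 3; have := ltn_pmod (f v).-1 (isT : 0 < 3); lia.
have [c1 c2 c3] : [/\ adj (C (3 * j + 1)).1 (C (3 * j + 1)).2,
  adj (C (3 * j + 2)).1 (C (3 * j + 2)).2 & adj (C (3 * j + 3)).1 (C (3 * j + 3)).2].
  by split; apply: Cadj; lia.
have [/eqP E1 /eqP E2] : f (C (3 * j + 1)).1 == 3 * j + 1 /\ f (C (3 * j + 1)).2 == 3 * j + 1.
  by rewrite addn1; apply/andP.
have [/eqP E3 /eqP E4] : f (C (3 * j + 2)).1 == 3 * j + 2 /\ f (C (3 * j + 2)).2 == 3 * j + 2.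
  by rewrite -[2]/(1 + 1) addnA [_ + 1 + 1]addn1; apply/andP.
have [/eqP E5 /eqP E6] : f (C (3 * j + 3)).1 == 3 * j + 3 /\ f (C (3 * j + 3)).2 == 3 * j + 3.
  by rewrite -[3]/(2 + 1) addnA [_ + 2 + 1]addn1; apply/andP.
rewrite !inE => /or4P [| | |/or3P []] /eqP Ev; split; try (apply: Hf; rewrite Ev; tauto);
  rewrite Ev; by [apply: adj_lt; eassumption | apply: adj_lt2; eassumption].
Qed.

Lemma uniq_levels (h : nat -> nat) m1 m2 m3 p0 p1 p2 p3 p4 p5 :
  h p0 = m1 -> h p1 = m1 -> h p2 = m2 -> h p3 = m2 -> h p4 = m3 -> h p5 = m3 ->
  m1 != m2 -> m1 != m3 -> m2 != m3 -> p0 != p1 -> p2 != p3 -> p4 != p5 ->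
  uniq [:: p0; p1; p2; p3; p4; p5].
Proof.
move=> h0 h1 h2 h3 h4 h5 n12 n13 n23 n01 n2 n45.
have ne u v a b : h u = a -> h v = b -> a != b -> (u == v) = false.
  by move=> Hu Hv Hab; apply/eqP => E; rewrite -Hu -Hv E eqxx in Hab.
rewrite /= !inE (negbTE n01) (negbTE n2) (negbTE n45).
rewrite (ne _ _ _ _ h0 h2 n12) (ne _ _ _ _ h0 h3 n12) (ne _ _ _ _ h0 h4 n13) (ne _ _ _ _ h0 h5 n13).
rewrite (ne _ _ _ _ h1 h2 n12) (ne _ _ _ _ h1 h3 n12) (ne _ _ _ _ h1 h4 n13) (ne _ _ _ _ h1 h5 n13).
by rewrite (ne _ _ _ _ h2 h4 n23) (ne _ _ _ _ h2 h5 n23) (ne _ _ _ _ h3 h4 n23) (ne _ _ _ _ h3 h5 n23).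
Qed.

Lemma win_grid j : j \in wins -> uniq (wv j) /\
  forall i k, gadj i k -> adj (nth 0 (wv j) i) (nth 0 (wv j) k).
Proof.
move=> jw; have jl := win_bound jw.
move: jw; rewrite mem_filter => /andP [/and3P [D0 D1 D2] _].
have a1 : adj (C (3 * j + 1)).1 (C (3 * j + 1)).2 by apply: Cadj; lia.
have a2 : adj (C (3 * j + 2)).1 (C (3 * j + 2)).2 by apply: Cadj; lia.
have a3 : adj (C (3 * j + 3)).1 (C (3 * j + 3)).2 by apply: Cadj; lia.
have S1 : (3 * j + 1).+1 = 3 * j + 2 by lia.
have S2 : (3 * j + 2).+1 = 3 * j + 3 by lia.
have [|b1 b2 _ _] := dbl_square _ D1; first by lia.
have [|b3 b4 _ _] := dbl_square _ D2; first by lia.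
rewrite S1 in b1 b2; rewrite S2 in b3 b4.
move: D0 D1 D2; rewrite /dbl S1 S2 -addn1 => /andP [/eqP E1 /eqP E2] /andP [/eqP E3 /eqP E4] /andP [/eqP E5 /eqP E6].
split.
  by apply: (uniq_levels E1 E2 E3 E4 E5 E6); rewrite ?eqn_add2l //; exact: adj_neq.
move=> i k; rewrite /gadj !inE => H.
repeat match goal with H : is_true (_ || _) |- _ => case/orP: H => H end;
  move/eqP: H => [-> ->] //=; by rewrite adjC.
Qed.

Definition fresh (A : pred nat) j := all (fun v => ~~ A v) (wv j).
(** A window counts as long as it is untouched or still offers a long ear inside. When the greedy
    procedure stops no window is good, so each loss must have been charged to some addition on the
    way. *)
Definition good A j := fresh A j || heff adj A (wv j).
Definition spent A := count (fun j => ~~ good A j) wins.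

Lemma good_eq (A A' : pred nat) j : {in wv j, A =1 A'} -> good A j -> good A' j.
Proof.
move=> H /orP [/allP F|/heffP [a [x1 [x2 [x3 [x4 [b [Hs E]]]]]]]]; apply/orP.
  by left; apply/allP => v Hv; rewrite -H // F.
right; apply/heffP; exists a, x1, x2, x3, x4, b; split=> //.
case/and5P: Hs => Ha H1 H2 H3 /and3P [H4 Hb _].
by move: E; rewrite /eff !H.
Qed.

Lemma good_lift (A : pred nat) j (M : seq bool) : j \in wins ->
  (forall i, i < 6 -> A (nth 0 (wv j) i) = nth false M i) ->
  heff gadj (nth false M) (iota 0 6) -> good A j.
Proof.
move=> jw HA /heffP [a [x1 [x2 [x3 [x4 [b [Hs E]]]]]]]; apply/orP; right.
have [uw gw] := win_grid jw; set p := nth 0 (wv j) in gw HA.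
have L x : x \in iota 0 6 -> x < 6 by rewrite mem_iota.
case/and5P: Hs => /L Ha /L H1 /L H2 /L H3 /and3P [/L H4 /L Hb _].
have pin i : i < 6 -> p i \in wv j by move=> Hi; apply: mem_nth.
have pne i k : i < 6 -> k < 6 -> i != k -> p i != p k by move=> Hi Hk; rewrite nth_uniq.
apply/heffP; exists (p a), (p x1), (p x2), (p x3), (p x4), (p b); split.
  by rewrite /= !pin.
case/andP: E => /andP [/and5P [Aa Ab A1 A2 A3] /and5P [A4 e1 e2 e3 e4]] /and4P [e5 n13 n41 n42].
rewrite /eff !HA // Aa Ab A1 A2 A3 A4 (gw _ _ e1) (gw _ _ e2) (gw _ _ e3) (gw _ _ e5) !pne // !andbT /=.
by case/orP: e4 => [/eqP ->|/gw ->]; rewrite ?eqxx ?orbT.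
Qed.

(** A fresh window that receives one vertex, or two non-adjacent ones, contains a long ear by
    [grid_single] and [grid_pair]. There remain two adjacent vertices, for which [grid_detour]
    applies. *)
Lemma good_pair (A A' : pred nat) j x1 x2 : j \in wins -> fresh A j ->
  (forall v, A' v = A v || (v \in [:: x1; x2])) -> x1 \in wv j ->
  good A' j \/ [/\ x2 \in wv j, adj x1 x2 & exists u v,
    [/\ u \in wv j, v \in wv j &
      [/\ adj x1 u, adj u v, adj v x2 & (u != x2) && (v != x1)]]].
Proof.
move=> jw /allP Fr HA x1w; have [uw gw] := win_grid jw.
set p := nth 0 (wv j) in gw *.
have pin i : i < 6 -> p i \in wv j by move=> Hi; apply: mem_nth.
have pE i k : i < 6 -> k < 6 -> (p i == p k) = (i == k) by move=> Hi Hk; rewrite nth_uniq.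
have [i i6 E1] : exists2 i, i < 6 & x1 = p i.
  by exists (index x1 (wv j)); rewrite ?index_mem // /p nth_index.
have [x2w|x2w] := boolP (x2 \in wv j); last first.
  left; apply: (@good_lift _ _ (grid_mask i i)) => //.
    move=> m m6; rewrite HA -/p (negbTE (Fr _ (pin _ m6))) !inE E1 pE //= grid_maskE //.
    by rewrite orbb [p m == x2](_ : _ = false) ?orbF //; apply: contraNF x2w => /eqP <-; exact: pin.
  by apply: grid_single.
have [k k6 E2] : exists2 k, k < 6 & x2 = p k.
  by exists (index x2 (wv j)); rewrite ?index_mem // /p nth_index.
have [gik|gik] := boolP (gadj i k).
  right; split=> //; first (by rewrite E1 E2 gw); have [u [v [u6 v6 [g1 g2 g3 /andP [g4 g5]]]]] := grid_detour i6 k6 gik.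
  by exists (p u), (p v); rewrite E1 E2 !pin // !gw // !pE // g4 g5.
left; apply: (@good_lift _ _ (grid_mask i k)) => //.
  by move=> m m6; rewrite HA -/p (negbTE (Fr _ (pin _ m6))) !inE E1 E2 !pE //= grid_maskE.
exact: grid_pair.
Qed.

(** A window without new vertices keeps its status, and each new vertex lies in at most one
    window. *)
Lemma spent_touch (A A' : pred nat) xs : (forall v, v \notin xs -> A' v = A v) ->
  spent A' <= spent A + size (undup xs).
Proof.
move=> H; pose touch j := has (mem (wv j)) xs.
have : spent A' <= count (predU (fun j => ~~ good A j) touch) wins.
  rewrite /spent -!size_filter; apply: uniq_leq_size; first by rewrite !filter_uniq ?iota_uniq.
  move=> j; rewrite !mem_filter => /andP [Hj ->]; rewrite andbT /=.
  have [//|Ht] := boolP (touch j); rewrite ?orbT // orbF; apply: contra Hj.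
  apply: good_eq => v Hv; rewrite H //; apply: contra Ht => vx.
  by apply/hasP; exists v.
move=> /leq_trans; apply.
have := count_predUI (fun j => ~~ good A j) touch wins.
suff : count touch wins <= size (undup xs) by rewrite /spent; lia.
rewrite -size_filter -(size_map (fun x => (f x).-1 %/ 3)); apply: uniq_leq_size.
  by rewrite !filter_uniq ?iota_uniq.
move=> j; rewrite mem_filter => /andP [/hasP [x xs_ /= xw] jw].
by apply/mapP; exists x; rewrite ?mem_undup //; case: (wv_time jw xw).
Qed.

(** As [A] admits no long ear, a good window is fresh. The detour therefore runs outside [A], which
    is what lengthens an ear through [x1] and [x2]. *)
Lemma good_two_new (A A' : pred nat) j x1 x2 : no_eff A -> j \in wins -> good A j ->
  (forall v, A' v = A v || (v \in [:: x1; x2])) ->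
  good A' j \/ [/\ x1 \in wv j, x2 \in wv j, adj x1 x2 & exists u v,
    [/\ ~~ A u, ~~ A v & [/\ adj x1 u, adj u v, adj v x2 & (u != x2) && (v != x1)]]].
Proof.
move=> nE jw gA HA.
have Fr : fresh A j.
  case/orP: gA => // /heffP [a [y1 [y2 [y3 [y4 [b [_ E]]]]]]].
  by have := nE a y1 y2 y3 y4 b; rewrite E.
have F v : v \in wv j -> ~~ A v by move=> Hv; apply: (allP Fr).
have [x1w|x1w] := boolP (x1 \in wv j).
  have [|[x2w e12 [u [v [uw vw H]]]]] := good_pair jw Fr HA x1w; first by left.
  by right; split=> //; exists u, v; split=> //; apply: F.
have [x2w|x2w] := boolP (x2 \in wv j).
  have [||[x1w' _]] := @good_pair A A' j x2 x1 jw Fr _ x2w; [|by left|by rewrite x1w' in x1w].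
  by move=> v; rewrite HA !inE [(v == x1) || _]orbC.
left; apply: good_eq gA => v Hv; rewrite HA !inE.
have [E|_] := eqVneq v x1; first by rewrite -E Hv in x1w.
have [E|_] := eqVneq v x2; first by rewrite -E Hv in x2w.
by rewrite /= orbF.
Qed.

Lemma addA2 (A : pred nat) x1 x2 x3 x4 : addA A x1 x2 x3 x4 =1 addA A x1 x2 x2 x2 ->
  forall v, addA A x1 x2 x3 x4 v = A v || (v \in [:: x1; x2]).
Proof. by move=> E v; rewrite E /addA !inE !orbb. Qed.

Lemma count_sub_in (T : eqType) (p q : pred T) s :
  {in s, forall x, p x -> q x} -> count p s <= count q s.
Proof.
move=> H; elim: s H => //= x s IH H; apply: leq_add.
  by case Ep: (p x) => //; rewrite (H x) ?inE ?eqxx.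
by apply: IH => y Hy; apply: H; rewrite inE Hy orbT.
Qed.

(** The weights balance each kind of addition. With three inner vertices [24 + 3 = 9 * 3], with four
    [30 + 4 <= 9 * 4], with two [18 + 0 = 9 * 2], and for a pendant path [24 + 1 = 9 * 2 + 7]; the
    second summand bounds the windows that are lost. *)
Lemma greedy_potential A lg c r : greedy A lg c r ->
  6 * c + spent A <= 9 * (cardA A).-1 + 7 * r.
Proof.
elim=> {A lg c r}
  [|A lg c r a x1 x2 x3 x4 b G IH E|A lg c r a x1 x2 x3 x4 b G IH nE T
   |A lg c r a x1 x2 x3 x4 b G IH nE nT R].
(* The start spoils no window: vertex 0 is treated as a pair of equal vertices added to the empty
   set, and equal vertices are not adjacent. *)
- rewrite cardA0 /= muln0 add0n; apply: (@leq_trans (spent xpred0)).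
    apply: count_sub_in => j jw; apply: contra => g0.
    have [||//|[_ _]] := @good_two_new xpred0 (fun v => v == 0) j 0 0 _ jw g0 _.
    + by move=> *.
    + by move=> v; rewrite !inE orbb.
    + by rewrite adjI.
  rewrite leqn0 -[_ == _]negbK -lt0n -has_count; apply/negP => /hasP [j jw].
  by rewrite /good /fresh all_predT.
- have [H1 H2 H3] := eff_facts E; have [_ _ _ A0] := greedy_basic G.
  have : spent (addA A x1 x2 x3 x4) <= spent A + size (undup [:: x1; x2; x3; x4]).
    by apply: spent_touch => v Hv; rewrite /addA (negbTE Hv) orbF.
  rewrite cardA_add // H2 H3.
  by case: (x4 != x3); lia.
- have [H1 H2 H3 /addA2 H4 H5] := two_facts T; have [_ _ _ A0] := greedy_basic G.
  have : spent (addA A x1 x2 x3 x4) <= spent A.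
    apply: count_sub_in => j jw; apply: contra => gj.
    have [//|[_ _ _ [u [v [Nu Nv [e1 e2 e3 /andP [n1 n2]]]]]]] := good_two_new nE jw gj H4.
    case/andP: T => /and4P [Aa Ab N1 N2] /and5P [_ _ e4 e5 e6].
    (* If this short ear spoiled a window, going round through [u] and [v] would give an ear with
       four inner vertices, which has preference. *)
    have /negP [] := nE a x1 u v x2 b.
    by rewrite /eff Aa Ab N1 N2 Nu Nv e4 e1 e2 e3 e6 orbT eq_sym n2 eq_sym H3 eq_sym n1.
  by rewrite cardA_add // H2 H5; lia.
- have [H1 H2 H3 /addA2 H4 H5] := rrs_facts R; have [_ _ _ A0] := greedy_basic G.
  have : spent (addA A x1 x2 x3 x4) <= spent A + 1.
    apply: (@leq_trans (count (predU (fun j => ~~ good A j) (pred1 ((f x1).-1 %/ 3))) wins)).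
      apply: count_sub_in => j jw /= Hj; have [gj|//] := boolP (good A j).
      (* A window can be lost only if it contains [x1], so at most one is. *)
      have [gj'|[x1w _ _ _]] := good_two_new nE jw gj H4; first by rewrite gj' in Hj.
      by have [-> _] := wv_time jw x1w; rewrite eqxx.
    apply: leq_trans (leq_addr (count (predI (fun j => ~~ good A j)
      (pred1 ((f x1).-1 %/ 3))) wins) _) _.
    by rewrite count_predUI leq_add2l count_uniq_mem ?leq_b1 // filter_uniq ?iota_uniq.
  by rewrite cardA_add // H2 -addnA H5; lia.
Qed.

Hypothesis conn : forall S : pred nat, S 0 -> (forall u v, S u -> adj u v -> S v) ->
  forall v, v < n -> S v.

(** If domination failed to propagate along an edge [u v], then a neighbour of [u] in [A] followed
    by [u] and [v] would be a pendant path. *)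
Lemma all_dominated (A : pred nat) : A 0 -> no_rrs A -> forall v, v < n -> A v || dom A v.
Proof.
move=> A0 nR; apply: conn => [|u v]; first by rewrite A0.
move=> Hu uv; apply: contraT; rewrite negb_or => /andP [Av Dv].
have Nu : ~~ A u by apply: contra Dv => Au; apply/domP; exists u.
move: Hu; rewrite (negbTE Nu) => /domP [a Aa au].
by have := nR a u v v v a; rewrite /rrs Aa Nu Av Dv !eqxx au uv.
Qed.

(** A fresh window contains two adjacent vertices outside [A]; both are dominated, and together with
    their neighbours in [A] they form an ear with two inner vertices. *)
Lemma all_spent (A : pred nat) : no_eff A -> no_two A ->
  (forall v, v < n -> A v || dom A v) -> spent A = size wins.
Proof.
move=> nE nT D; rewrite /spent; apply/eqP; rewrite -all_count; apply/allP => j jw.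
apply/negP => /orP [/allP Fr|/heffP [a [y1 [y2 [y3 [y4 [b [_ E]]]]]]]]; last first.
  by have := nE a y1 y2 y3 y4 b; rewrite E.
have [_ gw] := win_grid jw; have := gw 0 1 isT => /=.
set p := (C _).1; set q := (C _).2 => pq.
have pw : p \in wv j by rewrite inE eqxx.
have qw : q \in wv j by rewrite !inE eqxx orbT.
have [_ pn] := wv_time jw pw; have [_ qn] := wv_time jw qw.
have := D _ pn; have := D _ qn; rewrite (negbTE (Fr _ pw)) (negbTE (Fr _ qw)).
move=> /domP [b Ab bq] /domP [a Aa ap].
have := nT a p q q q b.
by rewrite /two Aa Ab (negbTE (Fr _ pw)) (negbTE (Fr _ qw)) !eqxx ap pq adjC bq.
Qed.

Theorem greedy_bound A lg c r L : greedy A lg c r -> no_eff A -> no_two A -> no_rrs A ->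
  (if cardA A == 1 then L + 2 <= n else L + 2 + cardA A <= c + n) ->
  21 * L <= 62 * l /\ (dn l = 0 -> L <= 2 * l).
Proof.
move=> G nE nT nR HL; have [A0 AN Hc Hp] := greedy_basic G.
have := greedy_potential G; rewrite (all_spent nE nT (all_dominated A0 nR)).
have := leq_trans (greedy_runs G) (runs_le A); have := wins_count; have := n_le.
have := rn_dn l; have : cardA A <= n by apply: leq_trans (count_size _ _) _; rewrite size_iota.
(* With [W] windows, [6 c + W <= 9 (#|A| - 1) + 7 q], [#|A| <= n <= 2 + 2 d + q] and
   [d <= 3 W + 2 (q + 1)] give [18 L <= 53 d + 50 q], and both quotients are below [62 / 21]. If
   [d = 0], then [c <= 2 (#|A| - 1)] gives [L <= 2 n - 4 <= 2 q]. *)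
by move: HL; case: eqP => [->|_]; lia.
Qed.
End Greedy.

(** * Multigraphs *)

Inductive rch (E : rel nat) (S : pred nat) : nat -> Prop :=
| rch0 u : S u -> rch E S u
| rchS u v : E u v -> rch E S v -> rch E S u.

Lemma rch_mono (E E' : rel nat) (S S' : pred nat) u :
  (forall u v, E u v -> E' u v) -> (forall u, S u -> rch E' S' u) ->
  rch E S u -> rch E' S' u.
Proof. by move=> HE HS; elim=> [v /HS //|v w /HE H _]; apply: rchS H. Qed.

Section Multigraph.
Variable n : nat.
Implicit Types mu : nat -> nat -> nat.

Definition deg mu v := \sum_(w < n) mu v w.
(** Twice the number of edges; the factors 2 in later bounds come from this. *)
Definition tot mu := \sum_(v < n) deg mu v.
Definition msym mu := forall u v, mu u v = mu v u.
Definition pos mu : rel nat := fun u v => 0 < mu u v.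
Definition addm mu u v k : nat -> nat -> nat := fun x y =>
  mu x y + k * (((x == u) && (y == v)) + ((x == v) && (y == u))).

Lemma sum_eq v : v < n -> \sum_(w < n) (w == v :> nat) = 1.
Proof.
move=> vn; rewrite (bigD1 (Ordinal vn)) //= eqxx big1 ?addn0 // => i Hi.
by apply/eqP; rewrite eqb0; apply: contra Hi => /eqP E; apply/eqP/val_inj.
Qed.

Lemma deg_addm mu u v k x : u < n -> v < n ->
  deg (addm mu u v k) x = deg mu x + k * ((x == u) + (x == v)).
Proof.
move=> un vn; rewrite /deg /addm big_split -big_distrr big_split /=; congr (_ + _ * (_ + _)).
  case: (x == u) => /=; last by rewrite big1.
  by rewrite (eq_bigr (fun w : 'I_n => (w == v :> nat) : nat)) ?sum_eq.
case: (x == v) => /=; last by rewrite big1.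
by rewrite (eq_bigr (fun w : 'I_n => (w == u :> nat) : nat)) ?sum_eq.
Qed.

Lemma tot_addm mu u v k : u < n -> v < n -> tot (addm mu u v k) = tot mu + 2 * k.
Proof.
move=> un vn; rewrite /tot (eq_bigr (fun x : 'I_n => deg mu x + k * ((x == u :> nat) + (x == v :> nat)))).
  by rewrite big_split -big_distrr big_split /= !sum_eq // mulnC.
by move=> x _; rewrite deg_addm.
Qed.

Lemma msym_addm mu u v k : msym mu -> msym (addm mu u v k).
Proof. by move=> H x y; rewrite /addm H addnC [in RHS]addnC ![(x == _) && _]andbC; lia. Qed.

Lemma addm_le mu u v k x y : mu x y <= addm mu u v k x y.
Proof. exact: leq_addr. Qed.

Lemma addm_edge mu u v k : 0 < k -> 0 < addm mu u v k u v.
Proof. by move=> k0; rewrite /addm !eqxx !addn_gt0 muln_gt0 k0 !addn_gt0 orbT. Qed.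

Lemma deg_gt0 mu u v : v < n -> 0 < mu u v -> 0 < deg mu u.
Proof. by move=> vn H; rewrite /deg (bigD1 (Ordinal vn)) //=; apply: ltn_addr. Qed.

Lemma deg_ex mu u : 0 < deg mu u -> exists2 v, v < n & 0 < mu u v.
Proof.
rewrite lt0n sum_nat_eq0 => /forallPn [v]; rewrite implyTb -lt0n => H.
by exists v.
Qed.

Lemma tot_ex mu : 0 < tot mu -> exists2 v, v < n & 0 < deg mu v.
Proof.
rewrite lt0n sum_nat_eq0 => /forallPn [v]; rewrite implyTb -lt0n => H.
by exists v.
Qed.

(** * Reversing the ear additions *)

(* An edge of a path is laid with a multiplicity of prescribed parity; the
   first even edge of a path is left out, the others are doubled. *)
Definition lay mu (zc e : bool) u v := addm mu u v (if e then 1 else if zc then 2 else 0).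

(** When [u] is reached, the edge leaving it is the last chance to make its degree even, so the
    parity of that edge is forced. The flag [zc] records that an even edge has already been left
    out. *)
Fixpoint layp mu zc u ys :=
  if ys is v :: ys' then
    if u == v then layp mu zc v ys'
    else let e := odd (deg mu u) in layp (lay mu zc e u v) (zc || ~~ e) v ys'
  else mu.

Definition layear mu e a ys :=
  if ys is x :: ys' then layp (lay mu false e a x) (~~ e) x ys' else mu.

Fixpoint zeros (D : nat -> bool) (e : bool) (u : nat) (ys : seq nat) :=
  if ys is v :: ys' then
    if u == v then zeros D e v ys'
    else let e' := e (+) D u in ~~ e' + zeros D e' v ys'
  else 0.

Fixpoint simp (u : nat) (ys : seq nat) :=
  if ys is v :: ys' then
    if u == v then simp v ys' else (u \notin v :: ys') && simp v ys'
  else true.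

Fixpoint plen (u : nat) (ys : seq nat) := if ys is v :: ys' then (u != v) + plen v ys' else 0.

(** Each parity is the previous one plus a fixed bit, so reversing the first reverses all: an edge
    that is even for one choice is odd for the other. *)
Lemma zeros_flip D e u ys : zeros D e u ys + zeros D (~~ e) u ys = plen u ys.
Proof.
elim: ys u e => //= v ys IH u e; case: eqP => [_|_]; first exact: IH.
by rewrite -(IH v (e (+) D u)) addNb; case: (e (+) D u) => /=; lia.
Qed.

Lemma lay_mono mu zc e u v x y : mu x y <= lay mu zc e u v x y.
Proof. exact: addm_le. Qed.

Lemma layp_mono mu zc u ys x y : mu x y <= layp mu zc u ys x y.
Proof.
elim: ys mu zc u => //= v ys IH mu zc u; case: eqP => // _.
exact: leq_trans (lay_mono _ _ _ _ _ _ _) (IH _ _ _).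
Qed.

Lemma layp_sym mu zc u ys : msym mu -> msym (layp mu zc u ys).
Proof.
elim: ys mu zc u => //= v ys IH mu zc u H; case: eqP => _; apply: IH => //.
exact: msym_addm.
Qed.

Lemma layp_deg mu zc u ys w : u < n -> all (fun y => y < n) ys -> w \notin u :: ys ->
  deg (layp mu zc u ys) w = deg mu w.
Proof.
elim: ys mu zc u => //= v ys IH mu zc u un /andP [vn yn].
rewrite !inE !negb_or => /and3P [wu wv wy]; have Hw : w \notin v :: ys by rewrite inE negb_or wv.
case: eqP => _; rewrite IH //.
by rewrite deg_addm // (negbTE wu) (negbTE wv) muln0 addn0.
Qed.

Lemma layp_even mu zc u ys w : u < n -> all (fun y => y < n) ys -> simp u ys ->
  w \in u :: ys -> w != last u ys -> ~~ odd (deg (layp mu zc u ys) w).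
Proof.
elim: ys mu zc u w => [|v ys IH] mu zc u w un /=; first by rewrite inE => _ _ ->.
move=> /andP [vn yn]; have [->|uv] := eqVneq u v.
  by move=> /= Hs; rewrite inE => /orP [/eqP ->|Hw] Hl; apply: IH => //; rewrite inE eqxx.
move=> /andP [uy Hs]; rewrite inE => /orP [/eqP ->|Hw] Hl; last exact: IH.
rewrite layp_deg // deg_addm // eqxx (negbTE uv) addn0 muln1 oddD.
by case: (odd _) => //; case: zc.
Qed.

(** An odd edge adds 2 to [tot] and a doubled one 4. The first even edge is left out and adds 0,
    which is the correction by 4, unless an even edge was left out earlier. *)
Lemma layp_tot (D : nat -> bool) mu zc e u ys : u < n -> all (fun y => y < n) ys -> simp u ys ->
  (u != last u ys -> odd (deg mu u) = e (+) D u) ->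
  (forall w, w \in ys -> w != u -> w != last u ys -> odd (deg mu w) = D w) ->
  tot (layp mu zc u ys) + 4 * (~~ zc && (0 < zeros D e u ys)) =
  tot mu + 2 * plen u ys + 2 * zeros D e u ys.
Proof.
elim: ys mu zc e u => [|v ys IH] mu zc e u un /=; first by rewrite andbF !addn0.
move=> /andP [vn yn]; have [->|uv] := eqVneq u v.
  move=> Hs Hu Hw; rewrite /= add0n; apply: IH => // w wy; apply: Hw.
  by rewrite inE wy orbT.
move=> /andP [uy Hs] Hu Hw.
have ul : u != last v ys by apply: contra uy => /eqP ->; exact: mem_last.
rewrite Hu //; set e' := e (+) D u.
have := IH (lay mu zc e' u v) (zc || ~~ e') e' v vn yn Hs.
have Dv w : w != u -> odd (deg (lay mu zc e' u v) w) = (e' && (w == v)) (+) odd (deg mu w).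
  move=> wu; rewrite deg_addm // (negbTE wu) add0n oddD oddM addbC; congr (_ (+) _).
  by case: e' => //=; [case: (w == v)|case: zc].
have P1 : v != last v ys -> odd (deg (lay mu zc e' u v) v) = e' (+) D v.
  by move=> vl; rewrite Dv 1?eq_sym // eqxx andbT Hw // ?inE ?eqxx // eq_sym.
have P2 w : w \in ys -> w != v -> w != last v ys -> odd (deg (lay mu zc e' u v) w) = D w.
  move=> wy wv wl; have wu : w != u by apply: contra uy => /eqP <-; rewrite inE wy orbT.
  by rewrite Dv // (negbTE wv) andbF Hw // inE wy orbT.
move=> /(_ P1 P2); rewrite tot_addm //.
by case: (e') => /=; case: (zc) => /=; clear; lia.
Qed.

Lemma layp_conn_last (mu0 : nat -> nat -> nat) (S : pred nat) mu u ys :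
  (forall x y, layp mu true u ys x y <= mu0 x y) ->
  rch (pos mu0) S (last u ys) -> forall w, w \in u :: ys -> rch (pos mu0) S w.
Proof.
elim: ys mu u => [|v ys IH] mu u /= Hle Hl w; first by rewrite inE => /eqP ->.
case: (eqVneq u v) Hle => [->|uv] Hle.
  by rewrite inE => /orP [/eqP ->|Hw]; apply: (IH mu v) => //; rewrite inE eqxx.
rewrite inE => /orP [/eqP ->|Hw]; last exact: (IH _ _ Hle).
apply: (@rchS _ _ _ v); last by apply: (IH _ _ Hle) => //; rewrite inE eqxx.
apply: leq_trans (Hle u v); apply: leq_trans (layp_mono _ _ _ _ _ _).
by apply: addm_edge; case: ifP.
Qed.

(** At most one edge of the path is missing. Vertices before the gap stay connected to the beginning
    of the path, those after it to its end. *)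
Lemma layp_conn (mu0 : nat -> nat -> nat) (S : pred nat) mu zc u ys : msym mu0 ->
  (forall x y, layp mu zc u ys x y <= mu0 x y) ->
  rch (pos mu0) S u -> rch (pos mu0) S (last u ys) ->
  forall w, w \in u :: ys -> rch (pos mu0) S w.
Proof.
move=> sy; elim: ys mu zc u => [|v ys IH] mu zc u /= Hle Hu Hl w.
  by rewrite inE => /eqP ->.
case: (eqVneq u v) Hle => [E|uv] Hle.
  rewrite E in Hu *; rewrite inE => /orP [/eqP -> //|Hw].
  by apply: (IH mu zc v).
rewrite inE => /orP [/eqP -> //|].
case: zc Hle => Hle; first exact: (layp_conn_last Hle).
case Eo: (odd (deg mu u)) Hle => Hle; last exact: (layp_conn_last Hle).
apply: (IH _ _ _ Hle) => //; apply: (@rchS _ _ _ u) => //.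
rewrite /pos sy; apply: leq_trans (Hle u v); apply: leq_trans (layp_mono _ _ _ _ _ _).
exact: addm_edge.
Qed.

Lemma layp_pos (P : rel nat) mu zc u ys :
  (forall x y, P x y = P y x) -> (forall x y, 0 < mu x y -> P x y) ->
  path (fun x y => (x == y) || P x y) u ys ->
  forall x y, 0 < layp mu zc u ys x y -> P x y.
Proof.
move=> sy; elim: ys mu zc u => [|v ys IH] mu zc u //= Hm /andP [Huv Hp] x y.
case: eqVneq Huv => //= uv Huv; first exact: IH.
apply: IH => // {}x {}y; rewrite /lay /addm.
case: (posnP (mu x y)) => [->|/Hm //].
case: (boolP ((x == u) && (y == v))) => [/andP [/eqP -> /eqP ->] //|_].
case: (boolP ((x == v) && (y == u))) => [/andP [/eqP -> /eqP ->]|_]; first by rewrite sy.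
by rewrite muln0.
Qed.

Variables (adj : rel nat) (Af : pred nat) (cF : nat).
Hypotheses (adjC : symmetric adj) (adjI : irreflexive adj).

Inductive okl : pred nat -> seq (seq nat) -> Prop :=
| okl0 : okl (fun v => v == 0) [::]
| oklS A l a x1 x2 x3 x4 b : okl A l -> A a -> A b -> a < n -> b < n ->
    all (fun x => ~~ A x && (x < n)) [:: x1; x2; x3; x4] -> adj a x1 ->
    path (fun x y => (x == y) || adj x y) x1 [:: x2; x3; x4; b] ->
    simp x1 [:: x2; x3; x4; b] ->
    okl (addA A x1 x2 x3 x4) ([:: a; x1; x2; x3; x4; b] :: l).

Definition lcost (l : seq (seq nat)) := sumn (map ecost l).

(* [mu] has to become even inside [A] only; the ears of [l] are not yet laid. *)
Definition RevI (A : pred nat) l mu :=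
  [/\ msym mu, forall u v, 0 < mu u v -> [&& adj u v, Af u & Af v],
      forall v, v < n -> ~~ A v -> ~~ odd (deg mu v),
      forall v, Af v -> rch (pos mu) A v & tot mu + 2 * lcost l <= 2 * cF].

(** An ear has at most five edges, [a x1] and at most four more. If an odd first edge leaves at most
    two even ones, it is chosen odd; otherwise at least three of the four are even, so the reversed
    choice has at most one even edge there besides the first. With at most two even edges, leaving
    one out pays for doubling the other. *)
Lemma RevI_step (A : pred nat) l mu a x1 x2 x3 x4 b (ys := [:: x2; x3; x4; b])
  (D := fun v => odd (deg mu v)) (e0 : bool) :
  e0 = (zeros D true x1 ys <= 2) ->
  A a -> A b -> a < n -> b < n ->
  all (fun x => ~~ A x && (x < n)) [:: x1; x2; x3; x4] -> adj a x1 ->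
  path (fun x y => (x == y) || adj x y) x1 ys -> simp x1 ys ->
  (forall v, addA A x1 x2 x3 x4 v -> Af v) ->
  RevI (addA A x1 x2 x3 x4) ([:: a; x1; x2; x3; x4; b] :: l) mu ->
  RevI A l (layear mu e0 a (x1 :: ys)).
Proof.
move=> He0 Aa Ab an bn Hx ax1 Hp Hs HAf [H1 H2 H3 H4 H5].
have /and5P [/andP [A1 x1n] /andP [A2 x2n] /andP [A3 x3n] /andP [A4 x4n] _] := Hx.
have ysn : all (fun y => y < n) ys by rewrite /= x2n x3n x4n bn.
have nax : a != x1 by apply: contra A1 => /eqP <-.
have notA w : w \in x1 :: ys -> w != b -> ~~ A w.
  by rewrite !inE => /or4P [/eqP ->|/eqP ->|/eqP ->|/orP [/eqP ->|/eqP ->]] //; rewrite eqxx.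
have inX w : (w \in [:: x1; x2; x3; x4]) = (w \in x1 :: ys) && (w != b).
  rewrite !inE; have [->|_] := eqVneq w b; last by rewrite !orbF andbT.
  rewrite andbF; apply/negbTE; rewrite !negb_or.
  by apply/and4P; split; [apply: contra A1|apply: contra A2|apply: contra A3|apply: contra A4] => /eqP <-.
rewrite /layear; set mu1 := lay mu false e0 a x1.
have mu1E : mu1 = addm mu a x1 e0 by rewrite /mu1 /lay; case: (e0).
have Dm w : w != a -> odd (deg mu1 w) = D w (+) (e0 && (w == x1)).
  by move=> wa; rewrite mu1E deg_addm // (negbTE wa) add0n oddD oddM; case: (e0); case: (w == x1).
split.
- exact/layp_sym/msym_addm.
- have Pmu1 x y : 0 < mu1 x y -> [&& adj x y, Af x & Af y].
    rewrite mu1E /addm; case: (posnP (mu x y)) => [->|/H2 //].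
    have Axa : Af a by apply: HAf; rewrite /addA Aa.
    have Axx : Af x1 by apply: HAf; rewrite /addA inE eqxx orbT.
    case: (boolP ((x == a) && (y == x1))) => [/andP [/eqP -> /eqP ->] _|_].
      by rewrite ax1 Axa Axx.
    case: (boolP ((x == x1) && (y == a))) => [/andP [/eqP -> /eqP ->] _|_]; last by rewrite muln0.
    by rewrite adjC ax1 Axa Axx.
  apply: (layp_pos _ Pmu1) => [x y|]; first by rewrite adjC [Af x && _]andbC.
  have Afx w : w \in x1 :: ys -> Af w.
    move=> Hw; apply: HAf; rewrite /addA; have [->|wb] := eqVneq w b; first by rewrite Ab.
    by rewrite inX Hw wb orbT.
  move: Hp; rewrite /= !andbT !Afx ?andbT // !inE eqxx ?orbT //.
- move=> v vn Av; have va : v != a by apply: contra Av => /eqP ->.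
  have vb : v != b by apply: contra Av => /eqP ->.
  have [Hv|Hv] := boolP (v \in x1 :: ys); first exact: layp_even.
  rewrite layp_deg // mu1E deg_addm // (negbTE va).
  have -> : (v == x1) = false by apply/negP => E; rewrite inE E in Hv.
  rewrite muln0 addn0; apply: H3 => //.
  by rewrite /addA negb_or Av inX (negbTE Hv).
- have sy := layp_sym (~~ e0) x1 ys (msym_addm a x1 (if e0 then 1 else if false then 2 else 0) H1).
  rewrite -/(lay mu false e0 a x1) -/mu1 in sy.
  move=> v /H4; apply: rch_mono => [x y Hxy|u].
    by apply: leq_trans Hxy (leq_trans _ (layp_mono _ _ _ _ _ _)); rewrite mu1E addm_le.
  case/orP => [Au|]; first exact: rch0.
  rewrite inX => /andP [Hu _].
  have Hb : rch (pos (layp mu1 (~~ e0) x1 ys)) A (last x1 ys) by exact: rch0.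
  case Ee: e0 sy Hb => sy Hb; last by apply: (@layp_conn_last _ _ mu1 x1 ys).
  apply: (@layp_conn _ _ mu1 (~~ true) x1 ys) => //.
  apply: (@rchS _ _ _ a); last exact: rch0.
  rewrite /pos sy; apply: leq_trans (layp_mono _ _ _ _ _ _).
  by rewrite mu1E Ee; apply: addm_edge.
- have := @layp_tot D mu1 (~~ e0) e0 x1 ys x1n ysn Hs.
  have P1 : x1 != last x1 ys -> odd (deg mu1 x1) = e0 (+) D x1.
    by rewrite Dm 1?eq_sym // eqxx andbT addbC.
  have P2 w : w \in ys -> w != x1 -> w != last x1 ys -> odd (deg mu1 w) = D w.
    move=> wy wx wl; rewrite Dm ?(negbTE wx) ?andbF ?addbF //.
    have : ~~ A w by apply: notA => //; rewrite inE wy orbT.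
    by apply: contra => /eqP ->.
  move=> /(_ P1 P2).
  have -> : tot mu1 = tot mu + 2 * e0 by rewrite mu1E tot_addm.
  have p4 : plen x1 ys <= 4.
    by rewrite /=; case: (x1 == x2); case: (x2 == x3); case: (x3 == x4); case: (x4 == b).
  have zf : zeros D true x1 ys + zeros D false x1 ys = plen x1 ys := zeros_flip D true x1 ys.
  have Hl : lcost ([:: a; x1; x2; x3; x4; b] :: l) = 1 + plen x1 ys + lcost l.
    by rewrite /lcost /= nax.
  move=> Ht; rewrite Hl in H5; move: (tot _) Ht => M.
  move: zf; set Z1 := zeros D true x1 ys; set Z0 := zeros D false x1 ys.
  move: He0; rewrite -/Z1; case: (leqP Z1 2) => Hz ->; rewrite -/Z1 -/Z0.
    move: (Z1) (Z0) Hz => z1 z0 Hz zf Ht; clear -Hz zf Ht p4 H5; lia.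
  move: (Z1) (Z0) Hz => z1 z0 Hz zf Ht; clear -Hz zf Ht p4 H5; lia.
Qed.

(** * Closed trails *)

Hypothesis AfN : forall v, Af v -> v < n.

Definition tourset (o : nat -> nat) lo hi : pred nat :=
  fun v => has (fun t => o t == v) (iota lo (hi - lo).+1).

Lemma toursetP o lo hi v : lo <= hi ->
  reflect (exists2 t, lo <= t <= hi & o t = v) (tourset o lo hi v).
Proof.
move=> lh; apply: (iffP hasP) => [[t]|[t Ht <-]].
  by rewrite mem_iota => Ht /eqP; exists t => //; lia.
by exists t; rewrite ?eqxx // mem_iota; lia.
Qed.

Record EI T0 mu o lo hi : Prop := {
  EI_le : lo <= hi;
  EI_sym : msym mu;
  EI_pos : forall u v, 0 < mu u v -> [&& adj u v, Af u & Af v];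
  EI_walk : forall t, lo <= t < hi -> adj (o t) (o t.+1);
  EI_Af : forall t, lo <= t <= hi -> Af (o t);
  EI_odd : forall v, v < n -> odd (deg mu v) = (v == o lo) (+) (v == o hi);
  EI_conn : forall v, Af v -> rch (pos mu) (tourset o lo hi) v;
  EI_tot : tot mu + 2 * (hi - lo) = T0 }.

Definition subm mu u v : nat -> nat -> nat := fun x y =>
  mu x y - (((x == u) && (y == v)) + ((x == v) && (y == u))).

Lemma subm_addm mu u v : msym mu -> u != v -> 0 < mu u v -> mu = addm (subm mu u v) u v 1.
Proof.
move=> sy uv H; apply: functional_extensionality => x; apply: functional_extensionality => y.
rewrite /addm /subm mul1n subnK //.
case: (boolP ((x == u) && (y == v))) => [/andP [/eqP -> /eqP ->]|_].
  by rewrite (negbTE uv) addn0.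
by case: (boolP ((x == v) && (y == u))) => [/andP [/eqP -> /eqP ->]|_]; rewrite // sy.
Qed.

Lemma EI_extend T0 mu o lo hi w : EI T0 mu o lo hi -> 0 < mu (o hi) w ->
  EI T0 (subm mu (o hi) w) (upd o hi.+1 w) lo hi.+1 /\ tot (subm mu (o hi) w) + 2 = tot mu.
Proof.
case=> le sy ps wk af od cn tt H; set u := o hi in H *; set mu' := subm mu u w.
have /and3P [uw Au Aw] := ps _ _ H.
have nuw : u != w by apply/eqP => E; rewrite E adjI in uw.
have E : mu = addm mu' u w 1 by apply: subm_addm.
have un := AfN Au; have wn := AfN Aw.
have Et : tot mu = tot mu' + 2 by rewrite E tot_addm.
have old t : t <= hi -> upd o hi.+1 w t = o t by move=> Ht; rewrite /upd ifN //; lia.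
have new : upd o hi.+1 w hi.+1 = w by rewrite /upd eqxx.
split; last by rewrite Et.
split=> //.
- by lia.
- move=> x y; rewrite /mu' /subm sy; congr (_ - _).
  by rewrite addnC ![(y == _) && _]andbC.
- by move=> x y Hm; apply: ps; apply: leq_trans Hm _; exact: leq_subr.
- move=> t Ht; rewrite old; last by lia.
  have [->|Nt] := eqVneq t hi; first by rewrite new.
  by rewrite old ?wk //; lia.
- move=> t Ht; have [->|Nt] := eqVneq t hi.+1; first by rewrite new.
  by rewrite old ?af //; lia.
- move=> v vn; have := od v vn; rewrite old // new E deg_addm // mul1n oddD -/u.
  by case: (odd _); case: (v == o lo); case: (eqVneq v u) => [->|_]; rewrite ?(negbTE nuw); case: (v == w).
- have sub v : tourset o lo hi v || (v == w) -> tourset (upd o hi.+1 w) lo hi.+1 v.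
    move=> Hv; apply/toursetP; first by lia.
    case/orP: Hv => [/toursetP|/eqP ->]; last by exists hi.+1 => //; lia.
    by case=> // t Ht <-; exists t; [lia|rewrite old //; lia].
  have Tu : tourset (upd o hi.+1 w) lo hi.+1 u.
    by apply: sub; apply/orP; left; apply/toursetP => //; exists hi => //; lia.
  (* A path to the trail may have used the edge that is removed, but both its ends now lie on the
     trail, so the path can be cut there. *)
  move=> v /cn; elim=> [x Hx|x y Hxy _ IH]; first by apply/rch0/sub; rewrite Hx.
  case: (boolP ((x == u) || (x == w))) => [/orP [/eqP ->|/eqP ->]|].
  + exact: rch0.
  + by apply/rch0/sub; rewrite eqxx orbT.
  rewrite negb_or => /andP [xu xw]; apply: rchS IH.
  by rewrite /pos /mu' /subm (negbTE xu) (negbTE xw) subn0.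
- by rewrite -tt Et; lia.
Qed.

(** The end of the trail has degree 0, an even number, and [EI_odd] makes the end of an open trail
    odd. *)
Lemma EI_closed T0 mu o lo hi : EI T0 mu o lo hi -> deg mu (o hi) = 0 -> o lo = o hi.
Proof.
move=> I H; have := EI_odd I (AfN (EI_Af I (_ : lo <= hi <= hi))).
have := EI_le I => le; rewrite le leqnn => /(_ isT).
by rewrite H eqxx addbT /= => /esym /negbFE /eqP ->.
Qed.

Lemma EI_rotate T0 mu o lo hi : EI T0 mu o lo hi -> deg mu (o hi) = 0 -> lo < hi ->
  EI T0 mu (upd o hi.+1 (o lo.+1)) lo.+1 hi.+1.
Proof.
move=> I H lh; have cl := EI_closed I H; case: I => le sy ps wk af od cn tt.
have old t : t <= hi -> upd o hi.+1 (o lo.+1) t = o t by move=> Ht; rewrite /upd ifN //; lia.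
have new : upd o hi.+1 (o lo.+1) hi.+1 = o lo.+1 by rewrite /upd eqxx.
split=> //.
- move=> t Ht; rewrite old; last by lia.
  have [->|Nt] := eqVneq t hi; first by rewrite new -cl wk //; lia.
  by rewrite old ?wk //; lia.
- move=> t Ht; have [->|Nt] := eqVneq t hi.+1; first by rewrite new af //; lia.
  by rewrite old ?af //; lia.
- by move=> v vn; rewrite od // cl addbb new old // addbb.
- move=> v /cn; apply: rch_mono => // u /toursetP [//|t Ht <-]; apply/rch0/toursetP => //.
  have [->|Nt] := eqVneq t lo; first by exists hi; [lia|rewrite old].
  by exists t; [lia|rewrite old //; lia].
Qed.

Definition fstpos mu (o : nat -> nat) lo hi :=
  find (fun t => 0 < deg mu (o t)) (iota lo (hi - lo).+1).

Lemma EI_fstpos T0 mu o lo hi : EI T0 mu o lo hi -> 0 < tot mu ->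
  has (fun t => 0 < deg mu (o t)) (iota lo (hi - lo).+1).
Proof.
move=> I /tot_ex [u un /deg_ex [v vn Huv]].
have /and3P [_ Au _] := EI_pos I Huv.
have H x : rch (pos mu) (tourset o lo hi) x -> 0 < deg mu x ->
    has (fun t => 0 < deg mu (o t)) (iota lo (hi - lo).+1).
  elim=> [y /hasP [t Ht /eqP E] Hy|y z Hyz _ IH Hy]; first by apply/hasP; exists t; rewrite ?E.
  apply: IH; have /and3P [_ Ay _] := EI_pos I Hyz.
  by apply: (deg_gt0 (AfN Ay)); rewrite (EI_sym I).
exact: H (EI_conn I Au) (deg_gt0 vn Huv).
Qed.

Definition Phi M mu o lo hi := tot mu * M.+1 + fstpos mu o lo hi.

Lemma Phi_extend M T0 mu o lo hi w : T0 <= 2 * M -> EI T0 mu o lo hi -> 0 < mu (o hi) w ->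
  Phi M (subm mu (o hi) w) (upd o hi.+1 w) lo hi.+1 < Phi M mu o lo hi.
Proof.
move=> TM I H; have [I' E] := EI_extend I H; rewrite /Phi -E.
have := EI_tot I'; have := EI_le I => le tt.
have : fstpos (subm mu (o hi) w) (upd o hi.+1 w) lo hi.+1 <= M.+1.
  by apply: leq_trans (find_size _ _) _; rewrite size_iota; lia.
by nia.
Qed.

Lemma Phi_rotate M T0 mu o lo hi : EI T0 mu o lo hi -> deg mu (o hi) = 0 ->
  0 < tot mu -> lo < hi /\ Phi M mu (upd o hi.+1 (o lo.+1)) lo.+1 hi.+1 < Phi M mu o lo hi.
Proof.
move=> I H T; have hs := EI_fstpos I T; have cl := EI_closed I H.
have le := EI_le I; have lh : lo < hi.
  rewrite ltn_neqAle le andbT; apply/eqP => E; move: hs.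
  by rewrite E subnn /= H.
have [L [E1 E2 HL]] : exists L, [/\ iota lo (hi - lo).+1 = lo :: L,
    iota lo.+1 (hi.+1 - lo.+1).+1 = rcons L hi.+1 & forall t, t \in L -> t <= hi].
  exists (iota lo.+1 (hi - lo)); split=> //.
    by rewrite subSS -[(hi - lo).+1]addn1 iotaD cats1 addSn subnKC.
  by move=> t; rewrite mem_iota => Ht; lia.
split=> //; rewrite /Phi ltn_add2l /fstpos E2 E1; rewrite E1 /= cl H /= in hs.
have E : {in L, (fun t => 0 < deg mu (upd o hi.+1 (o lo.+1) t)) =1 (fun t => 0 < deg mu (o t))}.
  by move=> t /HL Ht; rewrite /upd ifN //; lia.
by rewrite -cats1 find_cat (eq_in_has E) hs (eq_in_find E) /= cl H /=.
Qed.

Lemma EI_done T0 mu o lo hi : EI T0 mu o lo hi -> tot mu = 0 ->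
  o lo = o hi /\ forall v, Af v -> tourset o lo hi v.
Proof.
move=> I T; have Z u v : v < n -> u < n -> mu u v = 0.
  move=> vn un; apply/eqP; rewrite -leqn0 leqNgt; apply/negP => H.
  have : 0 < tot mu by rewrite /tot (bigD1 (Ordinal un)) //= ltn_addr ?(deg_gt0 vn).
  by rewrite T.
have D v : v < n -> deg mu v = 0 by move=> vn; rewrite /deg big1 // => w _; apply: Z.
have le := EI_le I; split.
  by apply: (EI_closed I); apply/D/AfN/(EI_Af I); rewrite le leqnn.
move=> v /(EI_conn I); elim=> // x y Hxy _ _.
have /and3P [_ Ax Ay] := EI_pos I Hxy.
by move: Hxy; rewrite /pos Z // AfN.
Qed.
End Multigraph.

(** * Reasoning about loop programs *)

Fixpoint mv c x : bool :=
  match c with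
  | Asg y _ => x == y
  | Seq a b | If _ a b => mv a x || mv b x
  | Rep a => mv a x
  | _ => false
  end.

Fixpoint ma c q : bool :=
  match c with
  | S1 q' _ _ | S2 q' _ _ _ => q == q'
  | Seq a b | If _ a b => ma a q || ma b q
  | Rep a => ma a q
  | _ => false
  end.

Lemma mv_frame n c s x : ~~ mv c x -> sv (exec n c s) x = sv s x.
Proof.
elim: c s => [y e|q i e|q i j e||a IHa b IHb|e a IHa b IHb|a IHa] s //=.
- by rewrite /upd => /negbTE ->.
- by rewrite negb_or => /andP [Ha Hb]; rewrite IHb ?IHa.
- by rewrite negb_or => /andP [Ha Hb]; case: ifP => _; rewrite ?IHb ?IHa.
- by move=> Ha; elim: {1}n => //= k IH; rewrite IHa.
Qed.

Lemma ma_frame n c s q : ~~ ma c q -> sa (exec n c s) q = sa s q.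
Proof.
elim: c s => [y e|q' i e|q' i j e||a IHa b IHb|e a IHa b IHb|a IHa] s //=.
- by move=> /negbTE ->.
- by move=> /negbTE ->.
- by rewrite negb_or => /andP [Ha Hb]; rewrite IHb ?IHa.
- by rewrite negb_or => /andP [Ha Hb]; case: ifP => _; rewrite ?IHb ?IHa.
- by move=> Ha; elim: {1}n => //= k IH; rewrite IHa.
Qed.

Definition eAnd a b := Ite a b Z0.
Definition eNot a := Ite a Z0 (Suc Z0).
Definition eOr a b := Ite a (Suc Z0) b.
Definition eEq a b := Ite (Sb a b) Z0 (Ite (Sb b a) Z0 (Suc Z0)).

Definition ev n s e := eval n s e != 0.

Lemma exec_If n e a b s : exec n (If e a b) s = if ev n s e then exec n a s else exec n b s.
Proof. by []. Qed.

Lemma exec_Seq n a b s : exec n (Seq a b) s = exec n b (exec n a s).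
Proof. by []. Qed.

Lemma ev_And n s a b : ev n s (eAnd a b) = ev n s a && ev n s b.
Proof. by rewrite /ev /=; case: (eval n s a). Qed.
Lemma ev_Not n s a : ev n s (eNot a) = ~~ ev n s a.
Proof. by rewrite /ev /=; case: (eval n s a). Qed.
Lemma ev_Or n s a b : ev n s (eOr a b) = ev n s a || ev n s b.
Proof. by rewrite /ev /=; case: (eval n s a). Qed.
Lemma ev_Eq n s a b : ev n s (eEq a b) = (eval n s a == eval n s b).
Proof.
rewrite /ev /eEq /= -!lt0n !subn_gt0.
by case: (ltngtP (eval n s a) (eval n s b)).
Qed.

Definition For x c := Seq (Asg x Z0) (Rep (Seq c (Asg x (Suc (V x))))).

Lemma For_inv n (I : nat -> st -> Prop) x c s : ~~ mv c x ->
  I 0 (setv s x 0) ->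
  (forall k s', k < n -> sv s' x = k -> I k s' -> I k.+1 (setv (exec n c s') x k.+1)) ->
  I n (exec n (For x c) s).
Proof.
move=> kx H0 Hs; rewrite /For.
change (I n (iter n (exec n (Seq c (Asg x (Suc (V x))))) (setv s x 0))).
suff [] : (fun k s' => I k s' /\ sv s' x = k) n
  (iter n (exec n (Seq c (Asg x (Suc (V x))))) (setv s x 0)) by [].
apply: (iter_inv (I := fun k s' => I k s' /\ sv s' x = k)).
  by split=> //=; rewrite /upd eqxx.
move=> k s' kn [HI Ex] /=; rewrite mv_frame // Ex; split; last by rewrite /upd eqxx.
exact: Hs.
Qed.

Lemma For_pres n (I : st -> Prop) x c s : ~~ mv c x ->
  (forall s v, I s -> I (setv s x v)) ->
  (forall s, I s -> sv s x < n -> I (exec n c s)) -> I s -> I (exec n (For x c) s).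
Proof.
move=> kx Hx Hc H; apply: (@For_inv n (fun _ => I)) => // [|k s' kn E HI].
  exact: Hx.
by apply/Hx/Hc; rewrite ?E.
Qed.

(** For exhaustive search: [P] gets established in round [t], the only round that has to be
    inspected, and no later round destroys it. *)
Lemma For_hit n (I P : st -> Prop) x c s t : ~~ mv c x -> t < n ->
  (forall s v, I s -> I (setv s x v)) ->
  (forall s, I s -> sv s x < n -> I (exec n c s)) ->
  (forall s v, P s -> P (setv s x v)) ->
  (forall s, I s -> P s -> sv s x < n -> P (exec n c s)) ->
  (forall s, I s -> sv s x = t -> P (exec n c s)) -> I s -> P (exec n (For x c) s).
Proof.
move=> kx tn Ix Ic Px Pc Ht HI.
suff : (fun k s' => I s' /\ (t < k -> P s')) n (exec n (For x c) s) by case=> _; apply.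
apply: (@For_inv n (fun k s' => I s' /\ (t < k -> P s'))) => //; first by split=> //; exact: Ix.
move=> k s' kn E [HI' HP]; split; first by apply/Ix/Ic; rewrite ?E.
rewrite ltnS leq_eqVlt => /orP [/eqP Et|/HP Hp]; apply: Px.
  by apply: Ht; rewrite ?E.
by apply: Pc; rewrite ?E.
Qed.

Fixpoint nest xs c := if xs is x :: xs' then For x (nest xs' c) else c.

Lemma mv_nest xs c x : mv (nest xs c) x = (x \in xs) || mv c x.
Proof.
elim: xs => //= y xs IH; rewrite /For /= IH inE.
by case: (x == y); case: (x \in xs); case: (mv c x).
Qed.

Lemma nest_pres n (I : st -> Prop) xs c s : uniq xs -> all (fun x => ~~ mv c x) xs ->
  {in xs, forall x s v, I s -> I (setv s x v)} ->
  (forall s, I s -> all (fun x => sv s x < n) xs -> I (exec n c s)) ->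
  I s -> I (exec n (nest xs c) s).
Proof.
elim: xs I s => [|x xs IH] I s /=; first by move=> _ _ _ H HI; apply: H.
move=> /andP [xn ux] /andP [kx kxs] Hx Hc HI.
apply: For_pres HI; rewrite ?mv_nest ?negb_or ?xn //.
  by move=> s' v; apply: Hx; rewrite inE eqxx.
move=> s' HI Hn.
suff [] : (fun s => I s /\ sv s x < n) (exec n (nest xs c) s') by [].
apply: (IH (fun s => I s /\ sv s x < n)) => //.
  move=> y yx s2 v [H1 H2]; split; first by apply: Hx => //; rewrite inE yx orbT.
  by rewrite /= /upd ifN //; apply: contra xn => /eqP ->.
move=> s2 [H1 H2] H3; split; last by rewrite mv_frame.
by apply: Hc => //; rewrite H2.
Qed.

Lemma nest_hit n (I P : st -> Prop) xs ts c s : uniq xs -> all (fun x => ~~ mv c x) xs ->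
  {in xs, forall x s v, I s -> I (setv s x v)} ->
  (forall s, I s -> all (fun x => sv s x < n) xs -> I (exec n c s)) ->
  {in xs, forall x s v, P s -> P (setv s x v)} ->
  (forall s, I s -> P s -> all (fun x => sv s x < n) xs -> P (exec n c s)) ->
  (forall s, I s -> map (sv s) xs = ts -> P (exec n c s)) ->
  size ts = size xs -> all (fun t => t < n) ts -> I s -> P (exec n (nest xs c) s).
Proof.
elim: xs ts I P s => [|x xs IH] [|t ts] I P s //=; first by move=> _ _ _ _ _ _ H _ _ HI; apply: H.
move=> /andP [xn ux] /andP [kx kxs] Ix Ic Px Pc Ht [sz] /andP [tn tsn] HI.
have yx y : y \in xs -> y == x = false by move=> H; apply: contraNF xn => /eqP <-.
have kN : ~~ mv (nest xs c) x by rewrite mv_nest negb_or xn.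
have Ix' : {in xs, forall y s v, (I s /\ sv s x < n) -> I (setv s y v) /\ sv (setv s y v) x < n}.
  move=> y yxs s2 v [H1 H2]; split; first by apply: Ix => //; rewrite inE yxs orbT.
  by rewrite /= /upd eq_sym yx.
have Ic' s2 : I s2 /\ sv s2 x < n -> all (fun x => sv s2 x < n) xs ->
    I (exec n c s2) /\ sv (exec n c s2) x < n.
  by move=> [H1 H2] H3; split; [apply: Ic; rewrite ?H2|rewrite mv_frame].
apply: (@For_hit n I P x _ s t) => //.
- by move=> s' v; apply: Ix; rewrite inE eqxx.
- move=> s' H1 H2.
  by have [] := nest_pres ux kxs Ix' Ic' (conj H1 H2).
- by move=> s' v; apply: Px; rewrite inE eqxx.
- move=> s' H1 H2 H3.
  suff [] : (fun s => (I s /\ sv s x < n) /\ P s) (exec n (nest xs c) s') by [].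
  apply: (@nest_pres n (fun s => (I s /\ sv s x < n) /\ P s)) => //.
    move=> y yxs s2 v [K1 K2]; split; first exact: Ix'.
    by apply: Px => //; rewrite inE yxs orbT.
  move=> s2 [[K1 K2] K3] K4; split; first by apply: Ic'.
  by apply: Pc => //; rewrite K2.
- move=> s' H1 H2; apply: (IH ts (fun s => I s /\ sv s x = t)) => //.
  + move=> y yxs s2 v [K1 K2]; split; first by apply: Ix => //; rewrite inE yxs orbT.
    by rewrite /= /upd eq_sym yx.
  + by move=> s2 [K1 K2] K3; split; [apply: Ic; rewrite ?K2 ?tn|rewrite mv_frame].
  + by move=> y yxs; apply: Px; rewrite inE yxs orbT.
  + by move=> s2 [K1 K2] K3 K4; apply: Pc; rewrite ?K2 ?tn.
  + by move=> s2 [K1 K2] K3; apply: Ht => //; rewrite K2 K3.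
Qed.

(** * The greedy program *)

Definition qE := 0. Definition qA := 1. Definition qL := 2. Definition qM := 3.
Definition qD := 4. Definition qO := 5. Definition qR := 6. Definition qW := 7.

Definition eA e := A2 qA Z0 e.
(* Array [qE] is shifted by eOne because the edge bits start in register 1. *)
Definition eAdj e1 e2 := A2 qE e1 (Suc e2).
Definition eOne := Suc Z0.

Definition six := [:: 0; 1; 2; 3; 4; 5].
Definition record_found : com :=
  Seq (Asg 6 eOne) (Seq (Asg 7 (V 0)) (Seq (Asg 8 (V 1)) (Seq (Asg 9 (V 2))
  (Seq (Asg 10 (V 3)) (Seq (Asg 11 (V 4)) (Asg 12 (V 5))))))).
(** All [n ^ 6] tuples are tried and the last success is kept. Variable 6 is the success flag; the
    arrays stay unchanged, so a recorded tuple remains valid. *)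
Definition search c := Seq (Asg 6 Z0) (nest six (If c record_found Nop)).

Section Search.
Variables (n : nat) (c : expr) (s0 : st) (test : nat -> nat -> nat -> nat -> nat -> nat -> bool).
Hypothesis Htest : forall s, sa s = sa s0 -> all (fun x => sv s x < n) six ->
  ev n s c = test (sv s 0) (sv s 1) (sv s 2) (sv s 3) (sv s 4) (sv s 5).

Lemma search_sa : sa (exec n (search c) s0) = sa s0.
Proof. by apply: functional_extensionality => q; rewrite ma_frame. Qed.

Lemma search_sv y : 12 < y -> sv (exec n (search c) s0) y = sv s0 y.
Proof. by do 13 (case: y => [//|y]); move=> _; rewrite mv_frame. Qed.

Lemma six_ne x y : x \in six -> 5 < y -> (y == x) = false.
Proof. by rewrite !inE => H Hy; apply/eqP => E; move: H Hy; rewrite -E; lia. Qed.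

Lemma search_sound : let s := exec n (search c) s0 in sv s 6 = 0 \/
  test (sv s 7) (sv s 8) (sv s 9) (sv s 10) (sv s 11) (sv s 12).
Proof.
pose J s := sa s = sa s0 /\ (sv s 6 = 0 \/
  test (sv s 7) (sv s 8) (sv s 9) (sv s 10) (sv s 11) (sv s 12)).
suff [] : J (exec n (search c) s0) by [].
change (J (exec n (nest six (If c record_found Nop)) (setv s0 6 0))).
apply: (@nest_pres n J) => //.
- move=> x Hx s v [H1 H2]; split=> //.
  by rewrite /= /upd !(six_ne Hx).
- move=> s [H1 H2] Hn; rewrite /= -/(ev n s c) (Htest H1 Hn).
  by case: ifP => // Ht; split=> //; right.
- by split=> //; left.
Qed.

Lemma search_complete a x1 x2 x3 x4 b : all (fun x => x < n) [:: a; x1; x2; x3; x4; b] ->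
  test a x1 x2 x3 x4 b -> sv (exec n (search c) s0) 6 != 0.
Proof.
move=> Hn Ht.
change (exec n (search c) s0) with (exec n (nest six (If c record_found Nop)) (setv s0 6 0)).
apply: (@nest_hit n (fun s => sa s = sa s0) (fun s => sv s 6 != 0) _ [:: a; x1; x2; x3; x4; b]) => //.
- by move=> s H _; rewrite /=; case: ifP.
- by move=> x Hx s v; rewrite /= /upd (six_ne Hx).
- by move=> s H1 H2 _; rewrite /=; case: ifP.
- move=> s H [E0 E1 E2 E3 E4 E5].
  rewrite /= -/(ev n s c) Htest //; last by rewrite /= E0 E1 E2 E3 E4 E5; apply: Hn.
  by rewrite E0 E1 E2 E3 E4 E5 Ht.
Qed.
End Search.

Definition cell n s q k := sa s q (idx2 n 0 k).

Lemma idx2_eq n i j i' j' : j < n -> j' < n ->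
  (idx2 n i j == idx2 n i' j') = (i == i') && (j == j').
Proof.
move=> jn j'n; apply/eqP/andP => [E|[/eqP -> /eqP -> //]].
have n0 : 0 < n by lia.
have := congr1 (fun x => x %/ n) E; have := congr1 (fun x => x %% n) E.
rewrite /idx2 /= !modnMDl !modn_small // !divnMDl // !divn_small // => -> /eqP.
by rewrite !addn0 eqn_add2r => ->.
Qed.

Lemma idx2_eq0 n k k' : (idx2 n 0 k == idx2 n 0 k') = (k == k').
Proof. by rewrite /idx2 eqn_add2l. Qed.

Lemma cell_set n s q k v q' k' :
  cell n (seta s q (idx2 n 0 k) v) q' k' = if (q' == q) && (k' == k) then v else cell n s q' k'.
Proof. by rewrite /cell /= idx2_eq0. Qed.

Definition push ys := cseq [seq Seq (S2 qL Z0 (V 13) (V y)) (Asg 13 (Suc (V 13))) | y <- ys].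

Lemma push_sv ys n s y : y != 13 -> sv (exec n (push ys) s) y = sv s y.
Proof.
by move=> Hy; rewrite mv_frame //; elim: ys => //= x ys IH; rewrite negb_or Hy.
Qed.

Lemma push_spec ys n s : 13 \notin ys -> let s' := exec n (push ys) s in
  [/\ sv s' 13 = sv s 13 + size ys,
      forall q k, (q != qL) || (k < sv s 13) -> cell n s' q k = cell n s q k &
      forall j, j < size ys -> cell n s' qL (sv s 13 + j) = sv s (nth 0 ys j)].
Proof.
elim: ys s => [|y ys IH] s; first by rewrite addn0.
rewrite inE negb_or => /andP [Hy Hys] /=.
set s1 := setv _ _ _; have [H1 H2 H3] := IH s1 Hys.
have E13 : sv s1 13 = (sv s 13).+1 by [].
rewrite E13 in H1 H2 H3; split.
- by rewrite H1 addSnnS.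
- move=> q k Hqk; rewrite H2; last by case/orP: Hqk => [->//|Hk]; rewrite orbC ltnW.
  rewrite /s1 /cell /= idx2_eq0; case: ifP => // /andP [/eqP Eq /eqP Ek].
  by move: Hqk; rewrite Eq Ek eqxx ltnn.
- case=> [_|j Hj].
    rewrite addn0 H2; last by rewrite leqnn orbT.
    by rewrite /s1 /cell /= idx2_eq0 !eqxx.
  rewrite addnS -addSn H3 //= /upd.
  have Hn : nth 0 ys j \in ys by apply: mem_nth.
  by case: eqP => // E; rewrite E (negbTE Hys) in Hn.
Qed.

(** The log is written in chronological order, while [l] has the latest ear first. It is thus a
    stack with pointer 13, which the reverse pass pops. *)
Definition LogRep n s (l : seq (seq nat)) := sv s 13 = 6 * size l /\
  forall i j, i < size l -> j < 6 -> cell n s qL (6 * i + j) = nth 0 (nth [::] (rev l) i) j.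

Lemma push_log ys n s l : size ys = 6 -> 13 \notin ys -> LogRep n s l ->
  LogRep n (exec n (push ys) s) ([seq sv s y | y <- ys] :: l).
Proof.
move=> sy y13 [H1 H2]; have [P1 P2 P3] := push_spec n s y13; split.
  by rewrite P1 H1 sy /= mulnS addnC.
move=> i j; rewrite /= ltnS rev_cons nth_rcons size_rev leq_eqVlt => /orP [/eqP ->|Hi] Hj.
  rewrite ltnn eqxx -H1 P3 ?sy // (nth_map 0) ?sy //.
by rewrite Hi P2 ?H2 // H1; lia.
Qed.

Definition setA := cseq [seq S2 qA Z0 (V y) eOne | y <- [:: 8; 9; 10; 11]].
Definition addEar := Seq setA (push [:: 7; 8; 9; 10; 11; 12]).
Definition addTwo := Seq setA (Seq (push [:: 7; 8; 8; 8; 8; 7]) (push [:: 8; 9; 9; 9; 9; 8])).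

Definition domc := nest [:: 14; 15]
  (If (eAnd (eA (V 15)) (eAdj (V 15) (V 14))) (S2 qW Z0 (V 14) eOne) Nop).

Definition eEff : expr :=
  let: (a, x1, x2, x3, x4, b) := (V 0, V 1, V 2, V 3, V 4, V 5) in
  eAnd (eAnd
    (eAnd (eA a) (eAnd (eA b) (eAnd (eNot (eA x1)) (eAnd (eNot (eA x2)) (eNot (eA x3))))))
    (eAnd (eNot (eA x4)) (eAnd (eAdj a x1) (eAnd (eAdj x1 x2) (eAnd (eAdj x2 x3)
       (eOr (eEq x4 x3) (eAdj x3 x4)))))))
    (eAnd (eAdj x4 b) (eAnd (eNot (eEq x1 x3)) (eAnd (eNot (eEq x4 x1)) (eNot (eEq x4 x2))))).

Definition eTwo : expr :=
  let: (a, x1, x2, x3, x4, b) := (V 0, V 1, V 2, V 3, V 4, V 5) in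
  eAnd (eAnd (eA a) (eAnd (eA b) (eAnd (eNot (eA x1)) (eNot (eA x2)))))
    (eAnd (eEq x3 x2) (eAnd (eEq x4 x2) (eAnd (eAdj a x1) (eAnd (eAdj x1 x2) (eAdj x2 b))))).

Definition eRrs : expr :=
  let: (a, x1, x2, x3, x4, b) := (V 0, V 1, V 2, V 3, V 4, V 5) in
  eAnd (eAnd (eA a) (eAnd (eNot (eA x1)) (eAnd (eNot (eA x2)) (eNot (A2 qW Z0 x2)))))
    (eAnd (eEq x3 x2) (eAnd (eEq x4 x2) (eAnd (eEq b a) (eAnd (eAdj a x1) (eAdj x1 x2))))).

Definition rrs_step := Seq (search eRrs) (If (V 6) addTwo Nop).
Definition two_step := Seq (search eTwo) (If (V 6) addEar rrs_step).
Definition greedy_step := Seq domc (Seq (search eEff) (If (V 6) addEar two_step)).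

Definition greedyc :=
  Seq (Asg 13 Z0) (Seq (S2 qA Z0 Z0 eOne) (Rep greedy_step)).

Section GreedySpec.
Variables (n : nat) (adj : rel nat) (E0 : nat -> nat).
Hypotheses (n0 : 0 < n) (adjC : symmetric adj) (adjI : irreflexive adj).
Hypothesis adj_lt : forall u v, adj u v -> u < n.
Hypothesis HE : forall u v, u < n -> v < n -> (E0 (idx2 n u v.+1) != 0) = adj u v.

(** The marks in [qW] are never erased. This is sound because domination only grows with [A];
    between two runs of [domc] the marks may be incomplete, hence the implication in place of an
    equality. *)
Definition GS s (A : pred nat) l :=
  [/\ sa s qE = E0, forall v, v < n -> (cell n s qA v != 0) = A v,
      LogRep n s l & forall v, v < n -> cell n s qW v != 0 -> dom n adj A v].

Lemma ev_adj s x y : sa s qE = E0 -> sv s x < n -> sv s y < n ->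
  ev n s (eAdj (V x) (V y)) = adj (sv s x) (sv s y).
Proof. by move=> H Hx Hy; rewrite -HE // -H. Qed.

Lemma ev_A s x (A : pred nat) : (forall v, v < n -> (cell n s qA v != 0) = A v) ->
  sv s x < n -> ev n s (eA (V x)) = A (sv s x).
Proof. by move=> H Hx; rewrite -H. Qed.

Lemma domc_spec s A l : GS s A l -> let s' := exec n domc s in
  GS s' A l /\ forall v, v < n -> (cell n s' qW v != 0) = dom n adj A v.
Proof.
move=> [H1 H2 [H3 H3'] H4] s'.
have F q : q != qW -> sa s' q = sa s q by move=> /negbTE Hq; rewrite ma_frame //= Hq.
have HW : forall v, v < n -> cell n s' qW v != 0 -> dom n adj A v.
  pose J s := [/\ sa s qE = E0, forall v, v < n -> (cell n s qA v != 0) = A v &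
     forall v, v < n -> cell n s qW v != 0 -> dom n adj A v].
  suff [] : J s' by [].
  rewrite /s'; apply: (@nest_pres n J) => //.
  move=> s2 [K1 K2 K3] /and3P [N1 N2 _]; rewrite exec_If ev_And.
  rewrite ev_adj // (ev_A K2) //; case: ifP => // /andP [Aw aw]; split=> //.
  move=> v vn; rewrite cell_set eqxx /=; case: (eqVneq v (sv s2 14)) => [-> _|_]; last exact: K3.
  by apply/domP => //; exists (sv s2 15).
split; first split=> //; rewrite ?F //.
- by move=> v vn; rewrite -H2 // /cell F.
- by split; first (by rewrite mv_frame); move=> i j Hi Hj; rewrite -H3' // /cell F.
move=> v vn; apply/idP/idP => [|/domP]; first exact: HW.
move=> /(_ adj_lt) [w Aw wv]; have wn := adj_lt wv.
apply: (@nest_hit n (fun s => sa s qE = E0 /\ forall v, v < n -> (cell n s qA v != 0) = A v)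
  (fun s => cell n s qW v != 0) _ [:: v; w]) => //; rewrite /= ?vn ?wn //.
- by move=> s2 H _; case: ifP.
- by move=> s2 _ H _; case: ifP => // _; rewrite cell_set eqxx /=; case: (v == _).
- move=> s2 [K1 K2] [E1 E2].
  rewrite -[X in cell n X]/(exec n (If (eAnd (eA (V 15)) (eAdj (V 15) (V 14))) (S2 qW Z0 (V 14) eOne) Nop) s2).
  rewrite exec_If ev_And.
  by rewrite ev_adj ?(ev_A K2) ?E1 ?E2 // Aw wv cell_set /= E1 !eqxx.
Qed.

Lemma setA_spec s (A : pred nat) : (forall v, v < n -> (cell n s qA v != 0) = A v) ->
  let s' := exec n setA s in
  (forall v, v < n -> (cell n s' qA v != 0) = addA A (sv s 8) (sv s 9) (sv s 10) (sv s 11) v).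
Proof.
move=> H s' v vn; rewrite /s' /setA /= !idx2_eq0 -/(cell n s qA v) /addA !inE.
by case: (v == sv s 11); case: (v == sv s 10); case: (v == sv s 9); case: (v == sv s 8);
  rewrite ?orbT ?orbF ?H.
Qed.

Lemma setA_frame s : let s' := exec n setA s in
  [/\ forall q, q != qA -> sa s' q = sa s q & sv s' = sv s].
Proof. by split=> // q Hq; rewrite ma_frame //= !negb_or Hq. Qed.

Lemma GS_add s A l ys : GS s A l -> size ys = 6 -> 13 \notin ys ->
  (forall v, dom n adj A v -> dom n adj (addA A (sv s 8) (sv s 9) (sv s 10) (sv s 11)) v) ->
  GS (exec n (Seq setA (push ys)) s) (addA A (sv s 8) (sv s 9) (sv s 10) (sv s 11))
     ([seq sv s y | y <- ys] :: l).
Proof.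
move=> [H1 H2 H3 H4] sy y13 Hd; rewrite exec_Seq.
have HA := setA_spec H2; have [F1 F2] := setA_frame s; set s1 := exec n setA s in HA F1 F2 *.
have [P1 P2 _] := push_spec n s1 y13.
have Fp q : q != qL -> sa (exec n (push ys) s1) q = sa s1 q.
  move=> /negbTE Hq; rewrite ma_frame //; elim: ys {sy y13 P1 P2} => //= y ys IH.
  by rewrite Hq.
have L1 : LogRep n s1 l.
  by case: H3 => K1 K2; split; rewrite ?F2 // => i j Hi Hj; rewrite -K2 // /cell F1.
split.
- by rewrite Fp // F1.
- by move=> v vn; rewrite -HA // /cell Fp.
- by have := push_log sy y13 L1; rewrite F2.
- by move=> v vn Hv; apply/Hd/H4 => //; move: Hv; rewrite /cell Fp // F1.
Qed.

Lemma dom_addA A x1 x2 x3 x4 v : dom n adj A v -> dom n adj (addA A x1 x2 x3 x4) v.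
Proof.
by move=> /(domP adj_lt) [w Aw wv]; apply/(domP adj_lt); exists w; rewrite // /addA Aw.
Qed.

Lemma push_GS s A l ys : GS s A l -> size ys = 6 -> 13 \notin ys ->
  GS (exec n (push ys) s) A ([seq sv s y | y <- ys] :: l).
Proof.
move=> [H1 H2 H3 H4] sy y13.
have Fp q : q != qL -> sa (exec n (push ys) s) q = sa s q.
  move=> /negbTE Hq; rewrite ma_frame //; elim: ys {sy y13} => //= y ys IH.
  by rewrite Hq.
split.
- by rewrite Fp.
- by move=> v vn; rewrite -H2 // /cell Fp.
- exact: push_log.
- by move=> v vn Hv; apply: H4 => //; move: Hv; rewrite /cell Fp.
Qed.

Lemma test_spec c s A l (test : nat -> nat -> nat -> nat -> nat -> nat -> bool) : GS s A l ->
  (forall a x1 x2 x3 x4 b, test a x1 x2 x3 x4 b -> all (fun x => x < n) [:: a; x1; x2; x3; x4; b]) ->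
  (forall s', sa s' = sa s -> all (fun x => sv s' x < n) six ->
   ev n s' c = test (sv s' 0) (sv s' 1) (sv s' 2) (sv s' 3) (sv s' 4) (sv s' 5)) ->
  let s' := exec n (search c) s in
  GS s' A l /\ (if ev n s' (V 6) then is_true (test (sv s' 7) (sv s' 8) (sv s' 9) (sv s' 10) (sv s' 11) (sv s' 12))
    else forall a x1 x2 x3 x4 b, ~~ test a x1 x2 x3 x4 b).
Proof.
move=> [H1 H2 [H3 H3'] H4] Hb Ht s'.
have E : sa s' = sa s by exact: search_sa.
have Ev y : 12 < y -> sv s' y = sv s y by exact: search_sv.
have S1 : sv s' 6 = 0 \/ test (sv s' 7) (sv s' 8) (sv s' 9) (sv s' 10) (sv s' 11) (sv s' 12).
  exact: search_sound.
have S2 a x1 x2 x3 x4 b : test a x1 x2 x3 x4 b -> sv s' 6 != 0.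
  by move=> H; exact: (search_complete Ht (Hb _ _ _ _ _ _ H) H).
clearbody s'; split.
  split; rewrite ?E //.
  - by move=> v vn; rewrite -H2 // /cell E.
  - by split; rewrite ?Ev // => i j Hi Hj; rewrite -H3' // /cell E.
  - by move=> v vn; rewrite /cell E; exact: H4.
rewrite {1}/ev /=; case: eqP => E6 /=; last by case: S1.
by move=> a x1 x2 x3 x4 b; apply/negP => /S2; rewrite E6.
Qed.

Lemma ev_eEff s (A : pred nat) : sa s qE = E0 ->
  (forall v, v < n -> (cell n s qA v != 0) = A v) -> all (fun x => sv s x < n) six ->
  ev n s eEff = eff adj A (sv s 0) (sv s 1) (sv s 2) (sv s 3) (sv s 4) (sv s 5).
Proof.
move=> KE KA /and5P [? ? ? ? /and3P [? ? _]].
by rewrite /eEff !ev_And !ev_Not !ev_Or !ev_Eq !(ev_A KA) // !ev_adj.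
Qed.

Lemma ev_eTwo s (A : pred nat) : sa s qE = E0 ->
  (forall v, v < n -> (cell n s qA v != 0) = A v) -> all (fun x => sv s x < n) six ->
  ev n s eTwo = two adj A (sv s 0) (sv s 1) (sv s 2) (sv s 3) (sv s 4) (sv s 5).
Proof.
move=> KE KA /and5P [? ? ? ? /and3P [? ? _]].
by rewrite /eTwo !ev_And !ev_Not !ev_Eq !(ev_A KA) // !ev_adj.
Qed.

Lemma ev_eRrs s (A : pred nat) : sa s qE = E0 ->
  (forall v, v < n -> (cell n s qA v != 0) = A v) ->
  (forall v, v < n -> (cell n s qW v != 0) = dom n adj A v) -> all (fun x => sv s x < n) six ->
  ev n s eRrs = rrs n adj A (sv s 0) (sv s 1) (sv s 2) (sv s 3) (sv s 4) (sv s 5).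
Proof.
move=> KE KA KW /and5P [? ? ? ? /and3P [? ? _]].
have E : ev n s (A2 qW Z0 (V 2)) = dom n adj A (sv s 2) by rewrite -KW.
by rewrite /eRrs !ev_And !ev_Not !ev_Eq !(ev_A KA) // !ev_adj // E.
Qed.

Lemma cell_sa s s' q : sa s' = sa s -> cell n s' q = cell n s q.
Proof. by rewrite /cell => ->. Qed.

(** The negation in the first case says that a finished state is never changed again; so after [n]
    rounds either the procedure has finished or [A] would have more than [n] vertices. *)
Definition progress A s' := exists A' l' c' r', [/\ greedy n adj A' l' c' r', GS s' A' l' &
  ((cardA n A).+2 <= cardA n A' /\ ~ [/\ no_eff adj A, no_two adj A & no_rrs n adj A]) \/
  [/\ A' = A, no_eff adj A, no_two adj A & no_rrs n adj A]].

Lemma all_lt6 (A : pred nat) x1 x2 x3 x4 a b : (forall v, A v -> v < n) ->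
  all (fun x => ~~ A x && (x < n)) [:: x1; x2; x3; x4] -> A a -> A b ->
  all (fun x => x < n) [:: a; x1; x2; x3; x4; b].
Proof.
by move=> AN /= /and5P [/andP [_ ->] /andP [_ ->] /andP [_ ->] /andP [_ ->] _] /AN -> /AN ->.
Qed.

Lemma addEar_GS s A l : GS s A l ->
  GS (exec n addEar s) (addA A (sv s 8) (sv s 9) (sv s 10) (sv s 11))
     ([:: sv s 7; sv s 8; sv s 9; sv s 10; sv s 11; sv s 12] :: l).
Proof.
move=> H.
exact: (GS_add H (ys := [:: 7; 8; 9; 10; 11; 12]) (erefl _) isT (fun v => @dom_addA _ _ _ _ _ v)).
Qed.

Lemma addTwo_GS s A l : GS s A l ->
  GS (exec n addTwo s) (addA A (sv s 8) (sv s 9) (sv s 10) (sv s 11))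
     ([:: sv s 8; sv s 9; sv s 9; sv s 9; sv s 9; sv s 8] ::
      [:: sv s 7; sv s 8; sv s 8; sv s 8; sv s 8; sv s 7] :: l).
Proof.
move=> H.
have -> : exec n addTwo s = exec n (push [:: 8; 9; 9; 9; 9; 8])
    (exec n (Seq setA (push [:: 7; 8; 8; 8; 8; 7])) s) by rewrite /addTwo !exec_Seq.
have := GS_add H (ys := [:: 7; 8; 8; 8; 8; 7]) (erefl _) isT (fun v => @dom_addA _ _ _ _ _ v).
have Fv y : y != 13 -> sv (exec n (Seq setA (push [:: 7; 8; 8; 8; 8; 7])) s) y = sv s y.
  by move=> Hy; rewrite exec_Seq push_sv //; case: (setA_frame s) => _ ->.
move: (exec n (Seq setA _) s) Fv => s5 Fv G1.
have := push_GS G1 (ys := [:: 8; 9; 9; 9; 9; 8]) (erefl _) isT.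
by rewrite [map _ [:: _ , _ , _ , _ , _ & _]]/= !Fv.
Qed.

Lemma rrs_step_spec s A l c r : greedy n adj A l c r -> GS s A l ->
  no_eff adj A -> no_two adj A ->
  (forall v, v < n -> (cell n s qW v != 0) = dom n adj A v) -> progress A (exec n rrs_step s).
Proof.
move=> G H0 nE nT HW; have [A0 AN _ _] := greedy_basic adjC adjI adj_lt n0 G.
have TR : forall a x1 x2 x3 x4 b, rrs n adj A a x1 x2 x3 x4 b ->
    all (fun x => x < n) [:: a; x1; x2; x3; x4; b].
  move=> a x1 x2 x3 x4 b H; have [K _ _ _ _] := rrs_facts adjC adjI adj_lt H.
  by case/andP: H => /and4P [Aa _ _ _] /and5P [_ _ /eqP E _ _]; apply: all_lt6 K _ _; rewrite // E.
rewrite /rrs_step exec_Seq; have [] := @test_spec eRrs s A l (rrs n adj A) H0 TR.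
  move=> s' Es; case: H0 => K1 K2 _ _.
  by apply: ev_eRrs; rewrite ?(cell_sa _ Es) ?Es.
move: (exec n (search eRrs) s) => s1 H1; rewrite exec_If; case: ifP => _ F.
  have [K1 K2 _ _ _] := rrs_facts adjC adjI adj_lt F.
  do 4 eexists; split; [exact: GR G nE nT F|exact: addTwo_GS|left].
  split; first by rewrite cardA_add // K2; lia.
  by case=> _ _ /(_ _ _ _ _ _ _)/negP /(_ F).
by exists A, l, c, r; split=> //; right.
Qed.

Lemma two_step_spec s A l c r : greedy n adj A l c r -> GS s A l ->
  no_eff adj A ->
  (forall v, v < n -> (cell n s qW v != 0) = dom n adj A v) -> progress A (exec n two_step s).
Proof.
move=> G H0 nE HW; have [A0 AN _ _] := greedy_basic adjC adjI adj_lt n0 G.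
have TT : forall a x1 x2 x3 x4 b, two adj A a x1 x2 x3 x4 b ->
    all (fun x => x < n) [:: a; x1; x2; x3; x4; b].
  move=> a x1 x2 x3 x4 b H; have [K _ _ _ _] := two_facts adjI adj_lt H.
  by case/andP: H => /and4P [Aa Ab _ _] _; apply: all_lt6 K _ _.
rewrite /two_step exec_Seq; have [] := @test_spec eTwo s A l (two adj A) H0 TT.
  by move=> s' Es; case: H0 => K1 K2 _ _; apply: ev_eTwo; rewrite ?(cell_sa _ Es) ?Es.
have := search_sa n eTwo s.
move: (exec n (search eTwo) s) => s1 E1 H1; rewrite exec_If; case: ifP => _ F.
  do 4 eexists; split; [exact: GT G nE F|exact: addEar_GS|left].
  have [K1 K2 _ _ _] := two_facts adjI adj_lt F; split; first by rewrite cardA_add // K2; lia.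
  by case=> _ /(_ _ _ _ _ _ _)/negP /(_ F).
by apply: rrs_step_spec G H1 nE F _; rewrite (cell_sa _ E1).
Qed.

Lemma greedy_step_spec s A l c r : greedy n adj A l c r -> GS s A l ->
  progress A (exec n greedy_step s).
Proof.
move=> G H0; have [A0 AN _ _] := greedy_basic adjC adjI adj_lt n0 G.
rewrite /greedy_step exec_Seq; have [] := domc_spec H0.
move: (exec n domc s) => s1 H1 HW.
have TE : forall a x1 x2 x3 x4 b, eff adj A a x1 x2 x3 x4 b ->
    all (fun x => x < n) [:: a; x1; x2; x3; x4; b].
  move=> a x1 x2 x3 x4 b H; have [K _ _] := eff_facts adjC adjI adj_lt H.
  by case/andP: H => /andP [/and5P [Aa Ab _ _ _] _] _; apply: all_lt6 K _ _.
rewrite exec_Seq; have [] := @test_spec eEff s1 A l (eff adj A) H1 TE.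
  by move=> s' Es; case: H1 => K1 K2 _ _; apply: ev_eEff; rewrite ?(cell_sa _ Es) ?Es.
have := search_sa n eEff s1.
move: (exec n (search eEff) s1) => s2 E2 H2; rewrite exec_If; case: ifP => _ F.
  do 4 eexists; split; [exact: GE G F|exact: addEar_GS|left].
  have [K1 K2 _] := eff_facts adjC adjI adj_lt F; split; first by rewrite cardA_add // K2; lia.
  by case=> /(_ _ _ _ _ _ _)/negP /(_ F).
by apply: two_step_spec G H2 F _; rewrite (cell_sa _ E2).
Qed.

Lemma greedyc_spec s : sa s qE = E0 -> (forall k, cell n s qA k = 0) ->
  (forall k, cell n s qW k = 0) ->
  exists A l c r, [/\ greedy n adj A l c r, GS (exec n greedyc s) A l &
    [/\ no_eff adj A, no_two adj A & no_rrs n adj A]].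
Proof.
move=> HE0 HA0 HW0; rewrite /greedyc !exec_Seq.
set s1 := exec n (S2 _ _ _ _) _.
have G1 : GS s1 (fun v => v == 0) [::].
  split=> //.
  - by move=> v vn; have := HA0 v; rewrite /s1 /cell /= idx2_eq0; case: (v == 0) => //= ->.
  - by move=> v vn; have := HW0 v; rewrite /s1 /cell /= => ->.
pose J t s := exists A l c r, [/\ greedy n adj A l c r, GS s A l &
   t.+1 <= cardA n A \/ [/\ no_eff adj A, no_two adj A & no_rrs n adj A]].
have [|t s' tn|A [l [c [r [G H NN]]]]] := @iter_inv _ J (exec n greedy_step) n s1.
- exists (fun v => v == 0), [::], 0, 0; split=> //; first exact: G0.
  by left; rewrite cardA0.
- move=> [A [l [c [r [G H HH]]]]].
  have [A' [l' [c' [r' [G' H' HH']]]]] := greedy_step_spec G H.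
  exists A', l', c', r'; split=> //.
  case: HH' => [[HH' NN]|[-> N1 N2 N3]]; last by right.
  by case: HH => [HH|/NN //]; left; lia.
- exists A, l, c, r; split=> //.
  case: NN => // NN; have : cardA n A <= n by apply: leq_trans (count_size _ _) _; rewrite size_iota.
  by lia.
Qed.
End GreedySpec.

Section GreedyLog.
Variables (n : nat) (adj : rel nat).
Hypotheses (n0 : 0 < n) (adjC : symmetric adj) (adjI : irreflexive adj).
Hypothesis adj_lt : forall u v, adj u v -> u < n.

Lemma okl_two A l a x1 x2 b : okl n adj A l -> (forall v, A v -> v < n) ->
  A a -> A b -> ~~ A x1 -> ~~ A x2 -> adj a x1 -> adj x1 x2 -> adj x2 b ->
  okl n adj (addA A x1 x2 x2 x2) ([:: a; x1; x2; x2; x2; b] :: l).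
Proof.
move=> H AN Aa Ab N1 N2 e1 e2 e3; have n12 := adj_neq adjI e2.
have n1b : x1 != b by apply: contra N1 => /eqP ->.
apply: oklS => //; rewrite ?AN //=.
- by rewrite N1 N2 (adj_lt e2) (adj_lt e3).
- by rewrite e2 e3 !eqxx !orbT.
- by rewrite (negbTE n12) !eqxx (negbTE (adj_neq adjI e3)) !inE !negb_or n12 n1b (adj_neq adjI e3).
Qed.

Lemma okl_one A l a x b : okl n adj A l -> (forall v, A v -> v < n) ->
  A a -> A b -> ~~ A x -> adj a x -> adj x b ->
  okl n adj (addA A x x x x) ([:: a; x; x; x; x; b] :: l).
Proof.
move=> H AN Aa Ab N1 e1 e2; apply: oklS => //; rewrite ?AN //=.
- by rewrite N1 (adj_lt e2).
- by rewrite e2 !eqxx !orbT.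
- by rewrite !eqxx (negbTE (adj_neq adjI e2)) inE (adj_neq adjI e2).
Qed.

(** A pendant path is two successive closed ears, the first at [a] with inner vertex [x1], the
    second at [x1] with inner vertex [x2]. *)
Lemma greedy_okl A l c r : greedy n adj A l c r -> okl n adj A l /\ c = lcost l.
Proof.
elim=> {A l c r}
  [|A l c r a x1 x2 x3 x4 b G [H ->] E|A l c r a x1 x2 x3 x4 b G [H ->] _ T
   |A l c r a x1 x2 x3 x4 b G [H ->] _ _ R]; first by split=> //; exact: okl0.
- have [_ AN _ _] := greedy_basic adjC adjI adj_lt n0 G.
  have [K _ _] := eff_facts adjC adjI adj_lt E; split; last by rewrite /lcost /= addnC.
  case/andP: E => /andP [/and5P [Aa Ab N1 N2 N3] /and5P [N4 e1 e2 e3 e4]] /and4P [e5 d13 d41 d42].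
  have ne x : ~~ A x -> x != b by apply: contra => /eqP ->.
  apply: oklS => //; rewrite ?AN //=; first by rewrite e2 e3 (eq_sym x3) e4 e5 !orbT.
  rewrite (negbTE (adj_neq adjI e2)) (negbTE (adj_neq adjI e3)) (negbTE (ne _ N4)) !inE !negb_or.
  rewrite (adj_neq adjI e2) (adj_neq adjI e3) d13 (eq_sym x1 x4) d41 (eq_sym x2 x4) d42.
  by rewrite !ne // /= (eq_sym x3 x4); case: (x4 == x3).
- have [_ AN _ _] := greedy_basic adjC adjI adj_lt n0 G.
  split; last by rewrite /lcost /= addnC.
  case/andP: T => /and4P [Aa Ab N1 N2] /and5P [/eqP -> /eqP -> e1 e2 e3].
  exact: okl_two.
- have [_ AN _ _] := greedy_basic adjC adjI adj_lt n0 G.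
  split; last by rewrite /lcost /=; lia.
  case/andP: R => /and4P [Aa N1 N2 D2] /and5P [/eqP -> /eqP -> _ e1 e2].
  have e1' : adj x1 a by rewrite adjC.
  have e2' : adj x2 x1 by rewrite adjC.
  have H1 := okl_one H AN Aa Aa N1 e1 e1'.
  have -> : addA A x1 x2 x2 x2 = addA (addA A x1 x1 x1 x1) x2 x2 x2 x2.
    apply: functional_extensionality => v; rewrite /addA !inE.
    by case: (A v); case: (v == x1); case: (v == x2).
  apply: okl_one => //.
  + by move=> v; rewrite /addA !inE !orbb => /orP [/AN //|/eqP ->]; exact: adj_lt e2.
  + by rewrite /addA inE eqxx orbT.
  + by rewrite /addA inE eqxx orbT.
  + by rewrite /addA !inE !orbb negb_or N2 eq_sym (adj_neq adjI e2).
Qed.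

(** Every ear brings a new vertex. Hence [n] rounds of [reversec] are enough to empty the log. *)
Lemma okl_size A l : okl n adj A l -> size l < cardA n A.
Proof.
elim=> [|{}A {}l a x1 x2 x3 x4 b _ IH _ _ _ _ Hx _ _ _]; first by rewrite cardA0.
have H : 0 < size (undup [:: x1; x2; x3; x4]).
  have : x1 \in undup [:: x1; x2; x3; x4] by rewrite mem_undup inE eqxx.
  by case: undup.
by rewrite cardA_add // [size (_ :: l)]/=; move: IH H; move: (size (undup _)); lia.
Qed.
End GreedyLog.

(** * The reverse pass *)

Definition eD e := A2 qD Z0 e.
Definition incM x y k := S2 qM (V x) (V y) (addc k (A2 qM (V x) (V y))).
Definition flipD x := S2 qD Z0 (V x) (eNot (eD (V x))).

Definition layc x y :=
  If (V 22) (Seq (incM x y 1) (Seq (incM y x 1) (Seq (flipD x) (flipD y))))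
    (If (V 24) (Seq (incM x y 2) (incM y x 2)) (Asg 24 eOne)).

Fixpoint countz x xs := if xs is y :: xs' then
  Seq (If (eEq (V x) (V y)) Nop
    (Seq (Asg 22 (Ite (eD (V x)) (eNot (V 22)) (V 22))) (If (V 22) Nop (Asg 23 (Suc (V 23))))))
    (countz y xs') else Nop.

Fixpoint layall x xs := if xs is y :: xs' then
  Seq (If (eEq (V x) (V y)) Nop (Seq (Asg 22 (eD (V x))) (layc x y))) (layall y xs') else Nop.

Definition popc := cseq (Asg 13 (Sb (V 13) (cst 6)) ::
  [seq Asg (16 + i) (A2 qL Z0 (addc i (V 13))) | i <- six]).

(** Two passes over the ear: [countz] counts in variable 23 the even edges that an odd first edge
    would cause; then the better parity is chosen and the edges are laid, with variable 22 as
    current parity and 24 as the flag [zc]. *)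
Definition earc := Seq popc (Seq (Asg 22 eOne) (Seq (Asg 23 Z0)
  (Seq (countz 17 [:: 18; 19; 20; 21]) (Seq (Asg 22 (eNot (Sb (V 23) (cst 2))))
  (Seq (Asg 24 Z0) (Seq (layc 16 17) (layall 17 [:: 18; 19; 20; 21]))))))).

Definition reversec := Rep (If (V 13) earc Nop).

Section Reverse.
Variable n : nat.

Definition MD s mu := (forall u v, u < n -> v < n -> sa s qM (idx2 n u v) = mu u v) /\
  (forall v, v < n -> (cell n s qD v != 0) = odd (deg n mu v)).

Lemma layc_spec s mu x y : MD s mu -> sv s x < n -> sv s y < n -> sv s x != sv s y ->
  let s' := exec n (layc x y) s in
  [/\ MD s' (lay mu (sv s 24 != 0) (sv s 22 != 0) (sv s x) (sv s y)),
      (sv s' 24 != 0) = (sv s 24 != 0) || ~~ (sv s 22 != 0) & forall z, z != 24 -> sv s' z = sv s z].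
Proof.
move=> [HM HD] xn yn xy s'.
have F z : z != 24 -> sv s' z = sv s z by move=> Hz; rewrite mv_frame //= negb_or.
have evV z : ev n s (V z) = (sv s z != 0) by [].
split=> //; last first.
  rewrite /s' /layc !exec_If !evV; case: (sv s 22 != 0); first by rewrite mv_frame // orbF.
  by case: (boolP (sv s 24 != 0)) => E //; rewrite mv_frame // E.
have inc k s1 : (forall u v, u < n -> v < n -> sa s1 qM (idx2 n u v) = mu u v) -> sv s1 = sv s ->
    forall u v, u < n -> v < n -> sa (exec n (incM y x k) (exec n (incM x y k) s1)) qM (idx2 n u v) =
      addm mu (sv s x) (sv s y) k u v.
  move=> H1 E u v un vn; rewrite /= !eval_addc /= E !idx2_eq // (eq_sym (sv s y)) (negbTE xy) /=.
  rewrite !H1 // /addm; case: (boolP ((u == sv s y) && (v == sv s x))) => [/andP [/eqP -> /eqP ->]|_].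
    by rewrite (eq_sym (sv s y)) (negbTE xy) /= muln1.
  by case: (boolP ((u == sv s x) && (v == sv s y))) => [/andP [/eqP -> /eqP ->]|_]; rewrite ?muln1 ?muln0 ?addn0.
rewrite /s' /layc !exec_If !evV.
case: (sv s 22 != 0).
  rewrite /lay; split.
    by move=> u v un vn; rewrite -(inc 1 s).
  move=> v vn; rewrite deg_addm // mul1n oddD -HD //.
  rewrite /cell /= !idx2_eq0 /= -!/(cell n s qD _).
  rewrite (eq_sym (sv s y)) (negbTE xy).
  case: (eqVneq v (sv s y)) => [->|vy].
    by rewrite (eq_sym (sv s y)) (negbTE xy) /=; case: (cell n s qD (sv s y)).
  by case: (eqVneq v (sv s x)) => [->|vx] /=; [case: (cell n s qD (sv s x))|rewrite addbF].
case: (sv s 24 != 0).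
  rewrite /lay; split; first by move=> u v un vn; rewrite -(inc 2 s).
  by move=> v vn; rewrite deg_addm // oddD oddM /= addbF -HD.
rewrite /lay; split; first by move=> u v un vn; rewrite /= /addm mul0n addn0 HM.
by move=> v vn; rewrite deg_addm // mul0n addn0 -HD.
Qed.

Lemma layall_spec s mu zc x xs : MD s mu -> zc = (sv s 24 != 0) ->
  (forall y, y \in x :: xs -> sv s y < n /\ 24 != y /\ 22 != y) ->
  let s' := exec n (layall x xs) s in
  MD s' (layp n mu zc (sv s x) (map (sv s) xs)) /\ sv s' 13 = sv s 13.
Proof.
elim: xs s mu zc x => [|y xs IH] s mu zc x H Hz Hx //; rewrite [layall _ _]/= exec_Seq.
have [xn _] := Hx x (mem_head _ _).
have [yn _] : sv s y < n /\ (24 != y /\ 22 != y) by apply: Hx; rewrite !inE eqxx orbT.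
have Hx' y' : y' \in y :: xs -> sv s y' < n /\ 24 != y' /\ 22 != y'.
  by move=> Hy; apply: Hx; rewrite inE Hy orbT.
rewrite [layp _ _ _ _ _]/= exec_If ev_Eq [eval _ _ _]/= [eval _ _ (V y)]/=.
case: eqP => [E|/eqP xy]; first exact: IH.
rewrite exec_Seq; set s1 := exec n (Asg 22 _) s.
have F1 z : 22 != z -> sv s1 z = sv s z by move=> /negbTE Hz'; rewrite /s1 /= /upd eq_sym Hz'.
have E22 : (sv s1 22 != 0) = odd (deg n mu (sv s x)) by case: (H) => _ <-.
have [_ [x24 x22]] := Hx x (mem_head _ _); have [_ [y24 y22]] := Hx' y (mem_head _ _).
have MD1 : MD s1 mu by [].
have [] := @layc_spec s1 mu x y MD1; rewrite ?(F1 x) ?(F1 y) // => H1 H2 H3.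
have F2 z : 24 != z -> 22 != z -> sv (exec n (layc x y) s1) z = sv s z.
  by move=> z24 z22; rewrite H3 1?eq_sym // F1.
rewrite E22 (F1 24) // -Hz in H1 H2.
have Hx2 z : z \in y :: xs -> sv (exec n (layc x y) s1) z < n /\ 24 != z /\ 22 != z.
  by move=> /Hx' [h1 [h2 h3]]; rewrite F2.
have [K1 K2] := IH _ _ _ _ H1 (esym H2) Hx2.
lazy zeta; rewrite K2 F2 //; split=> //; move: K1; rewrite F2 //.
have -> // : [seq sv (exec n (layc x y) s1) z | z <- xs] = [seq sv s z | z <- xs].
apply/eq_in_map => z zx; have [|_ [z24 z22]] := Hx' z; first by rewrite inE zx orbT.
exact: F2.
Qed.

Lemma countz_spec s (D : nat -> bool) e x xs : e = (sv s 22 != 0) ->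
  (forall v, v < n -> (cell n s qD v != 0) = D v) ->
  (forall y, y \in x :: xs -> [&& sv s y < n, 22 != y & 23 != y]) ->
  let s' := exec n (countz x xs) s in
  sv s' 23 = sv s 23 + zeros D e (sv s x) (map (sv s) xs) /\
  forall z, 22 != z -> 23 != z -> sv s' z = sv s z.
Proof.
elim: xs s e x => [|y xs IH] s e x He HD Hx; first by split=> //; rewrite addn0.
have /and3P [xn x22 x23] := Hx x (mem_head _ _).
have Hx' y' : y' \in y :: xs -> [&& sv s y' < n, 22 != y' & 23 != y'].
  by move=> Hy; apply: Hx; rewrite inE Hy orbT.
have /and3P [yn y22 y23] := Hx' y (mem_head _ _).
rewrite [countz _ _]/= exec_Seq exec_If ev_Eq [eval _ _ _]/= [eval _ _ (V y)]/=.
rewrite [zeros _ _ _ _]/=; case: eqP => [E|/eqP xy]; first exact: IH.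
rewrite exec_Seq; set s1 := exec n (Asg 22 _) s; rewrite exec_If.
have F1 z : 22 != z -> sv s1 z = sv s z by move=> /negbTE Hz; rewrite /s1 /= /upd eq_sym Hz.
have E22 : (sv s1 22 != 0) = e (+) D (sv s x).
  rewrite He -HD // /s1 /= -/(cell n s qD (sv s x)).
  by case: (cell n s qD (sv s x)); case: (sv s 22).
have -> : ev n s1 (V 22) = (sv s1 22 != 0) by [].
set s2 := (if _ then _ else _).
have F2 z : 22 != z -> 23 != z -> sv s2 z = sv s z.
  move=> z22 /negbTE z23; rewrite -F1 // /s2; case: ifP => // _.
  by rewrite /= /upd eq_sym z23.
have E2 : sa s2 = sa s by rewrite /s2; case: ifP.
have G22 : e (+) D (sv s x) = (sv s2 22 != 0) by rewrite -E22 /s2; case: ifP.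
have E23 : sv s2 23 = sv s 23 + ~~ (e (+) D (sv s x)).
  by rewrite -E22 /s2; case: ifP => _ /=; rewrite ?addn0 ?addn1.
have [] := IH s2 _ y G22.
- by move=> v vn; rewrite -HD // /cell E2.
- by move=> z /Hx' /and3P [h1 h2 h3]; rewrite F2 // h1 h2.
lazy zeta => K1 K2; split; last by move=> z z22 z23; rewrite K2 // F2.
rewrite K1 E23 F2 // -addnA.
have -> // : [seq sv s2 z | z <- xs] = [seq sv s z | z <- xs].
apply/eq_in_map => z zx; have /Hx' /and3P [_ z22 z23] : z \in y :: xs by rewrite inE zx orbT.
exact: F2.
Qed.

Variables (adj : rel nat) (Af : pred nat) (cF : nat).
Hypotheses (n0 : 0 < n) (adjC : symmetric adj) (adjI : irreflexive adj).
Hypothesis adj_lt : forall u v, adj u v -> u < n.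

Lemma okl_inv A g l : okl n adj A (g :: l) -> exists A' a x1 x2 x3 x4 b,
  [/\ A = addA A' x1 x2 x3 x4, g = [:: a; x1; x2; x3; x4; b], okl n adj A' l,
   [/\ A' a, A' b, a < n & b < n] &
   [/\ all (fun x => ~~ A' x && (x < n)) [:: x1; x2; x3; x4], adj a x1,
    path (fun x y => (x == y) || adj x y) x1 [:: x2; x3; x4; b] &
    simp x1 [:: x2; x3; x4; b]]].
Proof.
move E : (g :: l) => gl H; case: H E => // A' l' a x1 x2 x3 x4 b H1 H2 H3 H4 H5 H6 H7 H8 H9 [-> ->].
by exists A', a, x1, x2, x3, x4, b.
Qed.

Lemma popc_spec s g l : LogRep n s (g :: l) -> let s' := exec n popc s in
  [/\ sa s' = sa s, sv s' 13 = 6 * size l & forall i, i < 6 -> sv s' (16 + i) = nth 0 g i].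
Proof.
move=> [H1 H2] s'; have E : sv s' 13 = 6 * size l.
  have -> : sv s' 13 = sv s 13 - 6 by [].
  by rewrite H1 /= mulnS addKn.
split=> // i Hi.
have Ei : sv s' (16 + i) = cell n s qL (i + (sv s 13 - 6)).
  have E6 : sv s 13 - 6 = sv s 13 - eval n s (cst 6) by rewrite eval_cst.
  by do 6 (case: i Hi => [_|i Hi]; first by rewrite addnC).
have <- : cell n s qL (6 * size l + i) = nth 0 g i.
  by rewrite H2 // rev_cons nth_rcons size_rev ltnn eqxx.
by rewrite Ei H1 mulnS addKn addnC.
Qed.

Definition RS s l := exists A mu, [/\ okl n adj A l, MD s mu, RevI n adj Af cF A l mu,
  LogRep n s l & forall v, A v -> Af v].

Lemma earc_spec s g l : RS s (g :: l) -> RS (exec n earc s) l.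
Proof.
move=> [A [mu [Ho HM HR HL HA]]].
have [A' [a [x1 [x2 [x3 [x4 [b [EA Eg Ho' [Aa Ab an bn] [Hx e1 Hp Hs]]]]]]]]] := okl_inv Ho.
rewrite {A}EA {g}Eg in Ho HR HL HA.
rewrite /earc exec_Seq; have [] := popc_spec HL; set s1 := exec n popc s => P1 P2 P3.
have Hy : [/\ sv s1 16 = a, sv s1 17 = x1, sv s1 18 = x2, sv s1 19 = x3 & sv s1 20 = x4].
  by split; [exact: (P3 0)|exact: (P3 1)|exact: (P3 2)|exact: (P3 3)|exact: (P3 4)].
have y5 : sv s1 21 = b by exact: (P3 5).
clearbody s1; rewrite exec_Seq exec_Seq exec_Seq; set s2 := exec n (Asg 23 Z0) _.
have F2 z : 22 != z -> 23 != z -> sv s2 z = sv s1 z.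
  by move=> /negbTE z22 /negbTE z23; rewrite /s2 /= /upd !(eq_sym z) z22 z23.
have e22 : sv s2 22 = 1 by []. have e23 : sv s2 23 = 0 by [].
have E2 : sa s2 = sa s by rewrite -P1.
clearbody s2.
case: Hy => y0 y1 y2 y3 y4.
have xn z : z \in [:: 17; 18; 19; 20; 21] -> sv s2 z < n.
  have /and5P [/andP [_ n1] /andP [_ n2] /andP [_ n3] /andP [_ n4] _] := Hx.
  by rewrite !inE => /or4P [/eqP ->|/eqP ->|/eqP ->|/orP [/eqP ->|/eqP ->]];
    rewrite F2 // ?y1 ?y2 ?y3 ?y4 ?y5.
have HD2 v : v < n -> (cell n s2 qD v != 0) = odd (deg n mu v).
  by move=> vn; case: HM => _ <- //; rewrite /cell E2.
have Em : [seq sv s2 z | z <- [:: 18; 19; 20; 21]] = [:: x2; x3; x4; b].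
  by rewrite [LHS]/= !F2 // y2 y3 y4 y5.
have [] := @countz_spec s2 _ true 17 [:: 18; 19; 20; 21] _ HD2; first by rewrite e22.
  move=> z Hz; rewrite xn //=; move: Hz; rewrite !inE.
  by case/or4P => [/eqP ->|/eqP ->|/eqP ->|/orP [/eqP ->|/eqP ->]].
have E3 : sa (exec n (countz 17 [:: 18; 19; 20; 21]) s2) = sa s2.
  by apply: functional_extensionality => q; rewrite ma_frame.
move: E3; set s3 := exec n (countz _ _) s2; clearbody s3 => E3.
rewrite e23 add0n F2 // y1 Em => Z3 F3.
rewrite exec_Seq exec_Seq exec_Seq; set s4 := exec n (Asg 24 Z0) _.
have F4 z : 22 != z -> 24 != z -> sv s4 z = sv s3 z.
  by move=> /negbTE z22 /negbTE z24; rewrite /s4 /= /upd !(eq_sym z) z22 z24.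
(* Truncated subtraction of 2 vanishes exactly when the count is at most 2. *)
have f22 : (sv s4 22 != 0) = (zeros (fun v => odd (deg n mu v)) true x1 [:: x2; x3; x4; b] <= 2).
  rewrite -Z3 -subn_eq0 /s4 /= /upd /=.
  have -> : sv s3 23 - 2 = sv s3 23 - eval n s3 (cst 2) by rewrite eval_cst.
  by case: (sv s3 23 - _).
have f24 : sv s4 24 = 0 by [].
have E4 : sa s4 = sa s by rewrite -E2 -E3.
clearbody s4.
have FF z : [&& 22 != z, 23 != z & 24 != z] -> sv s4 z = sv s1 z.
  by case/and3P => z22 z23 z24; rewrite F4 // F3 // F2.
have MD4 : MD s4 mu.
  by case: HM => M1 M2; split=> [u v un vn|v vn]; rewrite ?E4 ?M1 // -M2 // /cell E4.
have ax : a != x1 by apply/eqP => E; rewrite E adjI in e1.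
have x1n : x1 < n by case/andP: Hx => /andP [].
have [] := @layc_spec s4 mu 16 17 MD4; rewrite ?(FF 16) ?(FF 17) ?y0 ?y1 //.
rewrite f22 f24 eqxx; set e0 := zeros _ _ _ _ <= 2.
set s5 := exec n (layc 16 17) s4; have L5 : sa s5 qL = sa s4 qL by rewrite ma_frame.
clearbody s5 => M5 Z5 F5.
have E5 z : [&& 22 != z, 23 != z & 24 != z] -> sv s5 z = sv s1 z.
  by move=> Hz; case/and3P: (Hz) => h1 h2 h3; rewrite F5 1?eq_sym // FF.
have [|K1 K2] := @layall_spec s5 _ _ 17 [:: 18; 19; 20; 21] M5 (esym Z5).
  move=> z Hz; have := xn z Hz; move: Hz; rewrite !inE => Hz.
  have Hz' : [&& 22 != z, 23 != z & 24 != z].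
    by case/or4P: Hz => [/eqP ->|/eqP ->|/eqP ->|/orP [/eqP ->|/eqP ->]].
  by rewrite E5 // -(FF z) // FF //; case/and3P: Hz' => h1 h2 h3; rewrite F2.
have Em' : [seq sv s5 z | z <- [:: 18; 19; 20; 21]] = [:: x2; x3; x4; b].
  by rewrite [LHS]/= !E5 // y2 y3 y4 y5.
rewrite Em' E5 // y1 in K1.
exists A', (layear n mu e0 a [:: x1; x2; x3; x4; b]); split=> //.
- apply: (@RevI_step n adj Af cF adjC A' l mu a x1 x2 x3 x4 b e0 erefl) => //.
- have L6 : sa (exec n (layall 17 [:: 18; 19; 20; 21]) s5) qL = sa s5 qL by rewrite ma_frame.
  case: HL => _ HL; split; first by rewrite K2 E5.
  move=> i j Hi Hj; rewrite /cell L6 L5 E4 -/(cell n s qL _) HL //=; last exact: ltnW.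
  by rewrite rev_cons nth_rcons size_rev Hi.
- by move=> v Hv; apply: HA; rewrite /addA Hv.
Qed.

Lemma reversec_spec s l : RS s l -> size l <= n -> let s' := exec n reversec s in
  exists mu, MD s' mu /\ RevI n adj Af cF (fun v => v == 0) [::] mu.
Proof.
move=> H Hs s'.
pose J t s := exists l, RS s l /\ size l <= n - t.
have : J n s'.
  apply: (iter_inv (I := J)); first by exists l; rewrite subn0.
  move=> t s1 tn [{H Hs}l [H Hs]].
  change (J t.+1 (exec n (If (V 13) earc Nop) s1)); rewrite exec_If.
  have E : sv s1 13 = 6 * size l by case: H => A [mu [_ _ _ [E _] _]].
  have -> : ev n s1 (V 13) = (size l != 0) by rewrite /ev /= E muln_eq0.
  case: l H Hs {E} => [|g l] H Hs; first by exists [::].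
  have -> : (size (g :: l) != 0) = true by [].
  exists l; split; first exact: earc_spec H.
  by move: Hs; rewrite [size _]/=; lia.
case=> {H Hs}l [[A [mu [Ho HM HR _ _]]] ]; rewrite subnn leqn0 size_eq0 => /eqP El.
rewrite {}El in Ho HR; exists mu; split=> //.
have <- // : A = (fun v => v == 0).
by move E : [::] Ho => l' H; case: H E.
Qed.
End Reverse.

(** * The closed trail *)

Definition decM x y := S2 qM (V x) (V y) (Sb (A2 qM (V x) (V y)) eOne).
Definition scanc := For 27 (If (A2 qM (V 30) (V 27)) (Seq (Asg 28 eOne) (Asg 29 (V 27))) Nop).
Definition extendc := Seq (decM 30 29) (Seq (decM 29 30)
  (Seq (Asg 26 (Suc (V 26))) (S2 qO Z0 (V 26) (V 29)))).
Definition rotatec := Seq (S2 qO Z0 (Suc (V 26)) (A2 qO Z0 (Suc (V 25))))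
  (Seq (Asg 25 (Suc (V 25))) (Asg 26 (Suc (V 26)))).
Definition trailstep := Seq (Asg 30 (A2 qO Z0 (V 26))) (Seq (Asg 28 Z0) (Seq scanc
  (If (V 28) extendc (If (Sb (V 26) (V 25)) rotatec Nop)))).
Definition trailc := Seq (Asg 25 Z0) (Seq (Asg 26 Z0) (Seq (S2 qO Z0 Z0 Z0)
  (Rep (Rep (Rep (Rep (Rep trailstep))))))).

Section Trail.
Variables (n : nat) (adj : rel nat) (Af : pred nat) (T0 M : nat).
Hypotheses (adjC : symmetric adj) (adjI : irreflexive adj).
Hypothesis AfN : forall v, Af v -> v < n.
Hypothesis TM : T0 <= 2 * M.

Definition MR s mu := forall u v, u < n -> v < n -> sa s qM (idx2 n u v) = mu u v.

Lemma scanc_spec s mu : MR s mu -> sv s 30 < n -> sv s 28 = 0 -> let s' := exec n scanc s in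
  [/\ sa s' = sa s, forall y, y \in [:: 25; 26; 30] -> sv s' y = sv s y &
   if sv s' 28 != 0 then sv s' 29 < n /\ 0 < mu (sv s 30) (sv s' 29)
   else deg n mu (sv s 30) = 0].
Proof.
move=> HM vn f0 s'.
have E : sa s' = sa s by apply: functional_extensionality => q; rewrite ma_frame.
have Ev y : y \in [:: 25; 26; 30] -> sv s' y = sv s y.
  by rewrite !inE => /or3P [] /eqP ->; rewrite mv_frame.
split=> //.
pose J k s1 := [/\ sa s1 = sa s, sv s1 30 = sv s 30 & if sv s1 28 != 0
   then sv s1 29 < n /\ 0 < mu (sv s 30) (sv s1 29)
   else forall w, w < k -> mu (sv s 30) w = 0].
have [_ _] : J n s'.
  apply: For_inv => //; first by split=> //=; rewrite /upd /= f0.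
  move=> k s1 kn E27 [J1 J2 J3]; rewrite exec_If.
  have -> : ev n s1 (A2 qM (V 30) (V 27)) = (mu (sv s 30) k != 0).
    by rewrite /ev /= J1 J2 E27 HM.
  case: ifP => Hk; first by split; rewrite //= /upd /= E27 lt0n Hk.
  split=> //=; rewrite /upd /=; case: ifP J3 => //= _ J3 w.
  by rewrite ltnS leq_eqVlt => /orP [/eqP ->|/J3 //]; apply/eqP; move: Hk => /negbFE.
case: ifP => // _ H; rewrite /deg big1 // => w _; exact: H.
Qed.

Definition ES s mu := MR s mu /\ EI n adj Af T0 mu (cell n s qO) (sv s 25) (sv s 26).

Lemma cell_upd s k v : cell n (seta s qO (idx2 n 0 k) v) qO = upd (cell n s qO) k v.
Proof. by apply: functional_extensionality => t; rewrite cell_set eqxx. Qed.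

Lemma trailstep_spec s mu : ES s mu -> exists mu', ES (exec n trailstep s) mu' /\
  (tot n mu = 0 -> tot n mu' = 0) /\ (0 < tot n mu ->
   Phi n M mu' (cell n (exec n trailstep s) qO) (sv (exec n trailstep s) 25) (sv (exec n trailstep s) 26)
   < Phi n M mu (cell n s qO) (sv s 25) (sv s 26)).
Proof.
move=> [HM HI]; rewrite /trailstep 3!exec_Seq; set s1 := exec n (Asg 28 Z0) _.
have E30 : sv s1 30 = cell n s qO (sv s 26) by [].
have E1 : sa s1 = sa s by [].
have E25 : sv s1 25 = sv s 25 by []. have E26 : sv s1 26 = sv s 26 by [].
have E28 : sv s1 28 = 0 by [].
clearbody s1; have le := EI_le HI.
have Av : Af (cell n s qO (sv s 26)) by apply: (EI_Af HI); rewrite le leqnn.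
have vn := AfN Av.
have HM1 : MR s1 mu by rewrite /MR E1.
have [] := scanc_spec HM1 _ E28; first by rewrite E30.
set s2 := exec n scanc s1; clearbody s2 => E2 F2; rewrite !exec_If.
have -> : ev n s2 (V 28) = (sv s2 28 != 0) by [].
have G30 : sv s2 30 = cell n s qO (sv s 26) by rewrite F2.
have G25 : sv s2 25 = sv s 25 by rewrite F2.
have G26 : sv s2 26 = sv s 26 by rewrite F2.
have EC : cell n s2 qO = cell n s qO by apply: functional_extensionality => t; rewrite /cell E2 E1.
rewrite E30; case: ifP => _.
  move=> [un Hu]; set v := cell n s qO (sv s 26) in Av vn Hu G30 *; set u := sv s2 29 in un Hu *.
  have [HI' Et] := EI_extend adjI AfN HI Hu.
  have HP := Phi_extend adjI AfN TM HI Hu.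
  exists (subm mu v u).
  have C : cell n (exec n extendc s2) qO = upd (cell n s qO) (sv s 26).+1 u.
    rewrite /extendc 3!exec_Seq -EC; set s3 := exec n (Asg 26 _) _.
    have -> : cell n s2 qO = cell n s3 qO by [].
    have -> : (sv s 26).+1 = sv s3 26 by rewrite -G26.
    exact: cell_upd.
  have V25 : sv (exec n extendc s2) 25 = sv s 25 by rewrite mv_frame.
  have V26 : sv (exec n extendc s2) 26 = (sv s 26).+1 by rewrite -G26.
  split; last by rewrite C V25 V26; split=> //; lia.
  split; last by rewrite C V25 V26.
  have uv : (v == u) = false.
    have /and3P [vu _ _] := EI_pos HI Hu.
    by apply/eqP => E; rewrite E adjI in vu.
  move=> x y xn yn; rewrite /= G30 -/u !idx2_eq // (eq_sym u) uv /=.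
  rewrite E2 E1 !HM // /subm.
  case: (boolP ((x == u) && (y == v))) => [/andP [/eqP -> /eqP ->]|_].
    by rewrite (eq_sym u) uv.
  by case: (boolP ((x == v) && (y == u))) => [/andP [/eqP -> /eqP ->]|_]; rewrite ?addn0 ?subn0.
move=> D0.
have -> : ev n s2 (Sb (V 26) (V 25)) = (sv s 25 < sv s 26) by rewrite /ev /= G25 G26 subn_eq0 ltnNge.
exists mu; case: ltnP => lh.
  have HI' := EI_rotate AfN HI D0 lh.
  have C : cell n (exec n rotatec s2) qO =
      upd (cell n s qO) (sv s 26).+1 (cell n s qO (sv s 25).+1).
    rewrite -G25 -G26 -EC; exact: (cell_upd s2 (sv s2 26).+1 (cell n s2 qO (sv s2 25).+1)).
  have V25 : sv (exec n rotatec s2) 25 = (sv s 25).+1 by rewrite -G25.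
  have V26 : sv (exec n rotatec s2) 26 = (sv s 26).+1 by rewrite -G26.
  split; last by rewrite C V25 V26; split=> // T; case: (Phi_rotate AfN M HI D0 T).
  split; last by rewrite C V25 V26.
  by move=> x y xn yn; rewrite ma_frame // E2 E1 HM.
have -> : exec n Nop s2 = s2 by [].
split; last first.
  by split=> // T; have [] := Phi_rotate AfN M HI D0 T; rewrite ltnNge lh.
split; last by rewrite EC G25 G26.
by move=> x y xn yn; rewrite E2 E1 HM.
Qed.

Lemma exec_rep5 c s : exec n (Rep (Rep (Rep (Rep (Rep c))))) s = iter (n ^ 5) (exec n c) s.
Proof.
have E k m (f : st -> st) : iter (k * m) f = iter k (iter m f).
  by apply: functional_extensionality => x; rewrite iterM.
by rewrite !expnS expn0 muln1 !E.
Qed.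

Lemma trailc_spec s mu : MR s mu -> msym mu ->
  (forall u v, 0 < mu u v -> [&& adj u v, Af u & Af v]) ->
  (forall v, v < n -> v != 0 -> ~~ odd (deg n mu v)) ->
  (forall v, Af v -> rch (pos mu) (fun v => v == 0) v) -> ~~ odd (tot n mu) ->
  tot n mu = T0 -> Af 0 -> T0 * M.+1 + 1 <= n ^ 5 ->
  let s' := exec n trailc s in exists mu', ES s' mu' /\ tot n mu' = 0.
Proof.
move=> HM sy ps od cn ev0 ET A0 HT; rewrite /trailc !exec_Seq; set s1 := exec n (S2 _ _ _ _) _.
have O0 : cell n s1 qO 0 = 0 by rewrite /s1 /cell /= idx2_eq0.
have E25 : sv s1 25 = 0 by []. have E26 : sv s1 26 = 0 by [].
have HM1 : MR s1 mu by move=> u v un vn; rewrite /s1 /= HM.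
have HI : EI n adj Af T0 mu (cell n s1 qO) 0 0.
  split=> //.
  - by move=> t; rewrite leqn0 => /eqP ->; rewrite O0.
  (* The reverse pass says nothing about the parity at vertex 0. It is even by the handshake
     argument: all other degrees and their total are even. *)
  - move=> v vn; rewrite O0 addbb; have [->|v0] := eqVneq v 0; last exact/negbTE/od.
    have n0 := AfN A0; move: ev0; rewrite /tot (bigD1 (Ordinal n0)) //= oddD.
    have -> : odd (\sum_(i < n | i != Ordinal n0) deg n mu i) = false.
      apply: (big_ind (fun x => odd x = false)) => // [x y Hx Hy|i Hi]; first by rewrite oddD Hx Hy.
      by apply/negbTE/od => //; apply: contra Hi => /eqP E; apply/eqP/val_inj.
    by rewrite addbF => /negbTE.
  - move=> v /cn; apply: rch_mono => // u /eqP ->; apply/rch0/toursetP => //.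
    by exists 0.
  - by rewrite subnn muln0 addn0.
clearbody s1.
pose J t s := exists mu, ES s mu /\ (tot n mu = 0 \/
  Phi n M mu (cell n s qO) (sv s 25) (sv s 26) + t <= n ^ 5).
have [] : J (n ^ 5) (exec n (Rep (Rep (Rep (Rep (Rep trailstep))))) s1).
  rewrite exec_rep5; apply: (iter_inv (I := J)).
    exists mu; split; first by split; last by rewrite E25 E26.
    right; rewrite addn0; apply: leq_trans HT; rewrite /Phi E25 E26 ET leq_add2l.
    by apply: leq_trans (find_size _ _) _; rewrite size_iota.
  move=> t s2 _ [mu2 [H2 HP]]; have [mu' [H' [K1 K2]]] := trailstep_spec H2.
  exists mu'; split=> //; case: HP => [/K1|HP]; first by left.
  have [/K1|T] := posnP (tot n mu2); first by left.
  by right; have := K2 T; lia.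
move=> mu' [H HP]; exists mu'; split=> //; case: HP => // HP.
have /eqP : tot n mu' * M.+1 = 0 by rewrite /Phi in HP; lia.
by rewrite muln_eq0 orbF => /eqP.
Qed.
End Trail.

(** * Writing the walk *)

(* Variables 31 and 32 hold the last configuration, which contains the vertex
   in variable 36; the next one puts that vertex in the other position. *)
Definition emitc := Seq
  (If (eEq (V 32) (V 36)) (Seq (Asg 31 (V 36)) (Asg 32 (V 37)))
                          (Seq (Asg 31 (V 37)) (Asg 32 (V 36))))
  (Seq (S2 qR Z0 (V 33) (V 31)) (Seq (S2 qR Z0 (Suc (V 33)) (V 32))
  (Seq (Asg 33 (addc 2 (V 33))) (Asg 38 (Suc (V 38)))))).
(** Array [qA] doubles as a record of the vertices taken care of: those of [A] from the beginning,
    the others once they are visited. *)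
Definition coverc := For 37 (If (eAnd (eNot (eA (V 37))) (eAdj (V 36) (V 37)))
  (Seq emitc (S2 qA Z0 (V 37) eOne)) Nop).
Definition walkstep := If (Sb (V 26) (V 34))
  (Seq (Asg 37 (A2 qO Z0 (V 34))) (Seq emitc (Seq (Asg 36 (V 37)) (Seq coverc
    (Asg 34 (Suc (V 34))))))) Nop.
Definition walkinit := Seq (Asg 36 (A2 qO Z0 (V 25))) (Seq (Asg 31 (V 36)) (Seq (Asg 32 (V 36))
  (Seq (Asg 33 eOne) (Seq (Asg 38 Z0) (Asg 34 (Suc (V 25))))))).
Definition walkc := Seq walkinit (Seq coverc (Seq (Rep (Rep walkstep))
  (S2 qR Z0 Z0 (Sb (V 38) eOne)))).

Section Walk.
Variables (n : nat) (adj : rel nat) (Af : pred nat) (E0 : nat -> nat) (v0 : nat).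
Hypotheses (adjC : symmetric adj) (adjI : irreflexive adj).
Hypothesis adj_lt : forall u v, adj u v -> u < n.
Hypothesis AfN : forall v, Af v -> v < n.
Hypothesis HE : forall u v, u < n -> v < n -> (E0 (idx2 n u v.+1) != 0) = adj u v.

Definition cadj (c d : nat * nat) :=
  ((c.1 == d.1) || adj c.1 d.1) && ((c.2 == d.2) || adj c.2 d.2).
Definition has_v v (c : nat * nat) := (c.1 == v) || (c.2 == v).
Definition cov s v := cell n s qA v != 0.

(** Here [ws] is the walk written so far and [k] the number of trail moves in it; all its other
    configurations cover one vertex outside [Af] each, whence [WI_size]. The pair [(v0, v0)] stands
    in for the last configuration while [ws] is empty; it is not a configuration and is never
    written. *)
Record WI s ws k : Prop := {
  WI_E : sa s qE = E0;
  WI_out : forall t, t < size ws -> cell n s qR (1 + 2 * t) = (nth (v0, v0) ws t).1 /\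
    cell n s qR (2 + 2 * t) = (nth (v0, v0) ws t).2;
  WI_33 : sv s 33 = 1 + 2 * size ws;
  WI_38 : sv s 38 = size ws;
  WI_last : (sv s 31, sv s 32) = last (v0, v0) ws;
  WI_has : has_v (sv s 36) (last (v0, v0) ws);
  WI_adj : all (fun c => adj c.1 c.2) ws;
  WI_path : sorted cadj ws;
  WI_cov : forall v, v < n -> cov s v -> Af v \/ has (has_v v) ws;
  WI_size : size ws + cardA n Af = k + cardA n (cov s) }.

Lemma emitc_spec s ws k : WI s ws k -> adj (sv s 36) (sv s 37) ->
  let s' := exec n emitc s in exists d,
  [/\ WI s' (rcons ws d) k.+1, has_v (sv s 36) d, has_v (sv s 37) d,
     forall q, q != qR -> sa s' q = sa s q &
     forall y, y \in [:: 25; 26; 34; 36; 37] -> sv s' y = sv s y].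
Proof.
move=> [H1 H2 H3 H4 H5 H6 H7 H8 H9 H10] Hadj s'.
set c := sv s 36 in Hadj H6 *; set w := sv s 37 in Hadj *.
pose d := if sv s 32 == c then (c, w) else (w, c).
have dc : has_v c d by rewrite /d /has_v; case: ifP => _ /=; rewrite eqxx ?orbT.
have dw : has_v w d by rewrite /d /has_v; case: ifP => _ /=; rewrite eqxx ?orbT.
have Fq q : q != qR -> sa s' q = sa s q.
  by move=> /negbTE Hq; rewrite ma_frame //= Hq.
have Fv y : y \in [:: 25; 26; 34; 36; 37] -> sv s' y = sv s y.
  by rewrite !inE => /or4P [| | |/orP []] /eqP ->; rewrite mv_frame.
exists d; split=> //.
set s1 := exec n (If (eEq (V 32) (V 36)) (Seq (Asg 31 (V 36)) (Asg 32 (V 37)))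
                          (Seq (Asg 31 (V 37)) (Asg 32 (V 36)))) s.
have D1 : (sv s1 31, sv s1 32) = d.
  by rewrite /s1 exec_If ev_Eq /d; case: ifP.
have V33 : sv s1 33 = 1 + 2 * size ws by rewrite /s1 mv_frame.
have V38 : sv s1 38 = size ws by rewrite /s1 mv_frame.
have A1 : sa s1 = sa s by rewrite /s1 exec_If; case: ifP.
have Es' : s' = exec n (Seq (S2 qR Z0 (V 33) (V 31)) (Seq (S2 qR Z0 (Suc (V 33)) (V 32))
  (Seq (Asg 33 (addc 2 (V 33))) (Asg 38 (Suc (V 38)))))) s1 by [].
have covE v : cov s' v = cov s v by rewrite /cov /cell Fq.
clearbody s1; split.
- by rewrite Fq.
- move=> t; rewrite size_rcons ltnS leq_eqVlt nth_rcons.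
  have C j : cell n s' qR j = if j == (1 + 2 * size ws).+1 then sv s1 32
    else if j == 1 + 2 * size ws then sv s1 31 else cell n s qR j.
    by rewrite Es' /cell /= !idx2_eq0 V33 A1.
  rewrite !C; case/orP => [/eqP ->|Ht].
    rewrite ltnn eqxx -D1 /= eqxx.
    have -> : (1 + 2 * size ws == (1 + 2 * size ws).+1) = false by lia.
    by have -> : (2 + 2 * size ws == (1 + 2 * size ws).+1) = true by lia.
  rewrite Ht; have [<- <-] := H2 t Ht.
  have -> : (1 + 2 * t == (1 + 2 * size ws).+1) = false by lia.
  have -> : (1 + 2 * t == 1 + 2 * size ws) = false by lia.
  have -> : (2 + 2 * t == (1 + 2 * size ws).+1) = false by lia.
  by have -> : (2 + 2 * t == 1 + 2 * size ws) = false by lia.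
- by rewrite Es' /= /upd /= V33 size_rcons; lia.
- by rewrite Es' /= /upd /= V38 size_rcons.
- by rewrite last_rcons -D1 Es'.
- by rewrite last_rcons Fv.
- rewrite all_rcons H7 andbT /d; case: ifP => _ /=; rewrite -/c // adjC //.
(* The agent on [c] moves to [w], while its partner, being adjacent to [c], moves onto [c]. So [c]
   stays occupied, and any neighbour of it costs a single step. *)
- case: ws {H2 H3 H4 H9 H10 V33 V38} H5 H6 H7 H8 => [//|c0 ws] H5 H6 H7 H8.
  rewrite [rcons _ _]/= [sorted _ _]/= rcons_path; apply/andP; split; first exact: H8.
  have Hl : adj (last c0 ws).1 (last c0 ws).2 by apply: (allP H7); rewrite mem_last.
  move: H5 H6 Hl; rewrite [last (v0, v0) _]/=; case: (last c0 ws) => x y [E31 E32].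
  rewrite /has_v /cadj /d E32 /= => Hxy Hl; move: Hxy Hadj.
  have [<-|_] /= := eqVneq y c; first by move=> _ ->; rewrite Hl !orbT.
  by rewrite orbF => /eqP <- ->; rewrite adjC Hl !orbT.
- move=> v vn; rewrite covE => /(H9 v vn) [H|H]; [by left|right].
  by rewrite has_rcons H orbT.
- by rewrite size_rcons addSn H10; congr (_.+1 + _); apply: eq_count => v; rewrite covE.
Qed.

Lemma WI_eq s s' ws k : sa s' = sa s -> {in [:: 31; 32; 33; 36; 38], sv s' =1 sv s} ->
  WI s ws k -> WI s' ws k.
Proof.
move=> Ea Ev [H1 H2 H3 H4 H5 H6 H7 H8 H9 H10].
have Ec q : cell n s' q = cell n s q by rewrite /cell Ea.
have Ecov : cov s' = cov s by apply: functional_extensionality => v; rewrite /cov Ec.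
split=> //; rewrite ?Ea ?Ec ?Ecov ?Ev //.
Qed.

Lemma WI_set s ws k y v : y \notin [:: 31; 32; 33; 36; 38] -> WI s ws k -> WI (setv s y v) ws k.
Proof.
move=> Hy; apply: WI_eq => // z Hz; rewrite /= /upd ifN //.
by apply: contraNneq Hy => <-.
Qed.

Lemma cardA_set s j : j < n -> ~~ cov s j ->
  cardA n (cov (seta s qA (idx2 n 0 j) 1)) = (cardA n (cov s)).+1.
Proof.
move=> jn Nj.
have -> : cardA n (cov (seta s qA (idx2 n 0 j) 1)) = count (predU (pred1 j) (cov s)) (iota 0 n).
  by apply: eq_count => v; rewrite /cov cell_set eqxx /=; case: (v == j).
have E0' : count (predI (pred1 j) (cov s)) (iota 0 n) = 0.
  rewrite (@eq_count _ _ pred0) ?count_pred0 // => v /=.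
  by case: eqP => // ->; apply/negbTE.
have := count_predUI (pred1 j) (cov s) (iota 0 n); rewrite E0' addn0 => ->.
by rewrite count_uniq_mem ?iota_uniq // mem_iota jn.
Qed.

Lemma coverc_spec s ws k : WI s ws k -> sv s 36 < n -> let s' := exec n coverc s in
  exists ws', [/\ WI s' ws' k, forall w, adj (sv s 36) w -> cov s' w,
    forall v, cov s v -> cov s' v, forall v, has (has_v v) ws -> has (has_v v) ws' &
    sa s' qO = sa s qO /\ {in [:: 25; 26; 34; 36], sv s' =1 sv s}].
Proof.
move=> H cn s'; set c := sv s 36 in cn *.
pose J j s1 := exists ws1, [/\ WI s1 ws1 k, sv s1 36 = c, forall w, w < j -> adj c w -> cov s1 w,
   forall v, cov s v -> cov s1 v & forall v, has (has_v v) ws -> has (has_v v) ws1].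
have [ws' [K1 K2 K3 K4 K5]] : J n s'.
  apply: For_inv => //; first by exists ws; split=> //; apply: WI_set.
  move=> j s1 jn E37 [ws1 [J1 J2 J3 J4 J5]].
  rewrite exec_If ev_And ev_Not.
  have -> : ev n s1 (eA (V 37)) = cov s1 j by rewrite -E37.
  have -> : ev n s1 (eAdj (V 36) (V 37)) = adj c j.
    by rewrite -HE // -(WI_E J1) -J2 -E37.
  case: (boolP (~~ cov s1 j && adj c j)) => [/andP [Nj Hj]|Hj]; last first.
    exists ws1; split=> //; first exact: WI_set.
    move=> w; rewrite ltnS leq_eqVlt => /orP [/eqP ->|]; last exact: J3.
    by move=> cj; move: Hj; rewrite cj andbT negbK.
  rewrite -J2 -E37 in Hj.
  have [d [M1 M2 M3 M4 M5]] := emitc_spec J1 Hj.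
  rewrite exec_Seq; set s2 := exec n emitc s1 in M1 M4 M5 *; clearbody s2.
  have E2 : sv s2 37 = j by rewrite M5.
  have -> : exec n (S2 qA Z0 (V 37) eOne) s2 = seta s2 qA (idx2 n 0 j) 1 by rewrite -E2.
  set s3 := seta _ _ _ _.
  have C3 v : cov s3 v = (v == j) || cov s2 v.
    by rewrite /cov cell_set eqxx /=; case: (v == j).
  have C2 v : cov s2 v = cov s1 v by rewrite /cov /cell M4.
  exists (rcons ws1 d); split=> //.
  - apply: WI_set => //; case: M1 => H1 H2 H3 H4 H5 H6 H7 H8 H9 H10; split=> //.
      move=> v vn; rewrite C3 => /orP [/eqP ->|/(H9 v vn) //].
      by right; rewrite has_rcons -E37 M3.
    rewrite cardA_set // ?C2 //; last by rewrite H10 addSnnS.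
  - by rewrite -J2 /= /upd /= M5.
  - move=> w; rewrite ltnS leq_eqVlt => Hw cw.
    change (cov s3 w); rewrite C3 C2; case/orP: Hw => [->//|Hw]; by rewrite J3 ?orbT.
  - by move=> v Hv; change (cov s3 v); rewrite C3 C2 J4 ?orbT.
  - by move=> v Hv; rewrite has_rcons J5 ?orbT.
exists ws'; split=> //.
- by move=> w cw; apply: K3 => //; apply: adj_lt; rewrite adjC; exact: cw.
- split; first by rewrite ma_frame.
  by move=> y; rewrite !inE => /or4P [] /eqP ->; rewrite /s' mv_frame.
Qed.

Variables (o : nat -> nat) (lo hi : nat).
Hypotheses (lohi : lo <= hi) (o_walk : forall t, lo <= t < hi -> adj (o t) (o t.+1)).
Hypotheses (o_Af : forall t, lo <= t <= hi -> Af (o t)) (o_closed : o lo = o hi).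
Hypotheses (o_all : forall v, Af v -> tourset o lo hi v) (hi_n : hi - lo <= n * n).
Hypotheses (Af_dom : forall v, v < n -> Af v || dom n adj Af v) (n2 : 2 <= n).
Hypothesis ov0 : o lo = v0.

(* [t] is the next position of the trail to be visited. *)
Record TI s ws t : Prop := {
  TI_WI : WI s ws (t - lo.+1);
  TI_vars : [/\ sv s 25 = lo, sv s 26 = hi, sv s 34 = t & sv s 36 = o t.-1];
  TI_o : cell n s qO = o;
  TI_t : lo < t <= maxn hi lo.+1;
  TI_Af : forall v, v < n -> Af v -> cov s v;
  TI_dom : forall i w, lo <= i < t -> adj (o i) w -> cov s w;
  TI_in : forall i, lo <= i < t -> (lo.+1 < t) || (0 < size ws) -> has (has_v (o i)) ws }.

(** The last position [hi] is not walked to, because [o hi = o lo]. The maximum with [lo.+1] only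
    matters for a trail of length 0. *)
Lemma walkstep_spec s ws t : TI s ws t -> exists ws', TI (exec n walkstep s) ws' (minn t.+1 (maxn hi lo.+1)).
Proof.
move=> [H1 [V25 V26 V34 V36] HO Ht HA Hd Hin]; rewrite /walkstep exec_If.
have -> : ev n s (Sb (V 26) (V 34)) = (t < hi) by rewrite /ev /= V26 V34 subn_eq0 ltnNge.
case: ltnP => th; last first.
  exists ws; have -> : minn t.+1 (maxn hi lo.+1) = t by lia.
  by split.
have -> : minn t.+1 (maxn hi lo.+1) = t.+1 by lia.
rewrite 4!exec_Seq; set s1 := exec n (Asg 37 _) s.
have E37 : sv s1 37 = o t by rewrite /s1 /= /upd /= -HO -V34.
have E1 y : 37 != y -> sv s1 y = sv s y by move=> /negbTE Hy; rewrite /s1 /= /upd eq_sym Hy.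
have E1a : sa s1 = sa s by [].
clearbody s1.
have W1 : WI s1 ws (t - lo.+1) by apply: WI_eq H1 => // y; rewrite !inE => /or4P [| | |/orP []] /eqP ->; rewrite E1.
have A1 : adj (sv s1 36) (sv s1 37).
  by rewrite E37 E1 // V36 -{2}(prednK (_ : 0 < t)); [apply: o_walk; lia|lia].
have [d [M1 M2 M3 M4 M5]] := emitc_spec W1 A1.
set s2 := exec n emitc s1 in M1 M4 M5 *; clearbody s2.
set s3 := exec n (Asg 36 (V 37)) s2.
have E3 y : 36 != y -> sv s3 y = sv s2 y by move=> /negbTE Hy; rewrite /s3 /= /upd eq_sym Hy.
have E36 : sv s3 36 = o t by rewrite /s3 /= /upd /= M5.
have E3a : sa s3 = sa s2 by [].
clearbody s3.
have Wt : WI s3 (rcons ws d) (t.+1 - lo.+1).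
  have -> : t.+1 - lo.+1 = (t - lo.+1).+1 by lia.
  case: M1 => K1 K2 K3 K4 K5 K6 K7 K8 K9 K10.
  have Ec q : cell n s3 q = cell n s2 q by rewrite /cell E3a.
  have Ecov : cov s3 = cov s2 by apply: functional_extensionality => v; rewrite /cov Ec.
  split=> //; rewrite ?E3a ?Ec ?Ecov ?(E3 31) ?(E3 32) ?(E3 33) ?(E3 38) //.
  by rewrite E36 last_rcons -E37.
have tn : sv s3 36 < n by rewrite E36; apply: AfN; apply: o_Af; lia.
have [ws' [N1 N2 N3 N4 [N5 N6]]] := coverc_spec Wt tn.
set s4 := exec n coverc s3 in N1 N2 N3 N5 N6 *; clearbody s4.
set s5 := exec n (Asg 34 _) s4.
have E5 y : 34 != y -> sv s5 y = sv s4 y by move=> /negbTE Hy; rewrite /s5 /= /upd eq_sym Hy.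
have F34 : sv s5 34 = t.+1 by rewrite /s5 /= /upd /= N6 // E3 // M5 // E1 // V34.
have E5a : sa s5 = sa s4 by [].
clearbody s5.
have C5 v : cov s5 v = cov s4 v by rewrite /cov /cell E5a.
have C3 v : cov s3 v = cov s v by rewrite /cov /cell E3a M4 // E1a.
have Hd' : has_v (o t.-1) d by rewrite -V36 -E1.
have Hd2 : has_v (o t) d by rewrite -E37.
exists ws'; split.
- by apply: WI_eq N1 => // y; rewrite !inE => /or4P [| | |/orP []] /eqP ->; rewrite E5.
- by split; rewrite ?F34 // E5 // N6 ?E36 // E3 // M5 // E1.
- by rewrite -HO; apply: functional_extensionality => x; rewrite /cell E5a N5 E3a M4 // E1a.
- by lia.
- by move=> v vn Av; rewrite C5 N3 // C3 HA.
- move=> i w; have [->|it] := eqVneq i t => Hi Hw; rewrite C5.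
    by apply: N2; rewrite E36.
  by rewrite N3 // C3 (Hd i) //; lia.
- move=> i Hi _; apply: N4; rewrite has_rcons.
  have [->|it] := eqVneq i t; first by rewrite Hd2.
  have [->|it'] := eqVneq i t.-1; first by rewrite Hd'.
  by rewrite Hin ?orbT //; lia.
Qed.

Lemma walkc_spec s : sa s qE = E0 -> (forall v, v < n -> cov s v = Af v) ->
  cell n s qO = o -> sv s 25 = lo -> sv s 26 = hi -> let s' := exec n walkc s in
  exists ws, [/\ 0 < size ws, all (fun c => adj c.1 c.2) ws && sorted cadj ws,
    forall v, v < n -> has (has_v v) ws, size ws + cardA n Af = (hi - lo).-1 + n &
    cell n s' qR 0 = (size ws).-1 /\ forall t, t < size ws ->
      cell n s' qR (1 + 2 * t) = (nth (v0, v0) ws t).1 /\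
      cell n s' qR (2 + 2 * t) = (nth (v0, v0) ws t).2].
Proof.
move=> HE0 HC HO V25 V26 s'; rewrite /s' /walkc 3!exec_Seq.
set s1 := exec n walkinit s.
have A1 : sa s1 = sa s by apply: functional_extensionality => q; rewrite ma_frame.
have [W25 W26 W34 W36] : [/\ sv s1 25 = lo, sv s1 26 = hi, sv s1 34 = lo.+1 & sv s1 36 = o lo].
  by split; [rewrite mv_frame|rewrite mv_frame|rewrite -V25|rewrite -HO -V25].
have cov1 v : cov s1 v = cov s v by rewrite /cov /cell A1.
have H1 : WI s1 [::] 0.
  split=> //; rewrite ?A1 //.
  - have -> : (sv s1 31, sv s1 32) = (cell n s qO (sv s 25), cell n s qO (sv s 25)) by [].
    by rewrite HO V25 ov0.
  - by rewrite W36 /has_v /= ov0 eqxx.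
  - by move=> v vn; rewrite cov1 HC //; left.
  - rewrite !add0n; apply: eq_in_count => v; rewrite mem_iota => vn.
    by rewrite cov1 HC.
clearbody s1.
have ln : sv s1 36 < n by rewrite W36; apply/AfN/o_Af; rewrite leqnn.
have [ws1 [N1 N2 N3 N4 [N5 N6]]] := coverc_spec H1 ln.
set s2 := exec n coverc s1 in N1 N2 N3 N5 N6 *; clearbody s2.
have T2 : TI s2 ws1 lo.+1.
  split.
  - by rewrite subnn.
  - by split; rewrite N6 // ?W25 ?W26 ?W34 ?W36.
  - by rewrite -HO; apply: functional_extensionality => x; rewrite /cell N5 A1.
  - by lia.
  - by move=> v vn Av; apply: N3; rewrite cov1 HC.
  - move=> i w Hi Hw; apply: N2; have -> // : sv s1 36 = o i.
    by rewrite W36; congr o; lia.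
  - move=> i Hi; rewrite ltnn /= => Hs; have -> : i = lo by lia.
    apply/hasP; exists (last (v0, v0) ws1).
      by case: (ws1) Hs => // c ws _; exact: (mem_last c ws).
    by have := WI_has N1; rewrite N6 // W36.
pose J i s := exists ws, TI s ws (minn (lo.+1 + i) (maxn hi lo.+1)).
have [ws T3] : J (n * n) (exec n (Rep (Rep walkstep)) s2).
  rewrite exec_rep2; apply: (iter_inv (I := J)).
    by exists ws1; have -> : minn (lo.+1 + 0) (maxn hi lo.+1) = lo.+1 by lia.
  move=> i s4 _ [ws4 H4]; have [ws5 H5] := walkstep_spec H4; exists ws5.
  by have <- : minn (minn (lo.+1 + i) (maxn hi lo.+1)).+1 (maxn hi lo.+1) =
     minn (lo.+1 + i.+1) (maxn hi lo.+1) by lia.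
have ET : minn (lo.+1 + n * n) (maxn hi lo.+1) = maxn hi lo.+1 by lia.
rewrite ET in T3; set T := maxn hi lo.+1 in ET T3.
have HT : T = maxn hi lo.+1 by [].
move: T3; set s3 := exec n (Rep (Rep walkstep)) s2; clearbody s3 T => T3.
have [W _ _ _ HA Hd Hin] := T3.
have onT v : Af v -> exists2 i, lo <= i < T & o i = v.
  move=> /o_all /toursetP [//|i Hi <-].
  have [->|Ni] := eqVneq i hi; first by exists lo; [lia|].
  by exists i => //; lia.
have allcov v : v < n -> cov s3 v.
  move=> vn; case/orP: (Af_dom vn) => [Av|/(domP adj_lt) [a Aa av]]; first exact: HA.
  by have [i Hi Ei] := onT _ Aa; apply: (Hd i) => //; rewrite Ei.
(* A closed trail with one edge would be a loop. *)
have nhi : hi != lo.+1.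
  apply/eqP => E; have := o_walk (_ : lo <= lo < hi); rewrite -E -o_closed adjI => H.
  by have : false by apply: H; lia.
(* Vertex [o lo] appears only in configurations written later. There is one: a nontrivial trail has
   a second edge, and for a trivial one the second vertex of the graph lies outside [Af] and has
   been covered. *)
have big : (lo.+1 < T) || (0 < size ws).
  have [h|h] := ltnP lo.+1 hi; first by rewrite HT (_ : lo.+1 < maxn hi lo.+1); lia.
  have hl : hi = lo by lia.
  apply/orP; right; case: ws W {T3 Hin} => // W; exfalso.
  have af v : v < n -> v = o lo.
    move=> vn; case: (WI_cov W vn (allcov _ vn)) => // Av.
    by have [i Hi <-] := onT _ Av; congr o; lia.
  by have := af 0 (ltnW n2); rewrite -(af 1 n2).
have hasv v : v < n -> has (has_v v) ws.
  move=> vn; case: (WI_cov W vn (allcov _ vn)) => // Av.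
  by have [i Hi <-] := onT _ Av; apply: Hin.
exists ws; split=> //.
- by have := hasv 0 (ltnW n2); case: (ws).
- by rewrite (WI_adj W) (WI_path W).
- rewrite (WI_size W); congr (_ + _); first by rewrite HT; lia.
  rewrite /cardA -[RHS](size_iota 0 n); apply/eqP; rewrite -all_count; apply/allP => v.
  by rewrite mem_iota => /allcov.
- have C j : cell n (exec n (S2 qR Z0 Z0 (Sb (V 38) eOne)) s3) qR j =
      if j == 0 then (size ws).-1 else cell n s3 qR j.
    by rewrite /cell /= idx2_eq0 (WI_38 W) subn1.
  rewrite !C; split=> // t Ht; rewrite !C.
  exact: (WI_out W Ht).
Qed.
End Walk.

(** * The algorithm *)

Definition algorithm := Seq greedyc (Seq reversec (Seq trailc walkc)).

Lemma algorithm_wf : wfc 40 8 algorithm. Proof. by vm_compute. Qed.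
Lemma algorithm_dep : cdep algorithm <= 30. Proof. by vm_compute. Qed.

Lemma tot_even n mu : msym mu -> (forall u, mu u u = 0) -> ~~ odd (tot n mu).
Proof.
move=> sy d0; rewrite /tot /deg; suff H m : ~~ odd (\sum_(v < m) \sum_(w < m) mu v w) by exact: H.
elim: m => [|m IH]; first by rewrite big_ord0.
have -> : \sum_(v < m.+1) \sum_(w < m.+1) mu v w =
    \sum_(v < m) \sum_(w < m) mu v w + (\sum_(v < m) mu m v + \sum_(v < m) mu m v).
  rewrite big_ord_recr /= big_ord_recr /= d0 addn0 addnA; congr (_ + _).
  rewrite -big_split /=; apply: eq_bigr => v _; rewrite big_ord_recr /=.
  by congr (_ + _); apply: sy.
by rewrite addnn oddD odd_double addbF.
Qed.

(** * Correctness on a given graph, compared with an optimal walk *)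

Section Correctness.
Variables (n : nat) (e : rel 'I_n).
Hypotheses (n2 : 2 <= n) (eC : symmetric e) (eI : irreflexive e).
Hypothesis econn : forall x y, connect e x y.

Local Notation adj := (edge_nat e : rel nat).

Lemma adjP u v : reflect (exists a b : 'I_n, [/\ val a = u, val b = v & e a b]) (adj u v).
Proof.
apply: (iffP existsP) => [[a /existsP [b /and3P [/eqP <- /eqP <- H]]]|[a [b [<- <- H]]]].
  by exists a, b.
by exists a; apply/existsP; exists b; rewrite !eqxx.
Qed.

Lemma adjE (a b : 'I_n) : adj a b = e a b.
Proof.
apply/adjP/idP => [[a' [b' [/val_inj -> /val_inj -> //]]]|H]; by exists a, b.
Qed.

Lemma adj_sym : symmetric adj.
Proof.
by move=> u v; apply/adjP/adjP => [] [a [b [<- <- H]]]; exists b, a; rewrite eC.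
Qed.

Lemma adj_irr : irreflexive adj.
Proof.
by move=> u; apply/adjP => [] [a [b [<- /val_inj -> H]]]; rewrite eI in H.
Qed.

Lemma adj_ltn u v : adj u v -> u < n.
Proof. by move=> /adjP [a [b [<- _ _]]]; exact: (ltn_ord a). Qed.

Lemma adj_conn (S : pred nat) : S 0 -> (forall u v, S u -> adj u v -> S v) ->
  forall v, v < n -> S v.
Proof.
move=> S0 HS v vn; have n0 : 0 < n by lia.
have /connectP [p Hp Hl] := econn (Ordinal n0) (Ordinal vn).
have -> : v = val (last (Ordinal n0) p) by rewrite -Hl.
have {Hl} : S (val (Ordinal n0)) by [].
elim: p (Ordinal n0) Hp => [|y p IH] x //= /andP [xy Hp] Sx.
by apply: IH => //; apply: HS Sx _; rewrite adjE.
Qed.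

Lemma input_adj u v : u < n -> v < n -> input_regs e (u * n + v).+1 = adj u v.
Proof.
move=> un vn; rewrite /input_regs /=.
have -> : u * n + v < n * n by nia.
by rewrite divnMDl ?modnMDl ?divn_small ?modn_small ?addn0 //; lia.
Qed.

Section Optimum.
Variables (s : seq ('I_n * 'I_n)).
Hypothesis Hs : spanning_walk e s.

Let i0 : 'I_n := Ordinal (ltnW n2).
Definition optC t : nat * nat := let p := nth (i0, i0) s t in (val p.1, val p.2).

Lemma optC_adj t : t <= walk_len s -> adj (optC t).1 (optC t).2.
Proof.
move: Hs; rewrite /spanning_walk /transition_walk /walk_len => /andP [/andP [Ha Hp] _] tl.
rewrite adjE; apply: (allP Ha); apply: mem_nth.
by case: (s) Hp tl.
Qed.

Lemma optC_step t : t < walk_len s ->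
  (((optC t).1 == (optC t.+1).1) || adj (optC t).1 (optC t.+1).1) /\
  (((optC t).2 == (optC t.+1).2) || adj (optC t).2 (optC t.+1).2).
Proof.
move: Hs; rewrite /spanning_walk /transition_walk /walk_len /optC => /andP [/andP [_ Hp] _].
case: (s) Hp => // x p Hp tl; rewrite /= in tl.
have /andP [] : config_adj e (nth (i0, i0) (x :: p) t) (nth (i0, i0) p t) by apply: (pathP _ Hp).
by rewrite !adjE.
Qed.

Lemma optC_span v : v < n -> exists2 t, t <= walk_len s & (optC t).1 = v \/ (optC t).2 = v.
Proof.
move=> vn; move: Hs => /andP [_ /forallP /(_ (Ordinal vn)) /hasP [p ps Hp]].
exists (index p s); first by rewrite /walk_len; move: ps; rewrite -index_mem; case: (s) => //= *; lia.
by rewrite /optC nth_index //; case/orP: Hp => /eqP ->; [left|right].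
Qed.

Lemma optC_dn : ~ has_C4 e -> dn optC (walk_len s) (walk_len s) = 0.
Proof.
move=> H; apply/eqP; rewrite -leqn0 leqNgt -has_count; apply/negP => /hasP [t].
rewrite mem_iota add0n => /andP [_ tl] D; apply: H.
have Cs1 t' : t' < walk_len s -> _ := fun h => proj1 (optC_step h).
have Cs2 t' : t' < walk_len s -> _ := fun h => proj2 (optC_step h).
have [a1 a2 d1 d2] := dbl_square (ltnW n2) Cs1 Cs2 tl D.
have b1 := optC_adj (ltnW tl); have b2 := optC_adj tl.
rewrite /optC /= in a1 a2 d1 d2 b1 b2.
move: a1 a2 d1 d2 b1 b2; set p := nth _ _ t; set q := nth _ _ t.+1.
rewrite !adjE => a1 a2 d1 d2 b1 b2.
have ne (x y : 'I_n) : e x y -> x != y by move=> Hxy; apply/eqP => E; rewrite E eI in Hxy.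
exists p.1, q.1, q.2, p.2; split=> //; last by split; rewrite eC.
rewrite /= !inE !negb_or (ne _ _ a1) (ne _ _ b1) (ne _ _ b2) -!val_eqE d1.
by rewrite (eq_sym (val q.1)) d2 (eq_sym (val q.2)) val_eqE (ne _ _ a2).
Qed.
End Optimum.

(** The walk that the algorithm outputs itself rules out the default value 0 of [h2]. *)
Lemma h2_opt w : spanning_walk e w -> exists s, spanning_walk e s /\ walk_len s = h2 e.
Proof.
move=> Hw; rewrite /h2; case: excluded_middle_informative => [H|[]]; last first.
  exists (walk_len w); apply/existsP.
  have sw : size w == (walk_len w).+1.
    by move: Hw => /andP [/andP [_]]; rewrite /walk_len; case: (w).
  by exists (Tuple sw).
case: ex_minnP => l /existsP [s Hs] _; exists s; split=> //.
by rewrite /walk_len size_tuple.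
Qed.

Lemma walk_correct (ws : seq (nat * nat)) (R : regs) :
  0 < size ws -> all (fun c => adj c.1 c.2) ws && sorted (cadj adj) ws ->
  (forall v, v < n -> has (has_v v) ws) -> R 0 = (size ws).-1 ->
  (forall t, t < size ws -> R (1 + 2 * t) = (nth (0, 0) ws t).1 /\
     R (2 + 2 * t) = (nth (0, 0) ws t).2) ->
  exists w : seq ('I_n * 'I_n), [/\ map (fun p => (val p.1, val p.2)) w = output_walk R,
    spanning_walk e w & walk_len w = (size ws).-1].
Proof.
move=> ws0 /andP [Ha Hs] Hv R0 HR.
pose io k : 'I_n := insubd (Ordinal (ltnW n2)) k.
have ioK k : k < n -> val (io k) = k by move=> kn; rewrite val_insubd kn.
pose w := [seq (io c.1, io c.2) | c <- ws].
have wsn c : c \in ws -> c.1 < n /\ c.2 < n.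
  by move=> /(allP Ha) H; split; [exact: adj_ltn H|rewrite adj_sym in H; exact: adj_ltn H].
have Ew : map (fun p => (val p.1, val p.2)) w = ws.
  rewrite -map_comp -[RHS]map_id; apply/eq_in_map => c /wsn [h1 h2] /=.
  by rewrite !ioK //; case: c {h1 h2}.
have adjio u v : u < n -> v < n -> e (io u) (io v) = adj u v.
  by move=> un vn; rewrite -adjE !ioK.
exists w; split; last by rewrite /walk_len size_map.
- rewrite Ew /output_walk R0 prednK //; apply: (@eq_from_nth _ (0, 0)) => [|t Ht].
    by rewrite size_mkseq.
  rewrite nth_mkseq //; have [-> ->] := HR t Ht.
  by case: (nth _ _ _).
- apply/andP; split; first (apply/andP; split).
  + apply/allP => p /mapP [c cw ->]; have [h1 h2] := wsn c cw.
    by rewrite /config /= adjio // (allP Ha).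
  + rewrite /w; case: ws ws0 Hs wsn {Ha Hv R0 HR w Ew} => // c ws _ /= Hs wsn.
    rewrite path_map; apply: (sub_in_path _ (allss (c :: ws)) Hs) => x y /wsn [x1 x2] /wsn [y1 y2].
    rewrite /cadj /config_adj /= !adjio // -!val_eqE /=.
    by rewrite !ioK.
  + apply/forallP => v; have /hasP [c cw Hc] := Hv v (ltn_ord v); have [h1 h2] := wsn c cw.
    apply/hasP; exists (io c.1, io c.2); first by apply/mapP; exists c.
    by move: Hc; rewrite /has_v -!val_eqE /= !ioK.
Qed.

Lemma algorithm_correct R : post qR algorithm e R ->
  exists w : seq ('I_n * 'I_n), [/\ map (fun p => (val p.1, val p.2)) w = output_walk R,
    spanning_walk e w, 21 * walk_len w <= 62 * h2 e
    & ~ has_C4 e -> walk_len w <= 2 * h2 e].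
Proof.
case=> s0 [HE0 H00 HR]; have n0 : 0 < n by lia.
have idxn i j : n * n <= idx2 n i j by rewrite /idx2 mulnDl addnAC leq_addl.
have HE u v : u < n -> v < n -> (sa s0 qE (idx2 n u v.+1) != 0) = adj u v.
  move=> un vn.
  have -> : idx2 n u v.+1 = n * n + (u * n + v).+1 by rewrite /idx2; lia.
  rewrite HE0; last by nia.
  by rewrite (input_adj un vn); case: (adj u v).
have Z q k : 0 < q -> cell n s0 q k = 0 by move=> q0; apply: H00.
have [A [l [c [r [G HG [nE nT nR]]]]]] :=
  greedyc_spec n0 adj_sym adj_irr adj_ltn HE (erefl _) (fun k => Z qA k isT) (fun k => Z qW k isT).
have [A0 AN Hc cA] := greedy_basic adj_sym adj_irr adj_ltn n0 G.
have [Ho Ec] := greedy_okl n0 adj_sym adj_irr adj_ltn G.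
have cAn : cardA n A <= n by apply: leq_trans (count_size _ _) _; rewrite size_iota.
move: HR; rewrite /algorithm; set s4 := exec n _ s0.
have -> : s4 = exec n walkc (exec n trailc (exec n reversec (exec n greedyc s0))) by [].
have FM q : q \in [:: qM; qD] -> sa (exec n greedyc s0) q = sa s0 q.
  by rewrite !inE => /orP [] /eqP ->; rewrite ma_frame.
move: HG FM; set s1 := exec n greedyc s0; clearbody s1 => -[G1 G2 G3 G4] FM.
have RS1 : RS n adj A c s1 l.
  have D0 v : deg n (fun _ _ => 0) v = 0 by rewrite /deg big1.
  have T0 : tot n (fun _ _ => 0) = 0 by rewrite /tot big1 // => i _; rewrite D0.
  exists A, (fun _ _ => 0); split=> //.
    split=> [u v un vn|v vn]; first by rewrite FM // H00.
    by rewrite D0 /cell FM // H00.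
  split=> //.
  - by move=> v vn _; rewrite D0.
  - by move=> v Av; exact: rch0.
  - by rewrite T0 Ec.
have sl : size l <= n by have := okl_size n0 Ho; lia.
have [mu [[HM _] [H1 H2 H3 H4 H5]]] := reversec_spec n0 adj_sym adj_irr RS1 sl.
have F2 q : q \in [:: qE; qA] -> sa (exec n reversec s1) q = sa s1 q.
  by rewrite !inE => /orP [] /eqP ->; rewrite ma_frame.
move: HM F2; set s2 := exec n reversec s1; clearbody s2 => HM F2.
have ev : ~~ odd (tot n mu).
  apply: tot_even => // u; apply/eqP; rewrite -leqn0 leqNgt; apply/negP => /H2.
  by rewrite adj_irr.
rewrite /lcost muln0 addn0 in H5.
(* The edge bound [M] is taken to be [c]. The product is at most [4 (n - 1) * 2 n], so
   [8 n ^ 2 <= n ^ 5] suffices, which needs [n >= 2]. *)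
have fuel : tot n mu * c.+1 + 1 <= n ^ 5.
  have h1 : tot n mu <= 4 * n.-1 by lia.
  have h2 : c.+1 <= 2 * n by lia.
  have h3 := leq_mul h1 h2.
  have h4 : 2 ^ 3 <= n ^ 3 by rewrite leq_exp2r.
  have h5 : 8 * n ^ 2 <= n ^ 5 by rewrite -[5]/(3 + 2) expnD leq_mul2r h4 orbT.
  rewrite -mulnn in h5; apply: leq_trans h5; nia.
have [mu' [[_ HI] T']] := trailc_spec adj_irr AN H5 HM H1 H2 H3 H4 ev (erefl _) A0 fuel.
have F3 q : q \in [:: qE; qA] -> sa (exec n trailc s2) q = sa s2 q.
  by rewrite !inE => /orP [] /eqP ->; rewrite ma_frame.
move: HI F3; set s3 := exec n trailc s2; clearbody s3 => HI F3.
have [oc oa] := EI_done AN HI T'.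
have le := EI_le HI; have tt := EI_tot HI; rewrite T' add0n in tt.
have hin : sv s3 26 - sv s3 25 <= n * n by nia.
have E3 : sa s3 qE = sa s0 qE by rewrite F3 // F2.
have C3 v : v < n -> cov n s3 v = A v.
  by move=> vn; rewrite -G2 // /cov /cell F3 // F2.
have AD := all_dominated adj_ltn adj_conn A0 nR.
have [ws [w0 wp wv wsz [o0 ot]]] := walkc_spec adj_sym adj_irr adj_ltn AN HE le (EI_walk HI)
  (EI_Af HI) oc oa hin AD n2 (erefl _) E3 C3 (erefl _) (erefl _) (erefl _).
move=> HR.
(* The predecessor in [(hi - lo).-1] truncates only for a trivial trail, and then [A] has a single
   vertex. This is why that case is separate in [Hcond]. *)
have cA1 : sv s3 26 = sv s3 25 -> cardA n A <= 1.
  move=> E; rewrite /cardA -size_filter -[1]/(size [:: cell n s3 qO (sv s3 25)]).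
  apply: uniq_leq_size; first by rewrite filter_uniq ?iota_uniq.
  move=> v; rewrite mem_filter => /andP [/oa /toursetP H _].
  by have [t Ht <-] := H le; rewrite inE (_ : t = sv s3 25) //; lia.
(* The machine returns only the first [n * n] cells of the output array. They suffice, as the walk
   has at most [2 n - 3] configurations and [4 n - 6 < n * n]. *)
have wsn : 2 * size ws < n * n by nia.
have [w [W1 W2 W3]] : exists w : seq ('I_n * 'I_n),
  [/\ map (fun p => (val p.1, val p.2)) w = output_walk R, spanning_walk e w &
   walk_len w = (size ws).-1].
  apply: walk_correct => //; first by rewrite HR ?muln_gt0 ?n0 // -o0.
  move=> t Ht; have [h1 h2] := ot t Ht.
  rewrite !HR; [|lia|lia].
  by move: h1 h2; rewrite !(set_nth_default (0, 0) (cell n _ _ _, _) Ht) => <- <-.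
have [s [Hs sl2]] := h2_opt W2.
have Hcond : if cardA n A == 1 then walk_len w + 2 <= n
  else walk_len w + 2 + cardA n A <= c + n.
  rewrite W3; case: eqP => [c1|/eqP c1]; first by lia.
  by lia.
have [B1 B2] := greedy_bound adj_sym adj_irr adj_ltn n0 (optC_adj Hs)
  (fun t h => proj1 (optC_step Hs h)) (fun t h => proj2 (optC_step Hs h))
  (optC_span Hs) adj_conn G nE nT nR Hcond.
rewrite -sl2; exists w; split=> // C4; apply: B2; exact: optC_dn.
Qed.
End Correctness.

Theorem theorem4 :
  exists (P : seq instr) (c k : nat),
  forall (n : nat) (e : rel 'I_n),
    2 <= n -> symmetric e -> irreflexive e -> (forall x y, connect e x y) ->
    exists R : regs,
      run P (c * n ^ k) (0, input_regs e) = Some R /\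
      exists w : seq ('I_n * 'I_n),
        [/\ map (fun p => (val p.1, val p.2)) w = output_walk R,
            spanning_walk e w,
            21 * walk_len w <= 62 * h2 e
          & ~ has_C4 e -> walk_len w <= 2 * h2 e].
Proof.
(* Room for 40 variables, 30 temporaries and the 8 arrays. The work space ends at register 71, so
   the decision tree branches on 70 input bits, a number independent of the graph. *)
have [P [c [k H]]] := @machine 40 30 8 qR algorithm isT isT isT isT algorithm_wf algorithm_dep.
exists P, c, k => n e n2 eC eI econn.
have [R [HR HP]] := H n e n2 eI.
exists R; split=> //; exact: algorithm_correct HP.
Qed.
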